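(* Let $\frac14<s_1<\frac34$ and $s_1<s_2<1$. Suppose that: (1) $f:\mathbb{R}^3\to\mathbb{R}$ is nontrivial, $f\in L^1(\mathbb{R}^3)$ and $(-\Delta)^{1-s_1}f\in L^2(\mathbb{R}^3)$; $\mathcal{K}:\mathbb{R}^3\to\mathbb{R}$, $\mathcal{K}\in L^1(\mathbb{R}^3)$, $(-\Delta)^{1-s_1}\mathcal{K}\in L^2(\mathbb{R}^3)$ and $Q:=\|(-\Delta)^{1-s_1}\mathcal{K}\|_{L^2(\mathbb{R}^3)}>0$. (2) $M>0$ and, for $j=1,2$, $g_j:\mathbb{R}\to\mathbb{R}$ satisfies $g_j(0)=0$, $g_j'(0)=0$, $g_j\in D_M$ (that is, $g_j\in C^2(I)$ with $\|g_j\|_{C^2(I)}\le M$), and $g_j$ does not vanish identically on the interval $I$. Let $\rho\in(0,1]$ and let $\varepsilon$ satisfy $0<\varepsilon\le\rho/H$, where $$H=2M\big(\|u_0\|_{H^2(\mathbb{R}^3)}+1\big)^2\left[\frac{3\,\|\mathcal{K}\|_{L^1(\mathbb{R}^3)}^2\big(\|u_0\|_{H^2(\mathbb{R}^3)}+1\big)^{\frac{8s_1}{3}-2}}{(3-4s_1)\,s_1^{\frac{4s_1}{3}}\,\pi^{\frac{8s_1}{3}}\,2^{4s_1+\frac{8s_1}{3}}}+\frac{Q^2}{4}\right]^{\frac12}.$$ For $j=1,2$ let $u_{p,j}$ be the unique fixed point of the map $t_{g_j}:B_\rho\to B_\rho$, which is a strict contraction for all such $\varepsilon$, and let $u_j(x)=u_0(x)+u_{p,j}(x)$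 be the resulting solution of $$-[(-\Delta)^{s_1}+(-\Delta)^{s_2}]u+\varepsilon\int_{\mathbb{R}^3}\mathcal{K}(x-y)g_j(u(y))\,dy+f(x)=0 .$$ Then for all $\varepsilon$ with $0<\varepsilon\le\rho/H$ the estimate $$\|u_1-u_2\|_{H^2(\mathbb{R}^3)}\le\frac{\varepsilon}{1-\varepsilon\sigma}\big(\|u_0\|_{H^2(\mathbb{R}^3)}+1\big)^2\left[\frac{\|\mathcal{K}\|_{L^1(\mathbb{R}^3)}^2\big(\|u_0\|_{H^2(\mathbb{R}^3)}+1\big)^{\frac{8s_1}{3}-2}}{s_1^{\frac{4s_1}{3}}\,\pi^{\frac{8s_1}{3}}\,2^{4s_1+\frac{8s_1}{3}}}\,\frac{3}{3-4s_1}+\frac{Q^2}{4}\right]^{\frac12}\|g_1-g_2\|_{C^2(I)}$$ holds, where $$\sigma:=M\big(\|u_0\|_{H^2(\mathbb{R}^3)}+1\big)\left\{\frac{\|\mathcal{K}\|_{L^1(\mathbb{R}^3)}^2\big(\|u_0\|_{H^2(\mathbb{R}^3)}+1\big)^{\frac{8s_1}{3}-2}}{s_1^{\frac{4s_1}{3}}\,\pi^{\frac{8s_1}{3}}\,2^{4s_1}}\,\frac{3}{3-4s_1}+Q^2\right\}^{\frac12}.$$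
   Context: Fractional powers $(-\Delta)^{s}$ on $\mathbb{R}^3$ are defined by the Fourier symbol $|p|^{2s}$, with $\widehat\phi(p)=(2\pi)^{-3/2}\int_{\mathbb{R}^3}\phi(x)e^{-ipx}dx$. Functions are real valued. For $0<s\le 1$, $H^{2s}(\mathbb{R}^3)=\{u:\mathbb{R}^3\to\mathbb{R}\mid u\in L^2(\mathbb{R}^3),\ (-\Delta)^{s}u\in L^2(\mathbb{R}^3)\}$ with norm $\|u\|_{H^{2s}(\mathbb{R}^3)}^2=\|u\|_{L^2(\mathbb{R}^3)}^2+\|(-\Delta)^{s}u\|_{L^2(\mathbb{R}^3)}^2$; in particular $\|u\|_{H^2(\mathbb{R}^3)}^2=\|u\|_{L^2(\mathbb{R}^3)}^2+\|\Delta u\|_{L^2(\mathbb{R}^3)}^2$. $c_e>0$ denotes the constant of the Sobolev embedding $\|u\|_{L^\infty(\mathbb{R}^3)}\le c_e\|u\|_{H^2(\mathbb{R}^3)}$. $u_0$ denotes the unique solution in $H^{2s_2}(\mathbb{R}^3)$ of the linear equation $[(-\Delta)^{s_1}+(-\Delta)^{s_2}]u_0=f$; under the hypotheses on $f$ it exists, is nontrivial and belongs to $H^2(\mathbb{R}^3)$. $B_\rho:=\{u\in H^2(\mathbb{R}^3)\mid \|u\|_{H^2(\mathbb{R}^3)}\le\rho\}$, $0<\rho\le1$, with the metric induced by the $H^2(\mathbb{R}^3)$ norm. $I:=\big[-c_e\|u_0\|_{H^2(\mathbb{R}^3)}-c_e,\ c_e\|u_0\|_{H^2(\mathbb{R}^3)}+c_e\big]$.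 $D_M:=\{g\in C^2(I)\mid \|g\|_{C^2(I)}\le M\}$, where $\|g\|_{C^2(I)}:=\|g\|_{C(I)}+\|g'\|_{C(I)}+\|g''\|_{C(I)}$ and $\|g\|_{C(I)}:=\max_{z\in I}|g(z)|$. For $g$ as in hypothesis (2), the map $t_g:B_\rho\to B_\rho$ sends $v\in B_\rho$ to the unique solution $u\in B_\rho$ of $$[(-\Delta)^{s_1}+(-\Delta)^{s_2}]u(x)=\varepsilon\int_{\mathbb{R}^3}\mathcal{K}(x-y)\,g(u_0(y)+v(y))\,dy;$$ for $0<\varepsilon\le\rho/H$ it is well defined and a strict contraction. *)

(* Defs.v *)
From HB Require Import structures.
From mathcomp Require Import all_boot all_order all_algebra.
From mathcomp Require Import all_classical all_reals all_analysis.

Set Implicit Arguments.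
Unset Strict Implicit.
Unset Printing Implicit Defensive.
Import Order.TTheory GRing.Theory Num.Theory.
Import numFieldNormedType.Exports.
Local Open Scope classical_set_scope.
Local Open Scope ring_scope.

(* The sigma-finite structure of a product measure is not found by canonical
   structure inference, so it is declared by hand for leb2 and leb3. *)
Lemma product_measure_sigma_finite d1 d2 (T1 : measurableType d1)
    (T2 : measurableType d2) (R : realType)
    (m1 : {sigma_finite_measure set T1 -> \bar R})
    (m2 : {sigma_finite_measure set T2 -> \bar R}) :
  sigma_finite setT (m1 \x m2)%E.
Proof.
have /sigma_finiteP[F [TF ndF Foo]] := sigma_finiteT m1.
have /sigma_finiteP[G [TG ndG Goo]] := sigma_finiteT m2.
exists (fun n => F n `*` G n).
  rewrite -setXTT TF TG predeqE => -[x y]; split.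
    move=> [/= [n _ Fnx] [k _ Gky]]; exists (maxn n k) => //; split.
    - by move: x Fnx; exact/subsetPset/ndF/leq_maxl.
    - by move: y Gky; exact/subsetPset/ndG/leq_maxr.
  by move=> [n _ []/= ? ?]; split; exists n.
move=> k; have [? ?] := Foo k; have [? ?] := Goo k.
split; first exact: measurableX.
by rewrite product_measure1E// lte_mul_pinfty// ge0_fin_numE.
Qed.

Definition leb2 {R : realType} :
    set (measurableTypeR R * measurableTypeR R) -> \bar R :=
  (@lebesgue_measure R \x @lebesgue_measure R)%E.
HB.instance Definition _ (R : realType) := Measure.on (@leb2 R).
HB.instance Definition _ (R : realType) :=
  Measure_isSigmaFinite.Build _ _ _ (@leb2 R)
    (product_measure_sigma_finite (@lebesgue_measure R) (@lebesgue_measure R)).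

(* Functions on R3 stand for Borel representatives of their classes modulo
   almost everywhere equality. *)
Notation R3 R :=
  (measurableTypeR R * measurableTypeR R * measurableTypeR R)%type.

Definition leb3 {R : realType} : set (R3 R) -> \bar R :=
  (@leb2 R \x @lebesgue_measure R)%E.
HB.instance Definition _ (R : realType) := Measure.on (@leb3 R).
HB.instance Definition _ (R : realType) :=
  Measure_isSigmaFinite.Build _ _ _ (@leb3 R)
    (product_measure_sigma_finite (@leb2 R) (@lebesgue_measure R)).

Section FractionalLaplacian.
Context {R : realType}.
Local Notation mu := (@leb3 R).
Implicit Types (phi w u : R3 R -> R) (p x : R3 R) (s : R).

Definition dot p x : R := p.1.1 * x.1.1 + p.1.2 * x.1.2 + p.2 * x.2.

Definition enorm p : R := Num.sqrt (dot p p).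

Definition norm_Lp (q : \bar R) u : R := fine ('N[mu]_q [EFin \o u])%E.

(* Real and imaginary parts of
   (2 pi)^(-3/2) \int phi(x) exp(- i p.x) dx, for phi in L^1. *)
Definition fourier_re phi p : R :=
  (2 * pi) `^ (- (3 / 2)) * \int[mu]_x (phi x * cos (dot p x)).
Definition fourier_im phi p : R :=
  - ((2 * pi) `^ (- (3 / 2)) * \int[mu]_x (phi x * sin (dot p x))).

Definition truncate (n : nat) phi x : R :=
  if enorm x <= n%:R then phi x else 0.

(* a + i b is a representative of the Fourier transform of phi: given by the
   integral when phi is in L^1, and by the L^2 limit of the transforms of the
   truncations of phi when phi is in L^2. *)
Definition is_fourier phi (a b : R3 R -> R) : Prop :=
  [/\ measurable_fun setT a, measurable_fun setT b &
      (phi \in Lfun mu 1 /\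
       {ae mu, forall p, a p = fourier_re phi p /\ b p = fourier_im phi p}) \/
      (phi \in Lfun mu 2%:E /\
       ((fun n => 'N[mu]_2%:E [EFin \o (fourier_re (truncate n phi) \- a)%R])%E
          @ \oo --> 0%E) /\
       ((fun n => 'N[mu]_2%:E [EFin \o (fourier_im (truncate n phi) \- b)%R])%E
          @ \oo --> 0%E))].

(* (-Delta)^s has Fourier symbol |p|^(2 s); w is real valued and in L^2. *)
Definition is_frac_lap s phi w : Prop :=
  w \in Lfun mu 2%:E /\
  exists a b, is_fourier phi a b /\
    is_fourier w (fun p => enorm p `^ (2 * s) * a p)
                 (fun p => enorm p `^ (2 * s) * b p).

Definition frac_lap_L2 s phi : Prop := exists w, is_frac_lap s phi w.

(* Determined up to almost everywhere equality; the zero function when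
   (-Delta)^s phi is not in L^2. *)
Definition frac_lap s phi : R3 R -> R :=
  xget (cst 0) [set w | is_frac_lap s phi w].

(* The space H^{2s} and its norm; H^2 is the case s = 1. *)
Definition in_H2s s u : Prop := u \in Lfun mu 2%:E /\ frac_lap_L2 s u.

Definition norm_H2s s u : R :=
  Num.sqrt (norm_Lp 2%:E u ^+ 2 + norm_Lp 2%:E (frac_lap s u) ^+ 2).

Definition in_H2 := in_H2s 1.
Definition norm_H2 := norm_H2s 1.

Definition sobolev_const (c : R) : Prop :=
  0 < c /\ forall u, in_H2 u ->
    ('N[mu]_+oo [EFin \o u] <= (c * norm_H2 u)%:E)%E.

Definition solves (s1 s2 : R) u (h : R3 R -> R) : Prop :=
  [/\ frac_lap_L2 s1 u, frac_lap_L2 s2 u &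
      {ae mu, forall x, frac_lap s1 u x + frac_lap s2 u x = h x}].

Definition convolution (K h : R3 R -> R) x : R := \int[mu]_y (K (x - y) * h y).

Definition ballH2 (rho : R) u : Prop := in_H2 u /\ norm_H2 u <= rho.

(* Graph of the map t_g of the ball of radius rho into itself. It is given as
   a relation because solutions are unique only almost everywhere; its fixed
   points are the u with t_graph s1 s2 eps rho K u0 g u u. *)
Definition t_graph (s1 s2 eps rho : R) (K u0 : R3 R -> R) (g : R -> R)
    (v u : R3 R -> R) : Prop :=
  [/\ ballH2 rho v, ballH2 rho u &
      solves s1 s2 u (fun x => eps * convolution K (fun y => g (u0 y + v y)) x)].

End FractionalLaplacian.

Section C2Interval.
Context {R : realType}.
Implicit Types (I : set R) (g : R -> R).

Definition dquot g (z y : R) : R := (g y - g z) / (y - z).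

(* Derivatives relative to I (one-sided at the end points of an interval). *)
Definition derivable_on I g : Prop :=
  forall z, I z -> cvg (dquot g z y @[y --> within I z^']).

Definition deriv_on I g (z : R) : R := lim (dquot g z y @[y --> within I z^']).

Definition C2_on I g : Prop :=
  [/\ derivable_on I g, derivable_on I (deriv_on I g) &
      {within I, continuous (deriv_on I (deriv_on I g))}].

(* For g continuous on a compact nonempty I the supremum is a maximum. *)
Definition normC I g : R := sup [set `|g z| | z in I].

Definition normC2 I g : R :=
  normC I g + normC I (deriv_on I g) + normC I (deriv_on I (deriv_on I g)).

Definition DM I (M : R) g : Prop := C2_on I g /\ normC2 I g <= M.

Definition nonlinearity I (M : R) g : Prop :=
  [/\ g 0 = 0, derive1 g 0 = 0, DM I M g & exists2 z, I z & g z != 0].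

End C2Interval.

Section Constants.
Context {R : realType}.
Implicit Types s M n k Q : R.

(* In the constants below n is the H^2 norm of u0, k the L^1 norm of K, and
   Q the L^2 norm of (-Delta)^(1 - s1) K. *)
Definition bracket s1 n k Q : R :=
  k ^+ 2 * (n + 1) `^ (8 * s1 / 3 - 2) /
    (s1 `^ (4 * s1 / 3) * pi `^ (8 * s1 / 3) * 2 `^ (4 * s1 + 8 * s1 / 3))
  * (3 / (3 - 4 * s1)) + Q ^+ 2 / 4.

Definition Hconst s1 M n k Q : R :=
  2 * M * (n + 1) ^+ 2 * Num.sqrt (bracket s1 n k Q).

Definition sigma_const s1 M n k Q : R :=
  M * (n + 1) * Num.sqrt
    (k ^+ 2 * (n + 1) `^ (8 * s1 / 3 - 2) /
       (s1 `^ (4 * s1 / 3) * pi `^ (8 * s1 / 3) * 2 `^ (4 * s1))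
     * (3 / (3 - 4 * s1)) + Q ^+ 2).

End Constants.

(* Main.v *)
(** Write u_j = u_0 + u_{p,j} and w = u_1 - u_2.  By the Sobolev embedding both u_j take values in I
    almost everywhere, and w solves [(-Delta)^{s1} + (-Delta)^{s2}] w = eps K * h with
    h = (g_1(u_1) - g_1(u_2)) + (g_1 - g_2)(u_2); since g_j(0) = g_j'(0) = 0, Taylor's formula bounds
    the L^1 and L^2 norms of the two summands by multiples of |w|_{H^2} and of |g_1 - g_2|_{C^2}.
    On the Fourier side the symbol |p|^{2 s1} + |p|^{2 s2} is at least |p|^{2 s1}.  In |w|_{L^2}, low
    frequencies are bounded with |h^|_oo <= c |h|_{L^1} and the integrability of |p|^{-4 s1} near 0
    (this is where s1 < 3/4 enters), high frequencies with Plancherel; the cut-off radius is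
    optimized.  In |Delta w|_{L^2} the multiplier |p|^{2 - 2 s1} is put on the kernel, which gives Q.
    Hence |w| <= eps (sigma |w| + B |g_1 - g_2|), and eps sigma < 1 allows one to solve for |w|.
    Plancherel's theorem is obtained for the real Hartley transform, with kernel cos + sin, whose even
    and odd parts give the real and imaginary parts of the Fourier transform. *)
Require Import Defs.
From mathcomp Require Import all_boot all_order all_algebra.
From mathcomp Require Import all_classical all_reals all_analysis.
From mathcomp Require Import measurable_realfun ess_sup_inf.
From mathcomp Require Import ring lra.
Set Implicit Arguments.
Unset Strict Implicit.
Unset Printing Implicit Defensive.
Import Order.TTheory GRing.Theory Num.Theory.
Import numFieldNormedType.Exports.
Local Open Scope classical_set_scope.
Local Open Scope ring_scope.

(** * Integrable and square integrable functions *)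

Section L1L2.
Context d (T : measurableType d) (R : realType) (mu : {measure set T -> \bar R}).
Implicit Types f g h : T -> R.

(** The kernel cos + sin is symmetric and its transform inverts itself, so one L^2 isometry of real
    functions carries the Fourier analysis. Inversion comes from damping the frequency integral by a
    product of one-dimensional exponentials, which turns it into convolution with a product of
    Poisson kernels. The equation is never solved for the two summands of h separately: the triangle
    inequality for |w| is carried out pointwise in frequency, with weights 1 + t and 1 + 1/t and a
    final choice of t, and each summand keeps its own cut-off radius. The nonlinearities are
    controlled on I only and may be non-measurable elsewhere, so they are replaced by their
    restrictions to I extended by 0. The powers of 2 in the two constants reflect the ratio of the
    L^1 to the L^2 bound: |u_0| + 1 for the change of argument, where both u_1 and u_2 contribute,
    and half of it for the change of nonlinearity. As s1 < 3/4, 2^(8 s1 / 3) < 4, whence sigma < H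
    and eps sigma < 1. *)

Definition L1 f := mu.-integrable [set: T] (EFin \o f).
Definition L2 f := measurable_fun [set: T] f /\ L1 (fun x => f x ^+ 2).
(** The square of the L^2 norm, kept squared because it adds up over real and imaginary parts and
    over even and odd parts. The real integral takes a default value when the square is not
    integrable, hence the [L2] hypotheses throughout. *)
Definition n2 f : R := \int[mu]_x (f x ^+ 2).
Definition ip f g : R := \int[mu]_x (f x * g x).

Lemma L1_measurable f : L1 f -> measurable_fun [set: T] f.
Proof. by move=> /integrableP[/measurable_EFinP]. Qed.

Lemma L1_le f g : measurable_fun [set: T] f -> (forall x, `|f x| <= g x) ->
  L1 g -> L1 f.
Proof.
move=> mf fg ig; apply: (le_integrable measurableT _ _ ig) => [|x _].
  exact/measurable_EFinP.
by rewrite /= lee_fin (le_trans (fg x)) ?ler_norm.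
Qed.

Lemma L1D f g : L1 f -> L1 g -> L1 (fun x => f x + g x).
Proof. move=> f1 g1; exact: (integrableD measurableT f1 g1). Qed.

Lemma L1Z (k : R) f : L1 f -> L1 (fun x => k * f x).
Proof. move=> f1; exact: (integrableZl measurableT k f1). Qed.

Lemma L1N f : L1 f -> L1 (fun x => - f x).
Proof. move=> f1; exact: (integrableN f1). Qed.

Lemma L1B f g : L1 f -> L1 g -> L1 (fun x => f x - g x).
Proof. move=> f1 g1; exact: (L1D f1 (L1N g1)). Qed.

Lemma L1_norm f : L1 f -> L1 (fun x => `|f x|).
Proof. by move=> f1; have := integrable_abse f1. Qed.

Lemma eq_L1 f g : f =1 g -> L1 f -> L1 g.
Proof. by move=> /funext ->. Qed.

Lemma L1_ge0P f : (forall x, 0 <= f x) -> measurable_fun [set: T] f ->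
  L1 f <-> (\int[mu]_x (f x)%:E < +oo)%E.
Proof.
move=> f0 mf; split=> [/integrableP[_]|foo].
  by under eq_integral do rewrite /= ger0_norm//.
apply/integrableP; split; first exact/measurable_EFinP.
by under eq_integral do rewrite /= ger0_norm//.
Qed.

Lemma RintegralE f : L1 f -> (\int[mu]_x f x)%:E = (\int[mu]_x (f x)%:E)%E.
Proof.
move=> f1; rewrite fineK//.
exact: (integrable_fin_num measurableT f1).
Qed.

Lemma RintD f g : L1 f -> L1 g ->
  \int[mu]_x (f x + g x) = \int[mu]_x f x + \int[mu]_x g x.
Proof. exact: RintegralD. Qed.

Lemma RintB f g : L1 f -> L1 g ->
  \int[mu]_x (f x - g x) = \int[mu]_x f x - \int[mu]_x g x.
Proof. exact: RintegralB. Qed.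

Lemma RintZ k f : L1 f -> \int[mu]_x (k * f x) = k * \int[mu]_x f x.
Proof. exact: RintegralZl. Qed.

Lemma Rint_le f g : L1 f -> L1 g -> (forall x, f x <= g x) ->
  \int[mu]_x f x <= \int[mu]_x g x.
Proof. by move=> f1 g1 fg; apply: le_Rintegral. Qed.

Lemma Rint_norm f : L1 f -> `|\int[mu]_x f x| <= \int[mu]_x `|f x|.
Proof. exact: le_normr_Rintegral. Qed.

Lemma eq_Rint f g : f =1 g -> \int[mu]_x f x = \int[mu]_x g x.
Proof. by move=> /funext ->. Qed.

(** The measure is not assumed complete, so measurability of [g] does not follow from that of [f]
    and is a separate hypothesis. *)
Lemma L1_ae f g : L1 f -> measurable_fun [set: T] g ->
  {ae mu, forall x, f x = g x} -> L1 g.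
Proof.
move=> /integrableP[mf f1] mg fg; apply/integrableP; split.
  exact/measurable_EFinP.
rewrite (ae_eq_integral (fun x => `|(EFin \o f) x|%E))//.
- by apply/measurable_EFinP/measurableT_comp.
- by apply: measurableT_comp.
- by apply: filterS fg => x /= ->.
Qed.

Lemma Rint_ae f g : measurable_fun [set: T] f -> measurable_fun [set: T] g ->
  {ae mu, forall x, f x = g x} -> \int[mu]_x f x = \int[mu]_x g x.
Proof.
move=> mf mg fg; rewrite /Rintegral; congr fine; apply: ae_eq_integral => //.
- exact/measurable_EFinP.
- exact/measurable_EFinP.
- by apply: filterS fg => x /= ->.
Qed.

Lemma Rint_eq0 f : L1 f -> (forall x, 0 <= f x) -> \int[mu]_x f x = 0 ->
  {ae mu, forall x, f x = 0}.
Proof.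
move=> f1 f0 fE.
have : (\int[mu]_x `|(f x)%:E| = 0)%E.
  under eq_integral do rewrite /= ger0_norm//.
  by rewrite -RintegralE// fE.
move=> /(ae_eq_integral_abs mu measurableT (proj1 (integrableP _ _ _ f1)))/=.
by apply: filterS => x /= /(_ I)[].
Qed.

Lemma n2_ge0 f : 0 <= n2 f.
Proof. by apply: Rintegral_ge0 => x _; exact: sqr_ge0. Qed.

Lemma L2M f g : L2 f -> L2 g -> L1 (fun x => f x * g x).
Proof.
move=> [mf f2] [mg g2].
apply: (L1_le _ _ (L1D f2 g2)); first exact: measurable_funM.
move=> x; rewrite ler_norml; apply/andP; split; nra.
Qed.

Lemma L2D f g : L2 f -> L2 g -> L2 (fun x => f x + g x).
Proof.
move=> [mf f2] [mg g2]; split; first exact: measurable_funD.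
apply: (L1_le _ _ (L1D (L1Z 2 f2) (L1Z 2 g2))).
  by apply: measurable_funX; exact: measurable_funD.
move=> x; rewrite ger0_norm ?sqr_ge0// sqrrD.
by have := sqr_ge0 (f x - g x); rewrite sqrrB; lra.
Qed.

Lemma L2Z k f : L2 f -> L2 (fun x => k * f x).
Proof.
move=> [mf f2]; split; first exact: measurable_funM.
apply: eq_L1 (L1Z (k ^+ 2) f2) => x; by rewrite exprMn.
Qed.

Lemma L2N f : L2 f -> L2 (fun x => - f x).
Proof. by move=> /(L2Z (-1)); under eq_fun do rewrite mulN1r. Qed.

Lemma L2B f g : L2 f -> L2 g -> L2 (fun x => f x - g x).
Proof. by move=> f2 /L2N; exact: L2D. Qed.

Lemma L2_le f g : measurable_fun [set: T] f -> (forall x, `|f x| <= `|g x|) ->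
  L2 g -> L2 f.
Proof.
move=> mf fg [mg g2]; split => //; apply: (L1_le _ _ g2).
  exact: measurable_funX.
by move=> x; rewrite normrX -(real_normK (num_real (g x))) lerXn2r ?nnegrE.
Qed.

Lemma L2_ae f g : L2 f -> measurable_fun [set: T] g ->
  {ae mu, forall x, f x = g x} -> L2 g.
Proof.
move=> [mf f2] mg fg; split => //; apply: L1_ae f2 _ _.
  exact: measurable_funX.
by apply: filterS fg => x ->.
Qed.

Lemma n2_ae f g : measurable_fun [set: T] f -> measurable_fun [set: T] g ->
  {ae mu, forall x, f x = g x} -> n2 f = n2 g.
Proof.
move=> mf mg fg; apply: Rint_ae; try exact: measurable_funX.
by apply: filterS fg => x ->.
Qed.

Lemma n2_eq0 f : L2 f -> n2 f = 0 -> {ae mu, forall x, f x = 0}.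
Proof.
move=> [mf f2] /Rint_eq0 -/(_ f2)/(_ (fun x => sqr_ge0 _)).
by apply: filterS => x /eqP; rewrite sqrf_eq0 => /eqP.
Qed.

Lemma n2N f : n2 (fun x => - f x) = n2 f.
Proof. by apply: eq_Rint => x; rewrite sqrrN. Qed.

Lemma n2DE f g (t : R) : L2 f -> L2 g ->
  n2 (fun x => f x + t * g x) = n2 f + 2 * t * ip f g + t ^+ 2 * n2 g.
Proof.
move=> f2 g2; rewrite /n2 /ip.
rewrite -RintZ; last exact: L2M.
rewrite -(RintZ (t ^+ 2)); last exact: g2.2.
rewrite -RintD; [|exact: f2.2|exact/L1Z/L2M].
rewrite -RintD; [|apply: L1D; [exact: f2.2|exact/L1Z/L2M]|apply: L1Z; exact: g2.2].
by apply: eq_Rint => x; ring.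
Qed.

Lemma n2D_le f g : L2 f -> L2 g ->
  n2 (fun x => f x + g x) <= 2 * n2 f + 2 * n2 g.
Proof.
move=> f2 g2; rewrite -(RintZ 2 f2.2) -(RintZ 2 g2.2) -RintD; last 2 first.
- exact/L1Z/f2.2.
- exact/L1Z/g2.2.
apply: Rint_le => [||x]; first exact: (L2D f2 g2).2.
  by apply: L1D; [exact/L1Z/f2.2|exact/L1Z/g2.2].
by have := sqr_ge0 (f x - g x); rewrite sqrrB sqrrD; lra.
Qed.

Lemma n2B_le f g : L2 f -> L2 g ->
  n2 (fun x => f x - g x) <= 2 * n2 f + 2 * n2 g.
Proof. by move=> f2 g2; have := n2D_le f2 (L2N g2); rewrite n2N. Qed.

(** Cauchy-Schwarz: the polynomial of [n2DE] in t is nonnegative, and its value at the minimizer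
    gives the inequality. *)
Lemma ip_sqr_le f g : L2 f -> L2 g -> ip f g ^+ 2 <= n2 f * n2 g.
Proof.
move=> f2 g2; have H t : 0 <= n2 f + 2 * t * ip f g + t ^+ 2 * n2 g.
  by rewrite -n2DE// n2_ge0.
have [g0|g0] := eqVneq (n2 g) 0.
  rewrite g0 mulr0; have [->|i0] := eqVneq (ip f g) 0; first by rewrite expr0n.
  (* When [n2 g = 0] the polynomial is affine; with nonzero slope it would take the value -1 at this
     t. *)
  have := H (- (n2 f + 1) / (2 * ip f g)); rewrite g0 mulr0 addr0.
  have -> : 2 * (- (n2 f + 1) / (2 * ip f g)) * ip f g = - (n2 f + 1).
    by field.
  lra.
have gp : 0 < n2 g by rewrite lt_def g0 n2_ge0.
have := H (- ip f g / n2 g).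
have -> : n2 f + 2 * (- ip f g / n2 g) * ip f g + (- ip f g / n2 g) ^+ 2 * n2 g
  = (n2 f * n2 g - ip f g ^+ 2) / n2 g by field.
by rewrite pmulr_lge0 ?invr_gt0// subr_ge0.
Qed.

Lemma ip_le f g : L2 f -> L2 g -> `|ip f g| <= Num.sqrt (n2 f) * Num.sqrt (n2 g).
Proof.
move=> f2 g2; rewrite -sqrtrM ?n2_ge0// -sqrtr_sqr ler_wsqrtr//.
exact: ip_sqr_le.
Qed.

Lemma sqrt_n2D f g : L2 f -> L2 g ->
  Num.sqrt (n2 (fun x => f x + g x)) <= Num.sqrt (n2 f) + Num.sqrt (n2 g).
Proof.
move=> f2 g2; have := n2DE 1 f2 g2.
rewrite (_ : n2 (fun x => f x + 1 * g x) = n2 (fun x => f x + g x)); last first.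
  by apply: eq_Rint => x; rewrite mul1r.
move=> ->; rewrite -[leRHS]ger0_norm ?addr_ge0 ?sqrtr_ge0// -sqrtr_sqr.
rewrite ler_wsqrtr// sqrrD !sqr_sqrtr ?n2_ge0//.
have := ler_norm (ip f g); have := ip_le f2 g2; lra.
Qed.

End L1L2.

(** * Limits under the integral and completeness of L^2 *)

Section L2limits.
Context d (T : measurableType d) (R : realType) (mu : {measure set T -> \bar R}).
Implicit Types f g h : T -> R.
Local Notation L1 := (L1 mu).
Local Notation L2 := (L2 mu).
Local Notation n2 := (n2 mu).
Local Notation ip := (ip mu).

Lemma cvg_dist_le (u v : nat -> R) (l : R) : (forall n, `|u n - l| <= v n) ->
  v n @[n --> \oo] --> (0:R) -> u n @[n --> \oo] --> l.
Proof.
move=> uv v0; apply/subr_cvg0.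
apply: (@squeeze_cvgr _ _ _ _ (fun n => - v n) v) => //.
  by apply: nearW => n; rewrite -ler_norml.
by rewrite -[0]oppr0; apply: cvgN.
Qed.

Lemma sqrt_cvg0 (v : nat -> R) : v n @[n --> \oo] --> (0:R) ->
  Num.sqrt (v n) @[n --> \oo] --> (0:R).
Proof.
by move=> v0; rewrite -(@sqrtr0 R); apply: (cvg_comp _ _ v0); exact: sqrt_continuous.
Qed.

Lemma Rint_dominated (f_ : nat -> T -> R) f g :
  (forall n, measurable_fun [set: T] (f_ n)) -> measurable_fun [set: T] f ->
  {ae mu, forall x, f_ n x @[n --> \oo] --> f x} -> L1 g ->
  (forall n x, `|f_ n x| <= g x) ->
  L1 f /\ \int[mu]_x f_ n x @[n --> \oo] --> \int[mu]_x f x.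
Proof.
move=> mf_ mf f_f g1 f_g.
have [||||//|f1 _ cf] := @dominated_convergence _ _ _ mu setT measurableT
  (fun n x => (f_ n x)%:E) (EFin \o f) (EFin \o g).
- by move=> n; exact/measurable_EFinP.
- exact/measurable_EFinP.
- apply: filterS f_f => x fx _; by apply/cvg_EFin; [exact: nearW|].
- exact: g1.
- by apply: aeW => x n _; rewrite /= lee_fin f_g.
split => //.
by apply: fine_cvg; rewrite fineK ?(integrable_fin_num measurableT f1).
Qed.

(** The bound concerns the extended integral, so it also yields integrability of the limit. *)
Lemma fatou_le (f_ : nat -> T -> R) f (e : R) :
  (forall n, measurable_fun [set: T] (f_ n)) -> measurable_fun [set: T] f ->
  (forall n x, 0 <= f_ n x) ->
  {ae mu, forall x, f_ n x @[n --> \oo] --> f x} ->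
  (forall n, (\int[mu]_x (f_ n x)%:E <= e%:E)%E) ->
  (\int[mu]_x (f x)%:E <= e%:E)%E.
Proof.
move=> mf_ mf f0 f_f He.
rewrite (@ae_eq_integral _ _ _ mu setT (fun x => limn_einf (fun k => (f_ k x)%:E)))//; last 3 first.
- exact/measurable_EFinP.
- apply: measurableT_comp => //; apply: measurable_fun_limn_esup => k.
  by apply: measurableT_comp => //; exact/measurable_EFinP.
- apply: filterS f_f => x hx _.
  have H : (f_ k x)%:E @[k --> \oo] --> (f x)%:E by apply/cvg_EFin; [exact: nearW|exact: hx].
  by rewrite (cvg_limn_einf_sup H).1.
apply: le_trans (fatou mu measurableT _ _) _ => //.
- by move=> k; exact/measurable_EFinP.
- by move=> k x _; rewrite lee_fin.
rewrite limn_einf_lim; apply: lime_le; first exact: is_cvg_einfs.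
apply: nearW => k; apply: le_trans (He k).
by apply: ereal_inf_lbound; exists k => /=.
Qed.

Lemma ip_cvg (f_ : nat -> T -> R) f g : (forall n, L2 (f_ n)) -> L2 f -> L2 g ->
  n2 (fun x => f_ n x - f x) @[n --> \oo] --> (0:R) ->
  ip (f_ n) g @[n --> \oo] --> ip f g.
Proof.
move=> f_2 f2 g2 f_f.
apply: (@cvg_dist_le _ (fun n => Num.sqrt (n2 (fun x => f_ n x - f x)) * Num.sqrt (n2 g))); last first.
  by rewrite -(mul0r (Num.sqrt (n2 g))); apply: cvgM; [exact: sqrt_cvg0|exact: cvg_cst].
move=> n.
have -> : ip (f_ n) g - ip f g = ip (fun x => f_ n x - f x) g.
  rewrite /ip -RintB; [|exact: L2M|exact: L2M].
  by apply: eq_Rint => x; rewrite mulrBl.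
by apply: ip_le => //; exact: L2B.
Qed.

Lemma sqrt_n2_lip f g : L2 f -> L2 g ->
  `|Num.sqrt (n2 f) - Num.sqrt (n2 g)| <= Num.sqrt (n2 (fun x => f x - g x)).
Proof.
move=> f2 g2.
have H h k : L2 h -> L2 k -> Num.sqrt (n2 h) - Num.sqrt (n2 k) <= Num.sqrt (n2 (fun x => h x - k x)).
  move=> h2 k2; rewrite lerBlDr.
  apply: le_trans (sqrt_n2D (L2B h2 k2) k2).
  by rewrite le_eqVlt; apply/orP; left; apply/eqP; congr Num.sqrt; apply: eq_Rint => x; rewrite subrK.
rewrite ler_norml H// andbT lerNl opprB.
apply: le_trans (H _ _ g2 f2) _.
rewrite le_eqVlt; apply/orP; left; apply/eqP; congr Num.sqrt; apply: eq_Rint => x.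
by rewrite -sqrrN opprB.
Qed.

Lemma n2_cvg (f_ : nat -> T -> R) f : (forall n, L2 (f_ n)) -> L2 f ->
  n2 (fun x => f_ n x - f x) @[n --> \oo] --> (0:R) ->
  n2 (f_ n) @[n --> \oo] --> n2 f.
Proof.
move=> f_2 f2 f_f.
have sc : Num.sqrt (n2 (f_ n)) @[n --> \oo] --> Num.sqrt (n2 f).
  apply: (@cvg_dist_le _ (fun n => Num.sqrt (n2 (fun x => f_ n x - f x)))); last exact: sqrt_cvg0.
  by move=> n; exact: sqrt_n2_lip.
have -> : (fun n => n2 (f_ n)) = (fun n => Num.sqrt (n2 (f_ n)) * Num.sqrt (n2 (f_ n))).
  by apply/funext => n; rewrite -expr2 sqr_sqrtr ?n2_ge0.
by rewrite -[n2 f]sqr_sqrtr ?n2_ge0// expr2; apply: cvgM.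
Qed.

(** Since f - g = (f_n - g) - (f_n - f), [n2B_le] bounds n2 (f - g) by a sequence that tends to
    0. *)
Lemma n2_cvg_unique (f_ : nat -> T -> R) f g : (forall n, L2 (f_ n)) -> L2 f -> L2 g ->
  n2 (fun x => f_ n x - f x) @[n --> \oo] --> (0:R) ->
  n2 (fun x => f_ n x - g x) @[n --> \oo] --> (0:R) ->
  {ae mu, forall x, f x = g x}.
Proof.
move=> f_2 f2 g2 cf cg.
have : n2 (fun x => f x - g x) <= 0.
  have c : (2 * n2 (fun x => f_ n x - g x) + 2 * n2 (fun x => f_ n x - f x)) @[n --> \oo] --> (0:R).
    rewrite -[0]addr0 -{1}(mulr0 2) -{2}(mulr0 2).
    by apply: cvgD; apply: cvgM; try exact: cvg_cst.
  apply: (ler_cvg_to (cvg_cst _) c); apply: nearW => n.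
  have := n2B_le (L2B (f_2 n) g2) (L2B (f_2 n) f2).
  rewrite (_ : n2 _ = n2 (fun x => f x - g x))//.
  by apply: eq_Rint => x; congr (_ ^+ 2); ring.
move=> h0; have := n2_eq0 (L2B f2 g2) (le_anti (introT andP (conj h0 (n2_ge0 _ _)))).
by apply: filterS => x /eqP; rewrite subr_eq0 => /eqP.
Qed.

Lemma geometric_increments_cvg (a : nat -> R) (C : R) :
  (forall k, `|a k.+1 - a k| <= C * 2^-1 ^+ k) -> cvgn a.
Proof.
move=> aC.
have sc : cvgn (series (fun k => a k.+1 - a k)).
  apply: normed_cvg; apply: (@series_le_cvg _ _ (geometric C 2^-1)).
  - by move=> n; exact: normr_ge0.
  - by move=> n; rewrite /geometric/=; exact: le_trans (normr_ge0 _) (aC n).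
  - exact: aC.
  - by apply: is_cvg_geometric_series; rewrite ger0_norm ?invr_ge0// invf_lt1// ltr1n.
have -> : a = (fun n => a 0%N + series (fun k => a k.+1 - a k) n).
  apply/funext => n; rewrite /series/= telescope_sumr//.
  by rewrite addrC subrK.
by apply: is_cvgD => //; exact: is_cvg_cst.
Qed.

(** A subsequence whose increments have [n2] at most 8^-k converges almost everywhere; Fatou's lemma
    then gives convergence of the whole sequence in L^2. *)
Lemma riesz_fischer (f_ : nat -> T -> R) : (forall n, L2 (f_ n)) ->
  (forall e : R, 0 < e -> exists N, forall m n, (N <= m)%N -> (N <= n)%N ->
     n2 (fun x => f_ m x - f_ n x) <= e) ->
  exists2 g, L2 g & n2 (fun x => f_ n x - g x) @[n --> \oo] --> (0:R).
Proof.
move=> f_2 cauchy.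
have e8 k : 0 < (8^-1 : R) ^+ k by rewrite exprn_gt0// invr_gt0.
pose N k := projT1 (cid (cauchy _ (e8 k))).
have NP k m n : (N k <= m)%N -> (N k <= n)%N -> n2 (fun x => f_ m x - f_ n x) <= 8^-1 ^+ k.
  by move=> ? ?; apply: (projT2 (cid (cauchy _ (e8 k)))).
(* A partial sum is at least each [N i] with i <= k, which is all that [Nphi] asks. *)
pose phi k := (\sum_(i < k.+1) N i)%N.
have Nphi k m : (k <= m)%N -> (N k <= phi m)%N.
  rewrite -ltnS => km; rewrite /phi (bigD1 (Ordinal km))//=; exact: leq_addr.
pose h k x := f_ (phi k) x.
pose D k x := h k.+1 x - h k x.
have D2 k : L2 (D k) by exact: (L2B (f_2 _) (f_2 _)).
have nD k : n2 (D k) <= 8^-1 ^+ k by apply: NP; exact: Nphi.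
(* The weight 4^k splits the decay: against 8^-k the integrals of the terms still sum like 2^-k,
   while finiteness of S x forces |D k x| <= sqrt(S x) 2^-k. *)
pose S x := (\sum_(0 <= k <oo) ((4 : R) ^+ k * D k x ^+ 2)%:E)%E.
have mD k : measurable_fun [set: T] (fun x => ((4 : R) ^+ k * D k x ^+ 2)%:E).
  by apply/measurable_EFinP/measurable_funM => //; apply: measurable_funX; exact: (D2 k).1.
have D0 k x : (0 <= ((4 : R) ^+ k * D k x ^+ 2)%:E)%E.
  by rewrite lee_fin mulr_ge0 ?sqr_ge0// exprn_ge0// ler0n.
have iS : (\int[mu]_x S x < +oo)%E.
  rewrite integral_nneseries//.
  apply: (@le_lt_trans _ _ (\sum_(0 <= k <oo) (geometric 1 (2^-1:R) k)%:E)%E).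
    apply: lee_nneseries => [k _ _|k _]; first by apply: integral_ge0 => x _; exact: D0.
    rewrite -RintegralE; last exact: L1Z (D2 k).2.
    rewrite RintZ; last exact: (D2 k).2.
    rewrite lee_fin /geometric/= mul1r.
    apply: (@le_trans _ _ (4 ^+ k * 8^-1 ^+ k)).
      by rewrite ler_wpM2l ?exprn_ge0//; exact: nD.
    by rewrite -exprMn (_ : 4 * 8^-1 = 2^-1)//; lra.
  have gc : cvgn (series (geometric (1:R) 2^-1)).
    by apply: is_cvg_geometric_series; rewrite ger0_norm ?invr_ge0// invf_lt1// ltr1n.
  rewrite (_ : (\sum_(0 <= k <oo) _)%E = (limn (series (geometric (1:R) 2^-1)))%:E) ?ltry//.
  rewrite -EFin_lim//; congr (limn _); apply/funext => n /=.
  by rewrite sumEFin.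
have mS : measurable_fun [set: T] S.
  by apply: ge0_emeasurable_sum => // k x _ _; exact: D0.
have S0 x : (0 <= S x)%E by apply: nneseries_ge0 => k _ _; exact: D0.
have SoO : {ae mu, forall x, S x \is a fin_num}.
  have iiS : mu.-integrable [set: T] S.
    by apply/integrableP; split => //; under eq_integral do rewrite gee0_abs//.
  by have := integrable_ae measurableT iiS; apply: filterS => x /(_ I).
have hc : {ae mu, forall x, cvgn (h ^~ x)}.
  apply: filterS SoO => x Sx.
  apply: (@geometric_increments_cvg _ (Num.sqrt (fine (S x)))) => k.
  have : (((4 : R) ^+ k * D k x ^+ 2)%:E <= S x)%E.
      rewrite /S (nneseriesD1 (n := k))//.
    by rewrite leeDl// nneseries_ge0// => j _ _; exact: D0.
  rewrite -[in leRHS](fineK Sx) lee_fin => Dk.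
  rewrite -[leRHS]ger0_norm ?mulr_ge0 ?sqrtr_ge0 ?exprn_ge0 ?invr_ge0//.
  rewrite -ler_sqr ?nnegrE// !real_normK ?num_real// exprMn sqr_sqrtr; last by apply: fine_ge0; exact: S0.
  rewrite -exprM mulnC exprM (_ : 2^-1 ^+ 2 = 4^-1); last by field.
  by rewrite exprVn ler_pdivlMr ?exprn_gt0// mulrC.
(* An upper limit is a measurable function of x, also at points where the sequence diverges. *)
pose g x := fine (limn_esup (fun k => (h k x)%:E)).
have mh k : measurable_fun [set: T] (h k) by exact: (f_2 _).1.
have mg : measurable_fun [set: T] g.
  apply: measurableT_comp => //.
  by apply: measurable_fun_limn_esup => k; exact/measurable_EFinP.
have hg : {ae mu, forall x, h k x @[k --> \oo] --> g x}.
  apply: filterS hc => x hx; rewrite /g.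
  have hx' : (h k x)%:E @[k --> \oo] --> (limn (h^~ x))%:E.
    by apply/cvg_EFin; [exact: nearW|exact: hx].
  by rewrite (cvg_limn_einf_sup hx')/=.
have key e n : (forall m, (n <= m)%N -> n2 (fun x => f_ n x - f_ (phi m) x) <= e) ->
    (\int[mu]_x ((f_ n x - g x) ^+ 2)%:E <= e%:E)%E.
  move=> He.
  (* Let m tend to infinity along the subsequence; the shift by n keeps the index k + n at least n,
     where [He] applies. *)
  apply: (@fatou_le (fun k x => (f_ n x - h (k + n)%N x) ^+ 2)).
  - by move=> k; apply/measurable_funX/measurable_funB => //; exact: (f_2 _).1.
  - by apply/measurable_funX/measurable_funB => //; exact: (f_2 _).1.
  - by move=> k x; exact: sqr_ge0.
  - apply: filterS hg => x hx; rewrite expr2; apply: cvgM; apply: cvgB; try exact: cvg_cst.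
      by rewrite (cvg_shiftn n (h^~ x)).
    by rewrite (cvg_shiftn n (h^~ x)).
  - move=> k; rewrite -RintegralE; last exact: (L2B (f_2 _) (f_2 _)).2.
    by rewrite lee_fin He// leq_addl.
have keyN k n : (N k <= n)%N -> (k <= n)%N -> (\int[mu]_x ((f_ n x - g x) ^+ 2)%:E <= (8^-1 ^+ k)%:E)%E.
  move=> Nn kn; apply: key => m nm; apply: NP => //; apply: Nphi.
  exact: leq_trans nm.
have fg2 n k : (N k <= n)%N -> (k <= n)%N -> L2 (fun x => f_ n x - g x).
  move=> Nn kn; have mfg : measurable_fun [set: T] (fun x => f_ n x - g x).
    by apply: measurable_funB => //; exact: (f_2 _).1.
  split=> //; apply/L1_ge0P; first by move=> x; exact: sqr_ge0.
    exact: measurable_funX.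
  by apply: le_lt_trans (keyN _ _ Nn kn) _; rewrite ltry.
have g2 : L2 g.
  have := L2B (f_2 (N 0%N)) (fg2 _ 0%N (leqnn _) (leq0n _)).
  by under eq_fun do rewrite opprB addrC subrK.
exists g => //; apply/cvgrPdist_le => e e0.
have [k _ /(_ k (leqnn _)) ke] : \forall k \near \oo, (8^-1:R) ^+ k <= e.
  have : (8^-1:R) ^+ k @[k --> \oo] --> (0:R).
    by apply: cvg_expr; rewrite ger0_norm ?invr_ge0// invf_lt1// ltr1n.
  move=> /cvgrPdist_le/(_ _ e0); apply: filterS => k.
  by rewrite sub0r normrN; apply: le_trans; exact: ler_norm.
exists (maxn (N k) k) => // n /=; rewrite geq_max => /andP[Nn kn].
rewrite sub0r normrN ger0_norm ?n2_ge0//.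
apply: le_trans ke; rewrite -lee_fin RintegralE; last exact: (fg2 _ _ Nn kn).2.
exact: keyN.
Qed.
End L2limits.

(** * Measure preserving maps, Fubini and convolution *)

Section MeasurePreserving.
Context d (T : measurableType d) (R : realType) (mu : {measure set T -> \bar R}).

Definition mpres (phi : T -> T) := measurable_fun [set: T] phi /\
  forall A, measurable A -> mu (phi @^-1` A) = mu A.

Lemma ge0_integral_mpres phi (f : T -> \bar R) : mpres phi ->
  measurable_fun [set: T] f -> (forall x, 0 <= f x)%E ->
  (\int[mu]_x f (phi x) = \int[mu]_x f x)%E.
Proof.
move=> [mphi phiE] mf f0.
have /= := @ge0_integral_pushforward _ _ _ _ _ phi mphi mu setT f measurableT mf.
rewrite preimage_setT => <-; last by move=> x _; exact: f0.
by apply: eq_measure_integral => A mA _; exact: phiE.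
Qed.

Lemma L1_mpres phi (f : T -> R) : mpres phi -> L1 mu f -> L1 mu (fun x => f (phi x)).
Proof.
move=> mp /[dup] f1 /integrableP[mf fo]; apply/integrableP; split.
  by apply: (measurableT_comp mf); exact: mp.1.
rewrite (ge0_integral_mpres (f := fun x => `|(f x)%:E|%E) mp)//.
exact: measurableT_comp mf.
Qed.

Lemma Rint_mpres phi (f : T -> R) : mpres phi -> measurable_fun [set: T] f ->
  \int[mu]_x f (phi x) = \int[mu]_x f x.
Proof.
move=> mp mf; rewrite /Rintegral integralE [in RHS]integralE; congr (fine (_ - _)%E).
  rewrite -(ge0_integral_mpres (f := (EFin \o f)^\+%E) mp) => //; first by apply: eq_integral => x _; rewrite !funeposE.
  by apply: measurable_funepos; exact/measurable_EFinP.
rewrite -(ge0_integral_mpres (f := (EFin \o f)^\-%E) mp) => //; first by apply: eq_integral => x _; rewrite !funenegE.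
by apply: measurable_funeneg; exact/measurable_EFinP.
Qed.

Lemma ae_mpres phi (P : T -> Prop) : mpres phi -> {ae mu, forall x, P x} ->
  {ae mu, forall x, P (phi x)}.
Proof.
move=> [mphi phiE] [A [mA A0 PA]]; exists (phi @^-1` A); split.
- by rewrite -[X in measurable X]setTI; exact: mphi.
- by rewrite phiE.
- by move=> x /= Px; apply: PA.
Qed.

End MeasurePreserving.

(** A product measure is determined by its values on rectangles, and the preimage of a rectangle is
    the rectangle of the preimages. *)
Lemma mpres_prod d1 d2 (T1 : measurableType d1) (T2 : measurableType d2) (R : realType)
  (m1 : {sigma_finite_measure set T1 -> \bar R})
  (m2 : {sigma_finite_measure set T2 -> \bar R}) phi1 phi2 :
  mpres m1 phi1 -> mpres m2 phi2 ->
  mpres (m1 \x m2)%E (fun x => (phi1 x.1, phi2 x.2)).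
Proof.
move=> [mp1 p1E] [mp2 p2E].
have mp : measurable_fun [set: T1 * T2] (fun x => (phi1 x.1, phi2 x.2)).
  by apply: measurable_fun_pair; apply: measurableT_comp.
split => // A mA.
have /(_ mp) H := @product_measure_unique _ _ _ _ _ m1 m2 (pushforward (m1 \x m2)%E (fun x => (phi1 x.1, phi2 x.2))).
apply/esym/H => // B C mB mC;
change ((m1 \x m2)%E ((phi1 @^-1` B) `*` (phi2 @^-1` C)) = (m1 B * m2 C)%E).
rewrite -p1E// -p2E//; apply: product_measure1E.
  by rewrite -[X in measurable X]setTI; exact: mp1.
by rewrite -[X in measurable X]setTI; exact: mp2.
Qed.

Section R3basics.
Context {R : realType}.
Local Notation mu := (@leb3 R).
Local Notation leb := (@lebesgue_measure R).
Implicit Types (x y p : R3 R) (f g : R3 R -> R).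

(** Reflections come first because convolution changes variables by y |-> x - y; translations are
    composites of two of them. A reflection turns []b, c]] into an interval open at the other end,
    of the same length. *)
Lemma mpres_leb_sub (a : R) : mpres leb (fun x : measurableTypeR R => a - x).
Proof.
have mf : measurable_fun [set: R] (fun x : measurableTypeR R => a - x : measurableTypeR R).
  by apply: measurable_funB => //; exact: measurable_cst.
split=> // A mA; apply/esym.
apply: (@lebesgue_measure_unique R (pushforward leb (fun x : measurableTypeR R => a - x : measurableTypeR R))) => //= _ [[b c]] _ <-.
rewrite /pushforward.
have -> : (fun x : R => a - x) @^-1` `]b, c] = `[a - c, a - b[%classic.
  apply/seteqP; split => x /=; rewrite !in_itv/= => /andP[? ?]; apply/andP; split; lra.
rewrite !lebesgue_measure_itv/= !lte_fin.
have -> : (a - c < a - b) = (b < c) by lra.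
by case: ifP => // _; rewrite -!EFinB; congr EFin; ring.
Qed.

Lemma mpres_sub (a : R3 R) : mpres mu (fun x => a - x).
Proof.
have h2 : mpres (@leb2 R) (fun x : measurableTypeR R * measurableTypeR R => (a.1.1 - x.1, a.1.2 - x.2)).
  exact: (mpres_prod (mpres_leb_sub a.1.1) (mpres_leb_sub a.1.2)).
have := mpres_prod h2 (mpres_leb_sub a.2).
by congr mpres; apply/funext => -[[x1 x2] x3]; case: a => [[? ?] ?].
Qed.

Lemma mpres_opp : mpres mu (fun x => - x).
Proof. by have := mpres_sub 0; under eq_fun do rewrite sub0r. Qed.

Lemma mpres_subr (a : R3 R) : mpres mu (fun x => x - a).
Proof.
have [m1 E1] := mpres_sub a; have [m2 E2] := mpres_opp.
have E : (fun x => x - a) = (fun x => - x) \o (fun x => a - x).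
  by apply/funext => x /=; rewrite opprB.
rewrite E; split; first exact: measurableT_comp.
move=> A mA; rewrite comp_preimage E1 ?E2//.
by rewrite -[X in measurable X]setTI; exact: m2.
Qed.

Lemma measurable_dot : measurable_fun [set: R3 R * R3 R] (fun z => dot z.1 z.2).
Proof.
rewrite /dot; apply: measurable_funD; first apply: measurable_funD;
  apply: measurable_funM; repeat (apply: measurableT_comp => //).
Qed.

Lemma measurable_dot2 p : measurable_fun [set: R3 R] (dot p).
Proof.
apply: (measurableT_comp measurable_dot (g := fun x => (p, x))).
by apply: measurable_fun_pair => //; exact: measurable_cst.
Qed.

Lemma measurable_enorm : measurable_fun [set: R3 R] (@enorm R).
Proof.
apply: measurableT_comp; first by apply: (@continuous_measurable_fun _ (@Num.sqrt R)); exact: sqrt_continuous.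
apply: (measurableT_comp measurable_dot (g := fun x => (x, x))).
exact: measurable_fun_pair.
Qed.

Lemma dotC p x : dot p x = dot x p.
Proof. by rewrite /dot; ring. Qed.

Lemma dotNl p x : dot (- p) x = - dot p x.
Proof. by rewrite /dot/=; ring. Qed.

Lemma dotDr p x y : dot p (x + y) = dot p x + dot p y.
Proof. by rewrite /dot/=; ring. Qed.

Lemma dotBr p x y : dot p (x - y) = dot p x - dot p y.
Proof. by rewrite /dot/=; ring. Qed.

Lemma enormN p : enorm (- p) = enorm p.
Proof. by rewrite /enorm dotNl dotC dotNl opprK. Qed.

Lemma measurable_truncate n f : measurable_fun [set: R3 R] f ->
  measurable_fun [set: R3 R] (truncate n f).
Proof.
move=> mf; rewrite /truncate; apply: measurable_fun_ifT => //.
  by apply: measurable_fun_ler => //; exact: measurable_enorm.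
Qed.

End R3basics.

(** * Poisson kernels *)

Section Poisson1D.
Context {R : realType}.
Local Notation leb := (@lebesgue_measure R).
Implicit Types (e z t : R).

Lemma is_derive_continuous (F : R -> R) (x l : R) : is_derive x 1 F l -> {for x, continuous F}.
Proof. by move=> [dF _]; exact/differentiable_continuous/derivable1_diffP. Qed.

Lemma sqrD_gt0 e z : 0 < e -> 0 < e ^+ 2 + z ^+ 2.
Proof. by move=> e0; rewrite ltr_pwDl ?sqr_ge0// exprn_gt0. Qed.

(** [F] is an antiderivative on the positive half-line only, since the damping factor below is not
    differentiable at 0. *)
Lemma even_integralT (f F : R -> R) (l : R) : (forall x, 0 <= f x) ->
  continuous f -> (forall x, f (- x) = f x) ->
  F x @[x --> +oo] --> l -> {for 0, continuous F} ->
  (forall x : R, 0 < x -> is_derive x 1 F (f x)) ->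
  (\int[leb]_x (f x)%:E = (2 * (l - F 0))%:E)%E.
Proof.
move=> f0 cf fN Fl F0 dF; rewrite ge0_symfun_integralT//; last by move=> x /=; rewrite fN.
rewrite -set_itvcy (@ge0_continuous_FTC2y _ f F 0 l)//.
- exact: continuous_subspaceT.
- by move=> x x0; have [] := dF x x0.
- exact: cvg_at_right_filter.
- move=> x; rewrite in_itv/= andbT => x0; by rewrite derive1E; have [_ ->] := dF x x0.
Qed.

(** The choice exp(-e |t|) keeps every integral elementary: its product with a cosine has an
    explicit antiderivative, its cosine transform is a Poisson kernel, and that kernel integrates to
    an arctangent. *)
Definition damp e t : R := expR (- (e * `|t|)).

Lemma damp_ge0 e t : 0 <= damp e t. Proof. exact: expR_ge0. Qed.

Lemma damp_le1 e t : 0 < e -> damp e t <= 1.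
Proof. by move=> e0; rewrite -expR0 ler_expR oppr_le0 mulr_ge0// ltW. Qed.

Lemma dampN e t : damp e (- t) = damp e t. Proof. by rewrite /damp normrN. Qed.

Lemma continuous_damp e : continuous (damp e).
Proof.
move=> x; apply: continuous_comp; last exact: continuous_expR.
apply: cvgN; apply: cvgM; [exact: cvg_cst|exact: norm_continuous].
Qed.

Lemma measurable_damp e : measurable_fun [set: measurableTypeR R] (damp e).
Proof. by apply: continuous_measurable_fun; exact: continuous_damp. Qed.

Lemma cvgy_expRN e : 0 < e -> expR (- (e * x)) @[x --> +oo] --> (0:R).
Proof.
move=> e0; apply: (@cvg_comp _ _ _ (fun x => e * x) (fun z => expR (- z)) _ (pinfty_nbhs R)).
  exact: gt0_cvgMry.
exact: cvgr_expR.
Qed.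

Lemma cvgy_expRN_bounded e (B : R -> R) (C : R) : 0 < e -> (forall t, `|B t| <= C) ->
  expR (- (e * x)) * B x @[x --> +oo] --> (0:R).
Proof.
move=> e0 BC.
apply: (@squeeze_cvgr _ _ _ _ (fun x => - (expR (- (e * x)) * C)) (fun x => expR (- (e * x)) * C)).
- apply: nearW => x; rewrite -ler_norml normrM (ger0_norm (expR_ge0 _)).
  by rewrite ler_wpM2l ?expR_ge0.
- rewrite -oppr0 -(mul0r C); apply: cvgN; apply: cvgM; [exact: cvgy_expRN|exact: cvg_cst].
- rewrite -(mul0r C); apply: cvgM; [exact: cvgy_expRN|exact: cvg_cst].
Qed.

Lemma is_derive_damp_cos e z x : 0 < e ->
  is_derive (x : R) 1 (fun t : R => expR (- (e * t)) * ((z * sin (z * t) - e * cos (z * t)) / (e ^+ 2 + z ^+ 2)))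
   (expR (- (e * x)) * cos (z * x)).
Proof.
move=> e0.
have d1 : is_derive (x : R) 1 (fun t : R => expR (- (e * t))) (- e * expR (- (e * x))).
  apply: is_derive_eq.
  by rewrite /GRing.scale/=; ring.
have d2 : is_derive (x : R) 1 (fun t : R => (z * sin (z * t) - e * cos (z * t)) / (e ^+ 2 + z ^+ 2))
   ((z * (z * cos (z * x)) - e * (- (z * sin (z * x)))) / (e ^+ 2 + z ^+ 2)).
  apply: is_derive_eq.
  rewrite /GRing.scale/=.
  by field; rewrite gt_eqF// sqrD_gt0.
apply: (is_derive_eq (is_deriveM d1 d2)).
rewrite /GRing.scale/=.
by field; rewrite gt_eqF// sqrD_gt0.
Qed.

(** Adding 1 makes the integrand nonnegative, so the fundamental theorem of calculus applies on the
    half-line; the term from 1 is subtracted in [Rint_damp_cos]. *)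
Lemma integral_damp_1cos e z : 0 < e ->
  (\int[leb]_t (damp e t * (1 + cos (z * t)))%:E = (2 * (e^-1 + e / (e ^+ 2 + z ^+ 2)))%:E)%E.
Proof.
move=> e0.
(* The constant 1 is written as cos (0 * t), so that one antiderivative formula serves both
   terms. *)
pose F t := expR (- (e * t)) * ((0 * sin (0 * t) - e * cos (0 * t)) / (e ^+ 2 + 0 ^+ 2))
   + expR (- (e * t)) * ((z * sin (z * t) - e * cos (z * t)) / (e ^+ 2 + z ^+ 2)).
have dF (x : R) : is_derive x 1 F (expR (- (e * x)) * cos (0 * x) + expR (- (e * x)) * cos (z * x)).
  apply: is_deriveD; exact: is_derive_damp_cos.
have D0 (y : R) : e ^+ 2 + y ^+ 2 != 0 by rewrite gt_eqF// sqrD_gt0.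
have fp t : 0 <= damp e t * (1 + cos (z * t)).
  by rewrite mulr_ge0 ?expR_ge0//; have := cos_geN1 (z * t); lra.
have fc : continuous (fun t => damp e t * (1 + cos (z * t))).
  move=> x; apply: cvgM; first exact: continuous_damp.
  apply: cvgD; first exact: cvg_cst.
  apply: continuous_comp; last exact: continuous_cos.
  by apply: cvgM; [exact: cvg_cst|exact: cvg_id].
have fe t : damp e (- t) * (1 + cos (z * (- t))) = damp e t * (1 + cos (z * t)).
  by rewrite dampN mulrN cosN.
have bd (y t : R) : `|(y * sin (y * t) - e * cos (y * t)) / (e ^+ 2 + y ^+ 2)| <= (`|y| + e) / (e ^+ 2 + y ^+ 2).
  rewrite normrM (_ : `|(e ^+ 2 + y ^+ 2)^-1| = (e ^+ 2 + y ^+ 2)^-1); last first.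
    by rewrite ger0_norm// invr_ge0 addr_ge0 ?sqr_ge0.
  rewrite ler_wpM2r ?invr_ge0 ?addr_ge0 ?sqr_ge0//.
  apply: le_trans (ler_normB _ _) _; rewrite !normrM (gtr0_norm e0); apply: lerD.
    by rewrite ler_piMr// ler_norml sin_geN1 sin_le1.
  by apply: ler_piMr; rewrite ?(ltW e0)// ler_norml cos_geN1 cos_le1.
have Fl : F x @[x --> +oo] --> (0:R).
  by rewrite -[X in _ --> X]addr0; apply: cvgD; apply: (cvgy_expRN_bounded e0 (bd _)).
have F0 : {for 0, continuous F}.
  exact: is_derive_continuous (dF 0).
have dF' (x : R) : 0 < x -> is_derive x 1 F (damp e x * (1 + cos (z * x))).
  move=> x0; apply: (is_derive_eq (dF x)).
  by rewrite mul0r cos0 /damp gtr0_norm//; ring.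
rewrite (even_integralT fp fc fe Fl F0 dF').
congr EFin; rewrite /F !mulr0 !sin0 !cos0 oppr0 expR0; field.
by rewrite (gt_eqF e0) D0.
Qed.

Lemma is_derive_atan_scaled e x0 y : 0 < e ->
  is_derive (y:R) 1 (fun t : R => atan ((t - x0) / e)) (e / (e ^+ 2 + (y - x0) ^+ 2)).
Proof.
move=> e0; apply: is_derive_eq.
rewrite /GRing.scale/=.
have : e ^+ 2 + (y - x0) ^+ 2 != 0 by rewrite gt_eqF// sqrD_gt0.
by move=> h; field; rewrite h gt_eqF.
Qed.

Lemma integral_damp e : 0 < e -> (\int[leb]_t (damp e t)%:E = (2 / e)%:E)%E.
Proof.
move=> e0; have := integral_damp_1cos 0 e0.
under eq_integral do rewrite mul0r cos0 mulrC EFinM.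
rewrite ge0_integralZl//; last 2 first.
- by apply/measurable_EFinP; exact: measurable_damp.
- by move=> x _; rewrite lee_fin damp_ge0.
move=> H.
have : (((1 + 1)^-1)%:E * ((1 + 1)%:E * \int[leb]_x (damp e x)%:E) = ((1+1)^-1)%:E * (2 * (e^-1 + e / (e ^+ 2 + 0 ^+ 2)))%:E)%E.
  by rewrite H.
rewrite muleA -EFinM mulVf ?mul1e ?gt_eqF// => ->; congr EFin; field.
by rewrite (gt_eqF e0).
Qed.

Lemma L1_damp e : 0 < e -> L1 leb (damp e).
Proof.
move=> e0; apply/L1_ge0P.
- exact: damp_ge0.
- exact: measurable_damp.
- by rewrite integral_damp// ltry.
Qed.

Lemma L1_damp_cos e z : 0 < e -> L1 leb (fun t => damp e t * cos (z * t)).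
Proof.
move=> e0; apply: (L1_le _ _ (L1_damp e0)).
  apply: continuous_measurable_fun => x; apply: cvgM; first exact: continuous_damp.
  apply: continuous_comp; last exact: continuous_cos.
  by apply: cvgM; [exact: cvg_cst|exact: cvg_id].
move=> t; rewrite normrM (ger0_norm (damp_ge0 _ _)) ler_piMr ?damp_ge0//.
by rewrite ler_norml cos_geN1 cos_le1.
Qed.

Lemma L1_damp_sin e z : 0 < e -> L1 leb (fun t => damp e t * sin (z * t)).
Proof.
move=> e0; apply: (L1_le _ _ (L1_damp e0)).
  apply: continuous_measurable_fun => x; apply: cvgM; first exact: continuous_damp.
  apply: continuous_comp; last exact: continuous_sin.
  by apply: cvgM; [exact: cvg_cst|exact: cvg_id].
move=> t; rewrite normrM (ger0_norm (damp_ge0 _ _)) ler_piMr ?damp_ge0//.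
by rewrite ler_norml sin_geN1 sin_le1.
Qed.

Lemma Rint_damp_cos e z : 0 < e ->
  \int[leb]_t (damp e t * cos (z * t)) = 2 * e / (e ^+ 2 + z ^+ 2).
Proof.
move=> e0.
have : \int[leb]_t (damp e t + damp e t * cos (z * t)) = 2 * (e^-1 + e / (e ^+ 2 + z ^+ 2)).
  rewrite -[RHS]/(fine (2 * (e^-1 + e / (e ^+ 2 + z ^+ 2)))%:E) -integral_damp_1cos//.
  by congr fine; apply: eq_integral => x _; rewrite mulrDr mulr1.
rewrite RintD; [|exact: L1_damp|exact: L1_damp_cos].
rewrite [X in X + _](_ : _ = 2 / e); last by rewrite /Rintegral integral_damp.
lra.
Qed.

Lemma Rint_damp_sin e z : 0 < e -> \int[leb]_t (damp e t * sin (z * t)) = 0.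
Proof.
move=> e0; have := Rint_mpres (mpres_leb_sub (0:R)) (L1_measurable (L1_damp_sin z e0)).
under eq_Rintegral do rewrite sub0r dampN mulrN sinN mulrN -mulN1r.
rewrite RintZ; last exact: L1_damp_sin.
lra.
Qed.

Definition poisson e t : R := e / (e ^+ 2 + t ^+ 2).

Lemma poisson_ge0 e t : 0 < e -> 0 <= poisson e t.
Proof. by move=> e0; rewrite divr_ge0 ?addr_ge0 ?sqr_ge0// ltW. Qed.

Lemma continuous_poisson e x0 : 0 < e -> continuous (fun t => poisson e (t - x0)).
Proof.
move=> e0 x; apply: cvgM; first exact: cvg_cst.
apply: cvgV; first by rewrite gt_eqF// sqrD_gt0.
apply: cvgD; first exact: cvg_cst.
by rewrite !expr2; apply: cvgM; apply: cvgB; try exact: cvg_cst; exact: cvg_id.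
Qed.

Lemma measurable_poisson e : 0 < e -> measurable_fun [set: R] (poisson e).
Proof.
move=> e0; apply: continuous_measurable_fun.
by have := @continuous_poisson e 0 e0; under eq_fun do rewrite subr0.
Qed.

Lemma integral_poisson e : 0 < e -> (\int[leb]_t (poisson e t)%:E = pi%:E)%E.
Proof.
move=> e0.
have fc : continuous (poisson e).
  by have := @continuous_poisson e 0 e0; under eq_fun do rewrite subr0.
have fe t : poisson e (- t) = poisson e t by rewrite /poisson sqrrN.
have dF (x : R) := is_derive_atan_scaled 0 x e0.
have dF' (x : R) : 0 < x -> is_derive x 1 (fun t : R => atan ((t - 0) / e)) (poisson e x).
  by move=> x0; apply: (is_derive_eq (dF x)); rewrite subr0.
have F0 : {for (0:R), continuous (fun t : R => atan ((t - 0) / e))}.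
  exact: is_derive_continuous (dF 0).
have Fl : (fun t : R => atan ((t - 0) / e)) x @[x --> +oo] --> pi / 2.
  apply: (@cvg_comp _ _ _ (fun t : R => (t - 0) / e) (@atan R) _ (pinfty_nbhs R)); last exact: cvgy_atan.
  rewrite (_ : (fun t : R => (t - 0) / e) = (fun t : R => e^-1 * t)); last first.
    by apply/funext => t; rewrite subr0 mulrC.
  have e1 : 0 < e^-1 by rewrite invr_gt0.
  exact: gt0_cvgMry.
rewrite (even_integralT (fun t => poisson_ge0 t e0) fc fe Fl F0 dF').
by congr EFin; rewrite subrr mul0r atan0; field.
Qed.

Lemma Rint_poisson_itv e a b x : 0 < e -> a < b ->
  \int[leb]_y (\1_(`]a, b]%classic) y * poisson e (y - x)) =
  atan ((b - x) / e) - atan ((a - x) / e).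
Proof.
move=> e0 ab; rewrite /Rintegral.
have dF (y : R) := is_derive_atan_scaled x y e0.
have cF (y : R) : {for y, continuous (fun t : R => atan ((t - x) / e))}.
  exact: is_derive_continuous (dF y).
have mP : measurable_fun [set: R] (fun y => poisson e (y - x)).
  by apply: continuous_measurable_fun; exact: continuous_poisson.
have -> : (\int[leb]_y (\1_(`]a, b]%classic) y * poisson e (y - x))%:E =
    \int[leb]_(y in `[a, b]) (poisson e (y - x))%:E)%E.
  rewrite -integral_itv_obnd_cbnd; last first.
    by apply/measurable_EFinP; exact: measurable_funTS.
  rewrite [RHS]integral_mkcond; apply: eq_integral => y _.
  by rewrite patchE indicE; case: ifP => _; rewrite ?mul1r ?mul0r.
rewrite (@continuous_FTC2 _ _ (fun t : R => atan ((t - x) / e)))//.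
- by apply: continuous_subspaceT; exact: continuous_poisson.
- split.
  + by move=> y _; have [] := dF y.
  + by apply: cvg_at_right_filter; exact: cF.
  + by apply: cvg_at_left_filter; exact: cF.
- by move=> y _; rewrite derive1E; have [_ ->] := dF y.
Qed.

End Poisson1D.

(** * Fubini's theorem for real integrals *)

Section RealFubini.
Context d1 d2 (T1 : measurableType d1) (T2 : measurableType d2) (R : realType).
Context (m1 : {sigma_finite_measure set T1 -> \bar R}).
Context (m2 : {sigma_finite_measure set T2 -> \bar R}).
Implicit Types F : T1 * T2 -> R.

Lemma measurable_Rint_param F : measurable_fun [set: T1 * T2] F ->
  measurable_fun [set: T1] (fun x => \int[m2]_y F (x, y)).
Proof.
move=> mF; rewrite /Rintegral; apply: measurableT_comp => //.
have mEF : measurable_fun [set: T1 * T2] (EFin \o F) by exact/measurable_EFinP.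
under eq_fun do rewrite integralE.
apply: emeasurable_funB.
  rewrite (_ : (fun x => _) = fubini_F m2 (EFin \o F)^\+%E); last first.
    by apply/funext => x; apply: eq_integral => y _; rewrite !funeposE.
  by apply: (measurable_fun_fubini_tonelli_F (EFin \o F)^\+%E) => //; exact: measurable_funepos.
rewrite (_ : (fun x => _) = fubini_F m2 (EFin \o F)^\-%E); last first.
  by apply/funext => x; apply: eq_integral => y _; rewrite !funenegE.
by apply: (measurable_fun_fubini_tonelli_F (EFin \o F)^\-%E) => //; exact: measurable_funeneg.
Qed.

Lemma ae_Rint_integral1 F : L1 (m1 \x m2)%E F ->
  {ae m1, forall x, (\int[m2]_y F (x, y))%:E = (\int[m2]_y (F (x, y))%:E)%E}.
Proof.
move=> F1; have := ae_integrable1 F1; apply: filterS => x Fx.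
exact: RintegralE.
Qed.

Lemma ae_Rint_integral2 F : L1 (m1 \x m2)%E F ->
  {ae m2, forall y, (\int[m1]_x F (x, y))%:E = (\int[m1]_x (F (x, y))%:E)%E}.
Proof.
move=> F1; have := ae_integrable2 F1; apply: filterS => x Fx.
exact: RintegralE.
Qed.

Lemma measurable_swap_fun F : measurable_fun [set: T1 * T2] F ->
  measurable_fun [set: T2 * T1] (fun z => F (z.2, z.1)).
Proof. by move=> mF; apply: measurableT_comp => //; exact: measurable_fun_pair. Qed.

(** The inner integral may diverge on a null set, where [fine] gives a default value, so the real
    iterated integral is compared with the extended one almost everywhere. *)
Lemma Rint_prod1 F : L1 (m1 \x m2)%E F ->
  \int[(m1 \x m2)%E]_z F z = \int[m1]_x \int[m2]_y F (x, y).
Proof.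
move=> F1; rewrite /Rintegral -(integral12_prod_meas1 F1); congr fine.
apply: ae_eq_integral => //.
- exact: (measurable_fubini_F F1).
- by apply/measurable_EFinP; apply: measurable_Rint_param; exact: L1_measurable F1.
- by have := ae_Rint_integral1 F1; apply: filterS => x /= -> _.
Qed.

End RealFubini.

Section RealFubini2.
Context d1 d2 (T1 : measurableType d1) (T2 : measurableType d2) (R : realType).
Context (m1 : {sigma_finite_measure set T1 -> \bar R}).
Context (m2 : {sigma_finite_measure set T2 -> \bar R}).
Implicit Types F : T1 * T2 -> R.

Lemma Rint_prod2 F : L1 (m1 \x m2)%E F ->
  \int[(m1 \x m2)%E]_z F z = \int[m2]_y \int[m1]_x F (x, y).
Proof.
move=> F1; rewrite /Rintegral -(integral21_prod_meas1 F1); congr fine.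
apply: ae_eq_integral => //.
- exact: (measurable_fubini_G F1).
- apply/measurable_EFinP.
  apply: (@measurable_Rint_param _ _ _ _ _ m1 (fun z => F (z.2, z.1))).
  exact: (measurable_swap_fun (L1_measurable F1)).
- by have := ae_Rint_integral2 F1; apply: filterS => x /= -> _.
Qed.

Lemma Rint_fubini F : L1 (m1 \x m2)%E F ->
  \int[m1]_x \int[m2]_y F (x, y) = \int[m2]_y \int[m1]_x F (x, y).
Proof. by move=> F1; rewrite -Rint_prod1// Rint_prod2. Qed.

Lemma L1_Rint_param1 F : L1 (m1 \x m2)%E F -> L1 m1 (fun x => \int[m2]_y F (x, y)).
Proof.
move=> F1; have := integrable_fubini_F F1 => /integrableP[mG oG].
have mR : measurable_fun [set: T1] (fun x => \int[m2]_y F (x, y)).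
  by apply: measurable_Rint_param; exact: L1_measurable F1.
apply/integrableP; split; first exact/measurable_EFinP.
rewrite (@ae_eq_integral _ _ _ m1 setT (fun x => `|fubini_F m2 (EFin \o F) x|%E))//.
- by apply: measurableT_comp => //; exact/measurable_EFinP.
- exact: measurableT_comp.
- by have := ae_Rint_integral1 F1; apply: filterS => x E _; rewrite /comp E.
Qed.

Lemma L1_tensor (a : T1 -> R) (b : T2 -> R) : L1 m1 a -> L1 m2 b ->
  L1 (m1 \x m2)%E (fun z => a z.1 * b z.2).
Proof.
move=> a1 b1; have ma := L1_measurable a1; have mb := L1_measurable b1.
have mab : measurable_fun [set: T1 * T2] (fun z => a z.1 * b z.2).
  by apply: measurable_funM; apply: measurableT_comp.
apply/(integrable12ltyP m1 m2); first exact/measurable_EFinP.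
move: a1 b1 => /integrableP[_ a1] /integrableP[_ b1].
under eq_integral => x _.
  under eq_integral => y _ do rewrite /= normrM EFinM.
  rewrite ge0_integralZl//; last first.
    by apply/measurable_EFinP; exact: measurableT_comp.
  over.
rewrite ge0_integralZr//.
- apply: lte_mul_pinfty => //; first exact: integral_ge0.
  by rewrite ge0_fin_numE//; exact: integral_ge0.
- by apply/measurable_EFinP; exact: measurableT_comp.
- exact: integral_ge0.
Qed.

Lemma Rint_tensor (a : T1 -> R) (b : T2 -> R) : L1 m1 a -> L1 m2 b ->
  \int[(m1 \x m2)%E]_z (a z.1 * b z.2) = \int[m1]_x a x * \int[m2]_y b y.
Proof.
move=> a1 b1; rewrite Rint_prod1; last exact: L1_tensor.
rewrite /= mulrC -RintZ//; apply: eq_Rint => x; rewrite RintZ// mulrC//.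
Qed.

End RealFubini2.

Lemma L1_Rint_param2 d1 d2 (T1 : measurableType d1) (T2 : measurableType d2) (R : realType)
  (m1 : {sigma_finite_measure set T1 -> \bar R})
  (m2 : {sigma_finite_measure set T2 -> \bar R}) (F : T1 * T2 -> R) :
  L1 (m1 \x m2)%E F -> L1 m2 (fun y => \int[m1]_x F (x, y)).
Proof.
move=> F1; have mF := L1_measurable F1.
have Fs1 : L1 (m2 \x m1)%E (fun z => F (z.2, z.1)).
  apply/(integrable12ltyP m2 m1).
    by apply/measurable_EFinP; exact: measurable_swap_fun.
  by apply/(integrable21ltyP m1 m2 (proj2 (measurable_EFinP _ _) mF)).
exact: (L1_Rint_param1 Fs1).
Qed.

(** * Convolution of integrable functions *)

Section Convolution.
Context {R : realType}.
Local Notation mu := (@leb3 R).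
Implicit Types (x y p : R3 R) (a b f g : R3 R -> R).

(** Integrating first over z.1 at fixed z.2, translation invariance makes the integral of the
    absolute value the product of the two L^1 norms. *)
Lemma L1_shear a b : L1 mu a -> L1 mu b ->
  L1 (mu \x mu)%E (fun z => a (z.1 - z.2) * b z.2).
Proof.
move=> a1 b1; have ma := L1_measurable a1; have mb := L1_measurable b1.
have msub : measurable_fun [set: R3 R * R3 R] (fun z => z.1 - z.2).
  apply: measurable_fun_pair; first apply: measurable_fun_pair;
   apply: measurable_funB; repeat (apply: measurableT_comp => //).
have mab : measurable_fun [set: R3 R * R3 R] (fun z => a (z.1 - z.2) * b z.2).
  by apply: measurable_funM; [exact: measurableT_comp ma msub|exact: measurableT_comp].
apply/(integrable21ltyP mu mu); first exact/measurable_EFinP.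
have na : measurable_fun [set: R3 R] (fun x => `|a x|%:E).
  by apply/measurable_EFinP; exact: measurableT_comp.
under eq_integral => y _.
  under eq_integral => x _ do rewrite /= normrM EFinM.
  rewrite ge0_integralZr//; last first.
    by apply: (measurableT_comp na); exact: (mpres_subr y).1.
  rewrite (ge0_integral_mpres (f := fun x => `|a x|%:E) (mpres_subr y))//.
  over.
rewrite ge0_integralZl//; last 2 first.
- by apply/measurable_EFinP; exact: measurableT_comp.
- exact: integral_ge0.
move: a1 b1 => /integrableP[_ a1] /integrableP[_ b1].
apply: lte_mul_pinfty => //; first exact: integral_ge0.
by rewrite ge0_fin_numE//; exact: integral_ge0.
Qed.

Lemma L1_convolution a b : L1 mu a -> L1 mu b -> L1 mu (convolution a b).
Proof. by move=> a1 b1; exact: (L1_Rint_param1 (L1_shear a1 b1)). Qed.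

Lemma Rint_convolution a b : L1 mu a -> L1 mu b ->
  \int[mu]_x convolution a b x = \int[mu]_x a x * \int[mu]_x b x.
Proof.
move=> a1 b1; rewrite /convolution (Rint_fubini (L1_shear a1 b1))/=.
rewrite -(RintZ _ b1); apply: eq_Rint => y.
have ay : L1 mu (fun x => a (x - y)) by exact: (L1_mpres (mpres_subr y)).
rewrite -(Rint_mpres (mpres_subr y) (L1_measurable a1)) mulrC -(RintZ (b y) ay).
by apply: eq_Rint => x; rewrite mulrC.
Qed.

End Convolution.

(** * The Hartley transform *)

Section Hartley.
Context {R : realType}.
Local Notation mu := (@leb3 R).
Local Notation leb := (@lebesgue_measure R).
Implicit Types (x y p : R3 R) (e : R) (f g h : R3 R -> R).

Definition cas (t : R) := cos t + sin t.

Lemma cas_le2 t : `|cas t| <= 2.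
Proof.
rewrite ler_norml /cas; have := cos_geN1 t; have := cos_le1 t.
by have := sin_geN1 t; have := sin_le1 t; lra.
Qed.

Lemma measurable_cas : measurable_fun [set: R] cas.
Proof.
by apply: continuous_measurable_fun => t; apply: cvgD; [exact: continuous_cos|exact: continuous_sin].
Qed.

(** Once integrated against an even damping in p, the sine of the sum contributes zero and only a
    function of the difference remains. *)
Lemma casM (s t : R) : cas s * cas t = cos (s - t) + sin (s + t).
Proof. by rewrite /cas cosB sinD; ring. Qed.

Definition fc : R := (2 * pi) `^ (- (3 / 2)).

Lemma fc_gt0 : 0 < fc.
Proof. by rewrite powR_gt0// mulr_gt0// pi_gt0. Qed.

Lemma fc_sqr : fc ^+ 2 = ((2 * pi) ^+ 3)^-1.
Proof.
have p0 : 0 <= 2 * pi :> R by rewrite mulr_ge0// pi_ge0.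
rewrite /fc -powR_mulrn ?powR_ge0// -powRrM.
by rewrite (_ : - (3 / 2) * 2%:R = - 3%:R) ?powRN ?powR_mulrn//; field.
Qed.

Definition hart f p : R := fc * \int[mu]_x (f x * cas (dot p x)).

Lemma measurable_cas_dot : measurable_fun [set: R3 R * R3 R] (fun z => cas (dot z.1 z.2)).
Proof. by apply: (measurableT_comp measurable_cas); exact: measurable_dot. Qed.

Lemma measurable_cas_dot2 p : measurable_fun [set: R3 R] (fun x => cas (dot p x)).
Proof. by apply: (measurableT_comp measurable_cas); exact: measurable_dot2. Qed.

Lemma L1_bounded f g (C : R) : L1 mu f -> measurable_fun [set: R3 R] g ->
  (forall x, `|g x| <= C) -> L1 mu (fun x => f x * g x).
Proof.
move=> f1 mg gC; apply: (L1_le _ _ (L1Z C (L1_norm f1))).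
  by apply: measurable_funM => //; exact: L1_measurable f1.
by move=> x; rewrite normrM mulrC ler_wpM2r.
Qed.

Lemma L1_cas f p : L1 mu f -> L1 mu (fun x => f x * cas (dot p x)).
Proof.
by move=> f1; apply: (L1_bounded f1 (measurable_cas_dot2 p)) => x; exact: cas_le2.
Qed.

Lemma measurable_cos_dot p : measurable_fun [set: R3 R] (fun x => cos (dot p x)).
Proof.
apply: measurableT_comp; last exact: measurable_dot2.
by apply: continuous_measurable_fun; exact: continuous_cos.
Qed.

Lemma measurable_sin_dot p : measurable_fun [set: R3 R] (fun x => sin (dot p x)).
Proof.
apply: measurableT_comp; last exact: measurable_dot2.
by apply: continuous_measurable_fun; exact: continuous_sin.
Qed.

Lemma L1_cos_sin f p : L1 mu f ->
  L1 mu (fun x => f x * cos (dot p x)) /\ L1 mu (fun x => f x * sin (dot p x)).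
Proof.
move=> f1; split.
  apply: (L1_bounded f1 (measurable_cos_dot p) (C := 1)) => x.
  by rewrite ler_norml cos_geN1 cos_le1.
apply: (L1_bounded f1 (measurable_sin_dot p) (C := 1)) => x.
by rewrite ler_norml sin_geN1 sin_le1.
Qed.

Lemma measurable_hart f : measurable_fun [set: R3 R] f -> measurable_fun [set: R3 R] (hart f).
Proof.
move=> mf; apply: measurable_funM; first exact: measurable_cst.
apply: (@measurable_Rint_param _ _ _ _ _ mu (fun z => f z.2 * cas (dot z.1 z.2))).
by apply: measurable_funM; [exact: measurableT_comp|exact: measurable_cas_dot].
Qed.

Lemma hart_bounded f p : L1 mu f -> `|hart f p| <= fc * (2 * \int[mu]_x `|f x|).
Proof.
move=> f1; rewrite /hart normrM (gtr0_norm fc_gt0) ler_wpM2l ?(ltW fc_gt0)//.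
apply: (le_trans (Rint_norm (L1_cas p f1))).
rewrite -(RintZ _ (L1_norm f1)); apply: Rint_le.
- exact: L1_norm (L1_cas p f1).
- exact: L1Z (L1_norm f1).
- by move=> x; rewrite normrM mulrC ler_wpM2r// cas_le2.
Qed.

Lemma hartB f g p : L1 mu f -> L1 mu g -> hart (fun x => f x - g x) p = hart f p - hart g p.
Proof.
move=> f1 g1; rewrite /hart -mulrBr -(RintB (L1_cas p f1) (L1_cas p g1)).
by congr (_ * _); apply: eq_Rint => x; rewrite mulrBl.
Qed.

Lemma L1_bounded_prod f g (k : R3 R * R3 R -> R) (C : R) : L1 mu f -> L1 mu g ->
  measurable_fun [set: R3 R * R3 R] k -> (forall z, `|k z| <= C) ->
  L1 (mu \x mu)%E (fun z => f z.1 * g z.2 * k z).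
Proof.
move=> f1 g1 mk kC.
have fg1 : L1 (mu \x mu)%E (fun z => f z.1 * g z.2) by exact: L1_tensor.
apply: (L1_le _ _ (L1Z C (L1_norm fg1))).
  by apply: measurable_funM => //; exact: L1_measurable fg1.
by move=> z; rewrite normrM mulrC ler_wpM2r.
Qed.

(** The kernel [cas (dot p x)] is symmetric in p and x, so Fubini moves the transform to the other
    factor. *)
Lemma hart_sym f g : L1 mu f -> L1 mu g ->
  \int[mu]_p (hart f p * g p) = \int[mu]_x (f x * hart g x).
Proof.
move=> f1 g1.
have F1 : L1 (mu \x mu)%E (fun z => g z.1 * f z.2 * cas (dot z.1 z.2)).
  by apply: (L1_bounded_prod g1 f1 measurable_cas_dot (C := 2)) => z; exact: cas_le2.
have := Rint_fubini F1; rewrite /= => H.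
transitivity (fc * \int[mu]_p \int[mu]_x (g p * f x * cas (dot p x))).
  rewrite -RintZ; last exact: (L1_Rint_param1 F1).
  apply: eq_Rint => p; rewrite /hart -mulrA; congr (_ * _).
  rewrite mulrC -(RintZ _ (L1_cas p f1)); apply: eq_Rint => x; exact: mulrA.
rewrite H -RintZ; last exact: (L1_Rint_param2 F1).
apply: eq_Rint => x; rewrite /hart mulrCA; congr (_ * _).
rewrite -(RintZ _ (L1_cas x g1)); apply: eq_Rint => p.
by rewrite dotC mulrA (mulrC (g p)).
Qed.

(** A product over the coordinates rather than exp(-e |p|), so that integrals factor into
    one-dimensional ones. *)
Definition damp3 e p : R := damp e p.1.1 * damp e p.1.2 * damp e p.2.

Lemma damp3_ge0 e p : 0 <= damp3 e p.
Proof. by rewrite !mulr_ge0 ?damp_ge0. Qed.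

Lemma damp3_le1 e p : 0 < e -> damp3 e p <= 1.
Proof. by move=> e0; rewrite !mulr_ile1 ?mulr_ge0 ?damp_ge0 ?damp_le1. Qed.

Lemma damp3N e p : damp3 e (- p) = damp3 e p.
Proof. by rewrite /damp3 /= !dampN. Qed.

Lemma L1_tensor3 (a b c : measurableTypeR R -> R) : L1 leb a -> L1 leb b -> L1 leb c ->
  L1 mu (fun p => a p.1.1 * b p.1.2 * c p.2).
Proof.
move=> a1 b1 c1.
have ab1 : L1 (@leb2 R) (fun p : measurableTypeR R * measurableTypeR R => a p.1 * b p.2) by exact: (L1_tensor a1 b1).
exact: (L1_tensor ab1 c1).
Qed.

Lemma Rint_tensor3 (a b c : measurableTypeR R -> R) : L1 leb a -> L1 leb b -> L1 leb c ->
  \int[mu]_p (a p.1.1 * b p.1.2 * c p.2) =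
  \int[leb]_t a t * \int[leb]_t b t * \int[leb]_t c t.
Proof.
move=> a1 b1 c1.
have ab1 : L1 (@leb2 R) (fun p : measurableTypeR R * measurableTypeR R => a p.1 * b p.2) by exact: (L1_tensor a1 b1).
rewrite -(Rint_tensor a1 b1).
exact: (Rint_tensor ab1 c1).
Qed.

Lemma L1_damp3 e : 0 < e -> L1 mu (damp3 e).
Proof. by move=> e0; apply: L1_tensor3; exact: L1_damp. Qed.

Lemma Rint_damp3_sin e x : 0 < e -> \int[mu]_p (damp3 e p * sin (dot p x)) = 0.
Proof.
move=> e0.
have i1 : L1 mu (fun p => damp3 e p * sin (dot p x)).
  by under eq_fun do rewrite dotC; exact: (L1_cos_sin x (L1_damp3 e0)).2.
have := Rint_mpres mpres_opp (L1_measurable i1).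
rewrite (_ : \int[mu]_x0 _ = \int[mu]_p (-1 * (damp3 e p * sin (dot p x)))).
  by rewrite (RintZ _ i1); lra.
by apply: eq_Rint => p; rewrite damp3N dotNl sinN mulN1r mulrN.
Qed.

Lemma Rint_damp3_cos e x : 0 < e -> \int[mu]_p (damp3 e p * cos (dot p x)) =
  8 * (poisson e x.1.1 * poisson e x.1.2 * poisson e x.2).
Proof.
move=> e0.
have P z : \int[leb]_t (damp e t * cos (z * t)) = 2 * poisson e z.
  by rewrite Rint_damp_cos// /poisson mulrA.
have S z := Rint_damp_sin z e0.
have c1 z := L1_damp_cos z e0; have s1 z := L1_damp_sin z e0.
pose C i t := damp e t * cos (i * t); pose D i t := damp e t * sin (i * t).
(* In the expansion of the cosine of three angles, every term except the product of cosines contains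
   sine factors, whose integrals vanish. *)
transitivity (\int[mu]_p (C x.1.1 p.1.1 * C x.1.2 p.1.2 * C x.2 p.2
   - (D x.1.1 p.1.1 * D x.1.2 p.1.2 * C x.2 p.2 + (D x.1.1 p.1.1 * C x.1.2 p.1.2 * D x.2 p.2
   + C x.1.1 p.1.1 * D x.1.2 p.1.2 * D x.2 p.2)))).
  apply: eq_Rint => p; rewrite /C /D /damp3 /dot cosD cosD sinD.
  rewrite (mulrC p.1.1) (mulrC p.1.2) (mulrC p.2); ring.
rewrite RintB; [|by apply: L1_tensor3; [exact: c1..]|].
  rewrite RintD; [|by apply: L1_tensor3; [exact: s1|exact: s1|exact: c1]|].
    rewrite RintD; [|by apply: L1_tensor3; [exact: s1|exact: c1|exact: s1]|
       by apply: L1_tensor3; [exact: c1|exact: s1|exact: s1]].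
    rewrite !Rint_tensor3; try exact: c1; try exact: s1.
    rewrite /C /D !P !S; ring.
  by apply: L1D; apply: L1_tensor3; try exact: c1; exact: s1.
by apply: L1D; [|apply: L1D]; apply: L1_tensor3; try exact: c1; exact: s1.
Qed.

End Hartley.

(** * Damped inversion and the L^2 bound *)

Section HartleyIsometry.
Context {R : realType}.
Local Notation mu := (@leb3 R).
Local Notation leb := (@lebesgue_measure R).
Implicit Types (x y p : R3 R) (e : R) (f g h : R3 R -> R).

Definition poisson3 e x : R :=
  (poisson e x.1.1 / pi) * (poisson e x.1.2 / pi) * (poisson e x.2 / pi).

(** The factor 8 from the three cosine integrals and [fc ^+ 2] = (2 pi)^-3 combine to pi^-3, which
    normalizes the kernel to mass 1. *)
Lemma poisson3E e x : 0 < e ->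
  fc ^+ 2 * \int[mu]_p (damp3 e p * cos (dot p x)) = poisson3 e x.
Proof.
move=> e0; rewrite Rint_damp3_cos// fc_sqr /poisson3.
rewrite -exprVn invfM; move: (pi^-1) => i; field.
by [].
Qed.

Lemma poisson3_ge0 e x : 0 < e -> 0 <= poisson3 e x.
Proof. by move=> e0; apply: mulr_ge0; [apply: mulr_ge0|];
  (apply: divr_ge0; [exact: poisson_ge0|exact: pi_ge0]). Qed.

Lemma L1_poisson e : 0 < e -> L1 leb (poisson e).
Proof.
move=> e0; apply/L1_ge0P; first by move=> t; exact: poisson_ge0.
  exact: measurable_poisson.
by rewrite integral_poisson// ltry.
Qed.

Lemma L1_poisson_pi e : 0 < e -> L1 leb (fun t => poisson e t / pi).
Proof. by move=> /L1_poisson/(L1Z pi^-1); apply: eq_L1 => t; rewrite mulrC. Qed.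

Lemma Rint_poisson e : 0 < e -> \int[leb]_t (poisson e t / pi) = 1.
Proof.
move=> e0; under eq_Rint do rewrite mulrC.
rewrite (RintZ _ (L1_poisson e0)); apply/eqP.
by rewrite /Rintegral integral_poisson//= mulVf// gt_eqF// pi_gt0.
Qed.

Lemma L1_poisson3 e : 0 < e -> L1 mu (poisson3 e).
Proof.
move=> e0; have P1 := L1_poisson_pi e0.
exact: (L1_tensor3 P1 P1 P1).
Qed.

Lemma Rint_poisson3 e : 0 < e -> \int[mu]_x poisson3 e x = 1.
Proof.
move=> e0; have P1 := L1_poisson_pi e0.
by rewrite /poisson3 (Rint_tensor3 P1 P1 P1) !Rint_poisson// !mulr1.
Qed.

Lemma poisson_le e t : 0 < e -> poisson e t <= e^-1.
Proof.
move=> e0; rewrite /poisson ler_pdivrMr; last exact: sqrD_gt0.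
rewrite mulrDr expr2 mulKf ?gt_eqF// lerDl mulr_ge0 ?sqr_ge0// invr_ge0 ltW//.
Qed.

Lemma poisson3_le e x : 0 < e -> `|poisson3 e x| <= (e^-1 / pi) ^+ 3.
Proof.
move=> e0; have e1 : 0 <= (pi : R)^-1 by rewrite invr_ge0 pi_ge0.
rewrite ger0_norm ?poisson3_ge0//.
have H t : 0 <= poisson e t / pi <= e^-1 / pi.
  by rewrite mulr_ge0 ?poisson_ge0//= ler_wpM2r// poisson_le.
rewrite !exprS expr0 mulr1 mulrA /poisson3.
move: (H x.1.1) (H x.1.2) (H x.2) => /andP[? ?] /andP[? ?] /andP[? ?].
by apply: ler_pM => //; [exact: mulr_ge0|apply: ler_pM].
Qed.

Lemma L1_damp3_mul e f : 0 < e -> measurable_fun [set: R3 R] f ->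
  (exists C, forall x, `|f x| <= C) -> L1 mu (fun p => damp3 e p * f p).
Proof.
move=> e0 mf [C fC]; exact: (L1_bounded (L1_damp3 e0) mf fC).
Qed.

Lemma L1_damp3_hart e f : 0 < e -> L1 mu f -> L1 mu (fun p => damp3 e p * hart f p).
Proof.
move=> e0 f1; apply: L1_damp3_mul => //.
  by apply: measurable_hart; exact: L1_measurable f1.
by exists (fc * (2 * \int[mu]_x `|f x|)) => p; exact: hart_bounded.
Qed.

(* Damping makes the double integral absolutely convergent; the inner one is a Poisson kernel. *)
Lemma hart_damp3_hart e f x : 0 < e -> L1 mu f ->
  hart (fun p => damp3 e p * hart f p) x = convolution (poisson3 e) f x.
Proof.
move=> e0 f1.
pose k (z : R3 R * R3 R) : R := cas (dot z.1 z.2) * cas (dot x z.1).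
have mk : measurable_fun [set: R3 R * R3 R] k.
  apply: measurable_funM; first exact: measurable_cas_dot.
  by apply: (measurableT_comp (measurable_cas_dot2 x)).
have k4 z : `|k z| <= 4.
  rewrite normrM (_ : 4 = 2 * 2); last by ring.
  by apply: ler_pM => //; exact: cas_le2.
have F1 := L1_bounded_prod (L1_damp3 e0) f1 mk k4.
have H := Rint_fubini F1; rewrite /= in H.
have E p : damp3 e p * hart f p * cas (dot x p) = fc * \int[mu]_y (damp3 e p * f y * k (p, y)).
  rewrite (_ : \int[mu]_y (damp3 e p * f y * k (p, y)) =
     (damp3 e p * cas (dot x p)) * \int[mu]_y (f y * cas (dot p y))); first by rewrite /hart; ring.
  by rewrite -(RintZ _ (L1_cas p f1)); apply: eq_Rint => y; rewrite /k/=; ring.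
transitivity (fc * \int[mu]_p (fc * \int[mu]_y (damp3 e p * f y * k (p, y)))).
  by congr (_ * _); apply: eq_Rint => p; exact: E.
rewrite (RintZ fc (L1_Rint_param1 F1)) H mulrA -expr2.
rewrite -(RintZ (fc ^+ 2) (L1_Rint_param2 F1)); apply: eq_Rint => y.
rewrite -poisson3E// -mulrA; congr (_ * _).
have c1 : L1 mu (fun p => damp3 e p * cos (dot p (x - y))).
  by under eq_fun do rewrite dotC; exact: (L1_cos_sin _ (L1_damp3 e0)).1.
have s1 : L1 mu (fun p => damp3 e p * sin (dot p (x + y))).
  by under eq_fun do rewrite dotC; exact: (L1_cos_sin _ (L1_damp3 e0)).2.
(* The sine integral added here is zero; with it the integrand becomes a product of two kernels
   [cas]. *)
rewrite (_ : \int[mu]_p (damp3 e p * cos (dot p (x - y))) =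
  \int[mu]_p (damp3 e p * cos (dot p (x - y)) + damp3 e p * sin (dot p (x + y)))); last first.
  by rewrite (RintD c1 s1) (Rint_damp3_sin _ e0) addr0.
rewrite mulrC -(RintZ _ (L1D c1 s1)); apply: eq_Rint => p.
rewrite /k /= casM (dotC x p) -[cos (_ - _)]cosN opprB -dotBr addrC -dotDr (addrC x y); ring.
Qed.

Lemma damp3_cvg1 p : damp3 (n.+1%:R^-1) p @[n --> \oo] --> (1 : R).
Proof.
have H t : damp (n.+1%:R^-1) t @[n --> \oo] --> (1 : R).
  have : expR (- (n.+1%:R^-1 * `|t|)) @[n --> \oo] --> expR (- (0 * `|t|)).
    apply: continuous_cvg; first exact: continuous_expR.
    by apply: cvgN; apply: cvgM; [exact: cvg_harmonic|exact: cvg_cst].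
  by rewrite mul0r oppr0 expR0.
have := @cvgM R nat \oo _ _ _ _ _ (@cvgM R nat \oo _ _ _ _ _ (H p.1.1) (H p.1.2)) (H p.2).
by rewrite !mulr1; apply; exact: eventually_filter.
Qed.

(** By [hart_sym] and damped inversion the left side is the integral of f against its average by a
    kernel of mass 1; then |f x f y| <= (f x ^2 + f y ^2) / 2, and each half integrates to n2 f /
    2. *)
Lemma hart_damped_n2 e f : 0 < e -> L1 mu f -> L2 mu f ->
  \int[mu]_p (damp3 e p * hart f p ^+ 2) <= n2 mu f.
Proof.
move=> e0 f1 f2; have P1 := L1_poisson3 e0.
have Pn x := poisson3_ge0 x e0.
have cP x y : `|poisson3 e (x - y)| <= (e^-1 / pi) ^+ 3 := poisson3_le (x - y) e0.
have mPx x : measurable_fun [set: R3 R] (fun y => poisson3 e (x - y)).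
  by apply: (measurableT_comp (L1_measurable P1)); exact: (mpres_sub x).1.
have Px1 x : L1 mu (fun y => poisson3 e (x - y)) by exact: (L1_mpres (mpres_sub x)).
have IPx x : \int[mu]_y poisson3 e (x - y) = 1.
  by rewrite (Rint_mpres (mpres_sub x) (L1_measurable P1)) Rint_poisson3.
have g1 := f2.2.
have Pf x : L1 mu (fun y => poisson3 e (x - y) * f y).
  by apply: eq_L1 (L1_bounded f1 (mPx x) (cP x)) => y; rewrite mulrC.
have Pg x : L1 mu (fun y => poisson3 e (x - y) * f y ^+ 2).
  by apply: eq_L1 (L1_bounded g1 (mPx x) (cP x)) => y; rewrite mulrC.
have -> : \int[mu]_p (damp3 e p * hart f p ^+ 2) =
    \int[mu]_x (f x * convolution (poisson3 e) f x).
  transitivity (\int[mu]_p (hart f p * (damp3 e p * hart f p))).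
    by apply: eq_Rint => p; ring.
  rewrite (hart_sym f1 (L1_damp3_hart e0 f1)).
  by apply: eq_Rint => x; rewrite hart_damp3_hart.
have mcf : measurable_fun [set: R3 R] (convolution (poisson3 e) f).
  exact: L1_measurable (L1_convolution P1 f1).
have cg1 := L1_convolution P1 g1.
have -> : n2 mu f = \int[mu]_x (2^-1 * (f x ^+ 2 + convolution (poisson3 e) (fun y => f y ^+ 2) x)).
  rewrite (RintZ _ (L1D g1 cg1)) (RintD g1 cg1) (Rint_convolution P1 g1).
  rewrite Rint_poisson3// mul1r /n2; lra.
have key x : `|f x * convolution (poisson3 e) f x| <=
    2^-1 * (f x ^+ 2 + convolution (poisson3 e) (fun y => f y ^+ 2) x).
  rewrite /convolution -(RintZ (f x) (Pf x)).
  apply: (le_trans (Rint_norm (L1Z (f x) (Pf x)))).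
  have -> : f x ^+ 2 = \int[mu]_y (f x ^+ 2 * poisson3 e (x - y)).
    by rewrite (RintZ _ (Px1 x)) IPx mulr1.
  rewrite -(RintD (L1Z (f x ^+ 2) (Px1 x)) (Pg x)).
  rewrite -(RintZ 2^-1 (L1D (L1Z (f x ^+ 2) (Px1 x)) (Pg x))).
  apply: Rint_le.
  - exact: L1_norm (L1Z (f x) (Pf x)).
  - exact: L1Z (L1D (L1Z (f x ^+ 2) (Px1 x)) (Pg x)).
  move=> y; rewrite normrM (normrM (poisson3 _ _)) (ger0_norm (Pn _)).
  have := Pn (x - y); have := sqr_ge0 (`|f x| - `|f y|).
  rewrite sqrrB !real_normK ?num_real//; nra.
have L : L1 mu (fun x => f x * convolution (poisson3 e) f x).
  apply: (L1_le _ key (L1Z 2^-1 (L1D g1 cg1))).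
  by apply: measurable_funM => //; exact: f2.1.
apply: (Rint_le L (L1Z 2^-1 (L1D g1 cg1))) => x.
exact: le_trans (ler_norm _) (key x).
Qed.

(** Fatou's lemma removes the damping. This yields a contraction only; equality is [hlim_n2], once
    the transform is known to be its own inverse. *)
Lemma hart_n2 f : L1 mu f -> L2 mu f -> L2 mu (hart f) /\ n2 mu (hart f) <= n2 mu f.
Proof.
move=> f1 f2; have mh : measurable_fun [set: R3 R] (hart f).
  by apply: measurable_hart; exact: f2.1.
have e0 n : 0 < (n.+1%:R^-1 : R) by rewrite invr_gt0 ltr0Sn.
have bd n : L1 mu (fun p => damp3 (n.+1%:R^-1) p * hart f p ^+ 2).
  apply: L1_damp3_mul => //; first exact: measurable_funX.
  exists ((fc * (2 * \int[mu]_x `|f x|)) ^+ 2) => p.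
  rewrite normrX lerXn2r ?nnegrE//; last exact: hart_bounded.
  exact: le_trans (normr_ge0 _) (hart_bounded p f1).
have F : (\int[mu]_p (hart f p ^+ 2)%:E <= (n2 mu f)%:E)%E.
  apply: (@fatou_le _ _ _ _ (fun n p => damp3 (n.+1%:R^-1) p * hart f p ^+ 2)).
  - by move=> n; exact: L1_measurable (bd n).
  - exact: measurable_funX.
  - by move=> n p; rewrite mulr_ge0 ?sqr_ge0// damp3_ge0.
  - apply: aeW => p; rewrite -[X in _ --> X]mul1r; apply: cvgM; [exact: damp3_cvg1|exact: cvg_cst].
  - by move=> n; rewrite -(RintegralE (bd n)) lee_fin hart_damped_n2.
have h2 : L2 mu (hart f).
  split => //; apply/L1_ge0P; first by move=> x; exact: sqr_ge0.
    exact: measurable_funX.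
  exact: le_lt_trans F (ltry _).
by split => //; rewrite -lee_fin /n2 (RintegralE h2.2).
Qed.

End HartleyIsometry.

(** * Half-open boxes as test functions *)

Section Boxes.
Context {R : realType}.
Local Notation mu := (@leb3 R).
Local Notation leb := (@lebesgue_measure R).
Implicit Types (x y p a b : R3 R) (e : R) (f g h : R3 R -> R).

Definition boxset a b : set (R3 R) :=
  [set x | [/\ a.1.1 < x.1.1 <= b.1.1, a.1.2 < x.1.2 <= b.1.2 & a.2 < x.2 <= b.2]].

Lemma boxsetE a b : boxset a b = `]a.1.1, b.1.1] `*` `]a.1.2, b.1.2] `*` `]a.2, b.2].
Proof.
apply/seteqP; split => x /=; rewrite !in_itv/=; first by case.
by move=> [[]].
Qed.

Lemma measurable_boxset a b : measurable (boxset a b).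
Proof. by rewrite boxsetE; apply: measurableX => //; apply: measurableX. Qed.

Definition box a b : R3 R -> R := \1_(boxset a b).

Lemma boxE a b x : box a b x = \1_(`]a.1.1, b.1.1]%classic) x.1.1 *
  \1_(`]a.1.2, b.1.2]%classic) x.1.2 * \1_(`]a.2, b.2]%classic) x.2 :> R.
Proof.
rewrite /box boxsetE !indicE -!natrM !mulnb; congr ((_ : bool)%:R).
apply/idP/andP => [|[/andP[]]]; rewrite !inE/=.
  by move=> [[? ?] ?]; split; [apply/andP; split|]; rewrite inE.
by [].
Qed.

Lemma boxsetI a b a' b' : boxset a b `&` boxset a' b' =
  boxset ((Num.max a.1.1 a'.1.1, Num.max a.1.2 a'.1.2), Num.max a.2 a'.2)
         ((Num.min b.1.1 b'.1.1, Num.min b.1.2 b'.1.2), Num.min b.2 b'.2).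
Proof.
apply/seteqP; split => x /=; rewrite /boxset/= !gt_max !le_min.
  by move=> [] [/andP[-> ->] /andP[-> ->] /andP[-> ->]] [/andP[-> ->] /andP[-> ->] /andP[-> ->]].
by move=> [/andP[/andP[-> ->] /andP[-> ->]] /andP[/andP[-> ->] /andP[-> ->]] /andP[/andP[-> ->] /andP[-> ->]]].
Qed.

Definition cube (n : nat) : set (R3 R) :=
  boxset ((- n%:R, - n%:R), - n%:R) ((n%:R, n%:R), n%:R).

Lemma bigcup_itv (t : R) : exists n : nat, forall m : nat, (n <= m)%N -> - m%:R < t <= m%:R.
Proof.
exists (Num.bound `|t|) => m; rewrite -(ler_nat R) => nm.
have := archi_boundP (normr_ge0 t).
by have := ler_norm t; have := ler_norm (- t); rewrite normrN; lra.
Qed.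

Lemma bigcup_cube : \bigcup_n cube n = [set: R3 R].
Proof.
apply/seteqP; split => // x _.
have [n1 H1] := bigcup_itv x.1.1; have [n2 H2] := bigcup_itv x.1.2.
have [n3 H3] := bigcup_itv x.2.
exists (n1 + n2 + n3)%N => //; split; [apply: H1|apply: H2|apply: H3].
- by rewrite -addnA leq_addr.
- by rewrite addnAC leq_addl.
- exact: leq_addl.
Qed.

Definition boxes : set (set (R3 R)) := [set B | exists a b, B = boxset a b].

Lemma boxes_setI_closed : setI_closed boxes.
Proof.
move=> _ _ [a [b ->]] [a' [b' ->]]; rewrite boxsetI.
by eexists; eexists.
Qed.

(** A slab bounded in a single coordinate is not a box, but it is the union of its intersections
    with the cubes. *)
Lemma sigma_boxes_cylinder (i : R3 R -> R) (s t : R) :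
  (forall (n : nat), boxes (i @^-1` `]s, t] `&` cube n)) ->
  <<s boxes >> (i @^-1` `]s, t]).
Proof.
move=> H; rewrite -[X in <<s _ >> X]setIT -bigcup_cube setI_bigcupr.
apply: sigma_algebra_bigcup => n; apply: sub_sigma_algebra; exact: H.
Qed.

Lemma measurable_boxesE : @measurable _ (R3 R) = <<s boxes >>.
Proof.
apply/seteqP; split; last first.
  apply: smallest_sub; first exact: sigma_algebra_measurable.
  by move=> _ [a [b ->]]; exact: measurable_boxset.
pose T' := g_sigma_algebraType boxes.
have mcoord (i : R3 R -> R) : (forall s t (n : nat), boxes (i @^-1` `]s, t] `&` cube n)) ->
    measurable_fun [set: T'] (i : T' -> measurableTypeR R).
  move=> H; apply: (@measurability _ _ T' (measurableTypeR R) setT i (@ocitv R)) => //.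
  move=> _ [_ [[s t]] _ <- <-]; rewrite setTI; exact: sigma_boxes_cylinder.
have mid : measurable_fun [set: T'] (id : T' -> R3 R).
  apply/measurable_fun_pairP; split; first apply/measurable_fun_pairP; first split.
  - apply: mcoord => s t n.
    exists ((Num.max s (- n%:R), - n%:R), - n%:R), ((Num.min t n%:R, n%:R), n%:R).
    rewrite /cube /boxset; apply/seteqP; split => x /=; rewrite in_itv/= gt_max le_min.
      by move=> [/andP[-> ->] [/andP[-> ->] -> ->]].
    by move=> [/andP[/andP[-> ->] /andP[-> ->]] -> ->].
  - apply: mcoord => s t n.
    exists ((- n%:R, Num.max s (- n%:R)), - n%:R), ((n%:R, Num.min t n%:R), n%:R).
    rewrite /cube /boxset; apply/seteqP; split => x /=; rewrite in_itv/= gt_max le_min.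
      by move=> [/andP[-> ->] [-> /andP[-> ->] ->]].
    by move=> [-> /andP[/andP[-> ->] /andP[-> ->]] ->].
  - apply: mcoord => s t n.
    exists ((- n%:R, - n%:R), Num.max s (- n%:R)), ((n%:R, n%:R), Num.min t n%:R).
    rewrite /cube /boxset; apply/seteqP; split => x /=; rewrite in_itv/= gt_max le_min.
      by move=> [/andP[-> ->] [-> -> /andP[-> ->]]].
    by move=> [-> -> /andP[/andP[-> ->] /andP[-> ->]]].
move=> A mA; have := mid measurableT A mA; by rewrite setTI.
Qed.

Lemma L1_indic_itv (s t : R) : L1 leb (\1_(`]s, t]%classic) : measurableTypeR R -> R).
Proof.
apply/L1_ge0P; first by move=> x; rewrite indicE.
  exact: measurable_indic.
rewrite integral_indic//= setIT lebesgue_measure_itv/=.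
by case: ifP => _; rewrite ltry.
Qed.

Lemma L1_box a b : L1 mu (box a b).
Proof.
have := L1_tensor3 (L1_indic_itv a.1.1 b.1.1) (L1_indic_itv a.1.2 b.1.2) (L1_indic_itv a.2 b.2).
by apply: eq_L1 => x; rewrite boxE.
Qed.

Lemma box_sqr a b x : box a b x ^+ 2 = box a b x.
Proof. by rewrite /box indicE; case: (_ \in _); rewrite ?expr1n ?expr0n. Qed.

Lemma L2_box a b : L2 mu (box a b).
Proof.
split; first exact: L1_measurable (L1_box a b).
by apply: eq_L1 (L1_box a b) => x; rewrite box_sqr.
Qed.

(* Boxes form a generating pi-system, so the measure with density f vanishes on Borel sets. *)
Lemma box_ae0 f : L2 mu f -> (forall a b, ip mu f (box a b) = 0) ->
  {ae mu, forall x, f x = 0}.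
Proof.
move=> f2 f0.
(* Cut off to a cube, f becomes integrable, so its integrals over Borel sets make sense. *)
pose g n x := f x * box ((- n%:R, - n%:R), - n%:R) ((n%:R, n%:R), n%:R) x.
have g1 n : L1 mu (g n) := L2M f2 (L2_box _ _).
have gE n E : measurable E -> L1 mu (fun x => g n x * \1_E x).
  move=> mE; apply: (L1_bounded (g1 n) (measurable_indic mE) (C := 1)) => x.
  by rewrite indicE ger0_norm// lern1 leq_b1.
have H n E : measurable E -> \int[mu]_x (g n x * \1_E x) = 0.
  suff : <<s boxes >> `<=` [set E | measurable E /\ \int[mu]_x (g n x * \1_E x) = 0].
    by move=> H; rewrite measurable_boxesE => /H[].
  apply: lambda_system_subset => //.
  - exact: boxes_setI_closed.
  - split => //.
    + split => //; rewrite -[RHS](f0 ((- n%:R, - n%:R), - n%:R) ((n%:R, n%:R), n%:R)).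
      by apply: eq_Rint => x; rewrite indicT mulr1.
    + move=> A B BA [mA A0] [mB B0]; split; first exact: measurableD.
      rewrite (_ : \int[mu]_x _ = \int[mu]_x (g n x * \1_A x - g n x * \1_B x)).
        by rewrite (RintB (gE n _ mA) (gE n _ mB)) A0 B0 subrr.
      apply: eq_Rint => x; rewrite -mulrBr; congr (_ * _).
      rewrite !indicE in_setD; have [xB|xB] /= := boolP (x \in B); last by rewrite andbT subr0.
      by rewrite andbF (mem_set (BA _ (set_mem xB))) subrr.
    + move=> F ndF FH; have mF k : measurable (F k) by exact: (FH k).1.
      have mUF : measurable (\bigcup_k F k) by exact: bigcup_measurable.
      split => //.
      have [||||//|_] := @Rint_dominated _ _ _ mu (fun k x => g n x * \1_(F k) x)
          (fun x => g n x * \1_(\bigcup_k F k) x) (fun x => `|g n x|).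
      * by move=> k; exact: L1_measurable (gE n _ (mF k)).
      * exact: L1_measurable (gE n _ mUF).
      * apply: aeW => x; apply: cvgM; first exact: cvg_cst.
        rewrite !indicE; have [/set_mem[k _ Fkx]|nF] := boolP (x \in \bigcup_k F k).
          apply: cvg_near_cst; exists k => // m /= km; rewrite indicE mem_set//.
          by move: (ndF _ _ km) => /subsetPset; apply.
        apply: cvg_near_cst; apply: nearW => k; rewrite indicE memNset// => Fkx.
        by move/negP : nF; apply; apply/mem_set; exists k.
      * exact: L1_norm (g1 n).
      * move=> k x; rewrite normrM ler_piMr// indicE ger0_norm// lern1 leq_b1//.
      under eq_fun do rewrite (FH _).2.
      by move=> c; apply/esym; exact: (cvg_unique _ (cvg_cst (0 : R)) c).
  (* Over a box the integral is that of f over the intersection with the cube, again a box. *)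
  - move=> _ [a [b ->]]; split; first exact: measurable_boxset.
    pose m := ((- n%:R, - n%:R), - n%:R) : R3 R; pose m' := ((n%:R, n%:R), n%:R) : R3 R.
    have := boxsetI m m' a b; set c := (X in _ = boxset X _); set d := (X in _ = boxset _ X) => bI.
    rewrite -[RHS](f0 c d); apply: eq_Rint => x; rewrite /g -mulrA; congr (_ * _).
    by rewrite /box -bI indicI.
have g0 n : {ae mu, forall x, g n x = 0}.
  have := @integral_ae_eq _ _ _ mu setT measurableT (cst 0%E) (EFin \o g n) (g1 n) (measurable_cst _).
  move=> /(_ _)-/(_ _)[|N [mN N0 NE]].
    move=> E _ mE; rewrite integral0 integral_mkcond.
    rewrite (_ : (EFin \o g n) \_ E = EFin \o (fun x => g n x * \1_E x)); last first.
      apply/funext => x; rewrite patchE /= indicE; case: ifP => _; by rewrite ?mulr1 ?mulr0.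
    by rewrite -(RintegralE (gE n _ mE)) H.
  exists N; split => // x /= gx; apply: NE => /= h; apply: gx.
  by have [] := h I.
have := @ae_foralln _ _ _ mu (fun n x => g n x = 0) g0.
apply: filterS => x gx.
have [k _ kx] : (\bigcup_n cube n) x by rewrite bigcup_cube.
by have := gx k; rewrite /g /box indicE mem_set// mulr1.
Qed.

End Boxes.

(** * The Hartley transform on L^2 is an isometric involution *)

Section HartleyInvolution.
Context {R : realType}.
Local Notation mu := (@leb3 R).
Local Notation leb := (@lebesgue_measure R).
Implicit Types (x y p a b : R3 R) (e : R) (f g h : R3 R -> R).

(** The average at z of the indicator of []s, t]] by the normalized one-dimensional Poisson
    kernel. *)
Definition atan_step e (s t z : R) : R := (atan ((t - z) / e) - atan ((s - z) / e)) / pi.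

Lemma atan_step_le1 e s t z : 0 < e -> s < t -> `|atan_step e s t z| <= 1.
Proof.
move=> e0 st; have p0 : 0 < pi :> R by exact: pi_gt0.
rewrite /atan_step normrM (gtr0_norm (_ : 0 < pi^-1)) ?invr_gt0// ler_pdivrMr// mul1r ler_norml.
have := atan_gtNpi2 ((t - z) / e); have := atan_ltpi2 ((t - z) / e).
have := atan_gtNpi2 ((s - z) / e); have := atan_ltpi2 ((s - z) / e); lra.
Qed.

Lemma atan_blowup_pos (w : R) : 0 < w -> atan (w / n.+1%:R^-1) @[n --> \oo] --> pi / 2.
Proof.
move=> w0; apply: (@cvg_comp _ _ _ (fun n : nat => w / n.+1%:R^-1) (@atan R) _ (pinfty_nbhs R)); last exact: cvgy_atan.
apply/cvgryPge => A; exists (Num.bound (`|A| / w)) => // n /= An.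
rewrite invrK mulrC -ler_pdivrMr//.
have h := archi_boundP (divr_ge0 (normr_ge0 A) (ltW w0)).
apply: (@le_trans _ _ (`|A| / w)).
  by apply: ler_wpM2r; [rewrite invr_ge0 ltW|exact: ler_norm].
apply: (le_trans (ltW h)); rewrite ler_nat; exact: leqW.
Qed.

Lemma atan_blowup_neg (w : R) : w < 0 -> atan (w / n.+1%:R^-1) @[n --> \oo] --> - (pi / 2).
Proof.
move=> w0; have w0' : 0 < - w by rewrite oppr_gt0.
rewrite (_ : (fun n : nat => atan (w / n.+1%:R^-1)) = (fun n : nat => - atan (- w / n.+1%:R^-1))).
  by apply: cvgN; exact: atan_blowup_pos.
by apply/funext => n; rewrite mulNr atanN opprK.
Qed.

(** At the end points the limit is 1/2, hence the two exclusions; [ae_neq3] disposes of them as a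
    null set. *)
Lemma atan_step_cvg (s t z : R) : s < t -> z != s -> z != t ->
  atan_step n.+1%:R^-1 s t z @[n --> \oo] --> (\1_(`]s, t]%classic) z : R).
Proof.
move=> st zs zt; have p0 : pi != 0 :> R by rewrite gt_eqF// pi_gt0.
rewrite /atan_step indicE.
have [z_s|s_z] := ltP z s.
  have zt' : z < t by exact: lt_trans st.
  rewrite memNset/=; last by rewrite in_itv/= => /andP[]; lra.
  rewrite (_ : 0%:R = (pi / 2 - pi / 2) / pi); last by rewrite subrr mul0r.
  by apply: cvgM; [apply: cvgB; apply: atan_blowup_pos; rewrite subr_gt0|exact: cvg_cst].
have {}s_z : s < z by rewrite lt_def zs.
have [z_t|t_z] := ltP z t.
  rewrite mem_set/=; last by rewrite in_itv/= s_z ltW.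
  rewrite (_ : 1%:R = (pi / 2 - - (pi / 2)) / pi); last by rewrite opprK -splitr divff.
  apply: cvgM; [apply: cvgB|exact: cvg_cst].
    by apply: atan_blowup_pos; rewrite subr_gt0.
  by apply: atan_blowup_neg; rewrite subr_lt0.
have {}t_z : t < z by rewrite lt_def zt.
rewrite memNset/=; last by rewrite in_itv/= => /andP[]; lra.
rewrite (_ : 0%:R = (- (pi / 2) - - (pi / 2)) / pi); last by rewrite subrr mul0r.
apply: cvgM; [apply: cvgB|exact: cvg_cst]; apply: atan_blowup_neg; rewrite subr_lt0//.
Qed.

Lemma convolution_poisson3_box e a b x : 0 < e ->
  a.1.1 < b.1.1 -> a.1.2 < b.1.2 -> a.2 < b.2 ->
  convolution (poisson3 e) (box a b) x = atan_step e a.1.1 b.1.1 x.1.1 *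
    atan_step e a.1.2 b.1.2 x.1.2 * atan_step e a.2 b.2 x.2.
Proof.
move=> e0 ab1 ab2 ab3; rewrite /convolution.
pose P (s t z u : R) : R := \1_(`]s, t]%classic) u * poisson e (u - z) / pi.
have P1 (s t z : R) : L1 leb (P s t z).
  have m1 : measurable_fun [set: R] (fun u => poisson e (u - z) / pi).
    apply: measurable_funM; last exact: measurable_cst.
    by apply: continuous_measurable_fun; exact: continuous_poisson.
  apply: (L1_le _ _ (L1Z (e^-1 / pi) (L1_indic_itv s t))).
    rewrite (_ : P s t z = fun u => \1_(`]s, t]%classic) u * (poisson e (u - z) / pi)); last first.
      by apply/funext => u; rewrite /P -[LHS]mulrA.
    by apply: measurable_funM => //; exact: measurable_indic.
  move=> u; rewrite /P indicE; case: (_ \in _); rewrite ?mul1r ?mulr1 ?mul0r ?mulr0 ?normr0//.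
  rewrite ger0_norm; last by apply: divr_ge0; [exact: poisson_ge0|exact: pi_ge0].
  by rewrite ler_wpM2r ?invr_ge0 ?pi_ge0// poisson_le.
have IP (s t z : R) : s < t -> \int[leb]_u P s t z u = atan_step e s t z.
  move=> st; rewrite /atan_step -(Rint_poisson_itv z e0 st) mulrC.
  have L : L1 leb (fun u => \1_(`]s, t]%classic) u * poisson e (u - z)).
    by apply: eq_L1 (L1Z pi (P1 s t z)) => u; rewrite /P mulrC divfK// gt_eqF// pi_gt0.
  by rewrite -(RintZ _ L); apply: eq_Rint => u; rewrite /P mulrC.
rewrite -(IP _ _ x.1.1 ab1) -(IP _ _ x.1.2 ab2) -(IP _ _ x.2 ab3).
rewrite -(Rint_tensor3 (P1 _ _ _) (P1 _ _ _) (P1 _ _ _)).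
apply: eq_Rint => y; rewrite boxE /P /poisson3 /=.
have sw (u v : R) : poisson e (u - v) = poisson e (v - u) by rewrite /poisson -(sqrrN (u - v)) opprB.
rewrite (sw x.1.1) (sw x.1.2) (sw x.2); ring.
Qed.

Lemma ae_fst_prod d1 d2 (T1 : measurableType d1) (T2 : measurableType d2)
  (m1 : {sigma_finite_measure set T1 -> \bar R})
  (m2 : {sigma_finite_measure set T2 -> \bar R}) (P : T1 -> Prop) :
  {ae m1, forall t, P t} -> {ae (m1 \x m2)%E, forall z, P z.1}.
Proof.
move=> [N [mN N0 PN]]; exists (N `*` setT); split; first exact: measurableX.
  by rewrite product_measure1E// [X in (X * _)%E]N0 mul0e.
by move=> z /= Pz; split => //; apply: PN.
Qed.

Lemma ae_snd_prod d1 d2 (T1 : measurableType d1) (T2 : measurableType d2)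
  (m1 : {sigma_finite_measure set T1 -> \bar R})
  (m2 : {sigma_finite_measure set T2 -> \bar R}) (P : T2 -> Prop) :
  {ae m2, forall t, P t} -> {ae (m1 \x m2)%E, forall z, P z.2}.
Proof.
move=> [N [mN N0 PN]]; exists (setT `*` N); split; first exact: measurableX.
  by rewrite product_measure1E// [X in (_ * X)%E]N0 mule0.
by move=> z /= Pz; split => //; apply: PN.
Qed.

Lemma ae_leb_neq (c : R) : {ae leb, forall t, t != c}.
Proof.
exists [set c]; split => //; first exact: lebesgue_measure_set1.
by move=> t /= /negP; rewrite negbK => /eqP.
Qed.

Lemma ae_neq3 (c : R3 R) : {ae mu, forall x, [/\ x.1.1 != c.1.1, x.1.2 != c.1.2 & x.2 != c.2]}.
Proof.
have h1 : {ae @leb2 R, forall z, z.1 != c.1.1} by exact: (@ae_fst_prod _ _ _ _ leb leb _ (ae_leb_neq c.1.1)).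
have h2 : {ae @leb2 R, forall z, z.2 != c.1.2} by exact: (@ae_snd_prod _ _ _ _ leb leb _ (ae_leb_neq c.1.2)).
have h1' : {ae mu, forall z, z.1.1 != c.1.1} by exact: (@ae_fst_prod _ _ _ _ (@leb2 R) leb _ h1).
have h2' : {ae mu, forall z, z.1.2 != c.1.2} by exact: (@ae_fst_prod _ _ _ _ (@leb2 R) leb _ h2).
have h3 : {ae mu, forall z, z.2 != c.2} by exact: (@ae_snd_prod _ _ _ _ (@leb2 R) leb _ (ae_leb_neq c.2)).
by apply: filterS3 h1' h2' h3 => x.
Qed.

(** The damped inner product has two limits as the damping disappears: the inner product of the
    transforms, and, since the Poisson averages of a box are bounded by 1 and converge almost
    everywhere, that of f with the box. *)
Lemma hart_box_isometry f a b : L1 mu f -> L2 mu f ->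
  ip mu (hart f) (hart (box a b)) = ip mu f (box a b).
Proof.
move=> f1 f2.
(* A degenerate box is empty, and both sides vanish. *)
have [/and3P[ab1 ab2 ab3]|nab] := boolP [&& a.1.1 < b.1.1, a.1.2 < b.1.2 & a.2 < b.2]; last first.
  have bx0 x : box a b x = 0.
    rewrite /box indicE memNset// => -[/andP[? ?] /andP[? ?] /andP[? ?]].
    by move/negP : nab; apply; apply/and3P; split; [apply: (@lt_le_trans _ _ x.1.1)|apply: (@lt_le_trans _ _ x.1.2)|apply: (@lt_le_trans _ _ x.2)].
  have h0 p : hart (box a b) p = 0.
    rewrite /hart (_ : \int[mu]_x _ = \int[mu]_x (0 * box a b x)).
      by rewrite (RintZ _ (L1_box a b)) mul0r mulr0.
    by apply: eq_Rint => x; rewrite bx0 !mul0r.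
  rewrite /ip (_ : \int[mu]_x (f x * _) = \int[mu]_x (0 * box a b x)); last first.
    by apply: eq_Rint => x; rewrite bx0 !mulr0.
  rewrite (_ : \int[mu]_x (hart f x * _) = \int[mu]_x (0 * box a b x))//.
  by apply: eq_Rint => x; rewrite h0 mul0r mulr0.
have b1 := L1_box a b; have b2 := L2_box a b.
have e0 n : 0 < (n.+1%:R^-1 : R) by rewrite invr_gt0 ltr0Sn.
have [hf2 _] := hart_n2 f1 f2; have [hb2 _] := hart_n2 b1 b2.
pose u n := \int[mu]_p (hart f p * (damp3 n.+1%:R^-1 p * hart (box a b) p)).
have uE n : u n = \int[mu]_x (f x * convolution (poisson3 n.+1%:R^-1) (box a b) x).
  rewrite /u (hart_sym f1 (L1_damp3_hart (e0 n) b1)).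
  by apply: eq_Rint => x; rewrite hart_damp3_hart.
have lim1 : u n @[n --> \oo] --> ip mu (hart f) (hart (box a b)).
  have hfb := L2M hf2 hb2.
  apply: (Rint_dominated (g := fun p => `|hart f p * hart (box a b) p|) _ _ _ _ _).2.
  - move=> n; apply: measurable_funM; first exact: hf2.1.
    exact: L1_measurable (L1_damp3_hart (e0 n) b1).
  - exact: L1_measurable hfb.
  - apply: aeW => p; apply: cvgM; first exact: cvg_cst.
    by rewrite -[X in _ --> X]mul1r; apply: cvgM; [exact: damp3_cvg1|exact: cvg_cst].
  - exact: L1_norm.
  - move=> n p; rewrite mulrCA normrM (ger0_norm (damp3_ge0 _ _)).
    by rewrite ler_piMl// damp3_le1.
have lim2 : u n @[n --> \oo] --> ip mu f (box a b).
  under eq_fun do rewrite uE.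
  apply: (Rint_dominated (g := fun p => `|f p|) _ _ _ _ _).2.
  - move=> n; apply: measurable_funM; first exact: f2.1.
    exact: L1_measurable (L1_convolution (L1_poisson3 (e0 n)) b1).
  - exact: L1_measurable (L2M f2 b2).
  - apply: filterS2 (ae_neq3 a) (ae_neq3 b) => x [? ? ?] [? ? ?].
    apply: cvgM; first exact: cvg_cst.
    under eq_fun do rewrite convolution_poisson3_box//.
    rewrite boxE; apply: cvgM; [apply: cvgM|]; exact: atan_step_cvg.
  - exact: L1_norm.
  - move=> n x; rewrite normrM ler_piMr// convolution_poisson3_box// normrM.
    rewrite mulr_ile1 ?atan_step_le1// normrM mulr_ile1 ?atan_step_le1//.
exact: (cvg_unique _ lim1 lim2).
Qed.

Lemma L1_truncate n f : L2 mu f -> L1 mu (truncate n f).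
Proof.
move=> [mf f2].
(* The side n + 1 leaves room because boxes omit their lower faces; on the box |f| <= f^2 + 1. *)
pose c : R3 R := ((- n.+1%:R, - n.+1%:R), - n.+1%:R); pose d : R3 R := ((n.+1%:R, n.+1%:R), n.+1%:R).
apply: (L1_le _ _ (L1D f2 (L1_box c d))); first exact: measurable_truncate.
move=> x; rewrite /truncate; case: ifP => [xn|_]; last first.
  by rewrite normr0 addr_ge0 ?sqr_ge0// /box indicE.
rewrite /box indicE mem_set/=; last first.
  have dx : dot x x = enorm x ^+ 2.
    by rewrite sqr_sqrtr// /dot -!expr2 !addr_ge0 ?sqr_ge0.
  have : dot x x <= n%:R ^+ 2 by rewrite dx lerXn2r ?nnegrE// sqrtr_ge0.
  rewrite /dot -!expr2 => dn.
  have H (t : R) : t ^+ 2 <= n%:R ^+ 2 -> - n.+1%:R < t <= n.+1%:R.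
    rewrite -ler_sqrt ?sqr_ge0// !sqrtr_sqr (ger0_norm (ler0n _ _)) ler_norml => /andP[? ?].
    rewrite -natr1; apply/andP; split; lra.
  have := sqr_ge0 x.1.1; have := sqr_ge0 x.1.2; have := sqr_ge0 x.2 => ? ? ?.
  by split; apply: H; lra.
rewrite ler_norml; apply/andP; split; nra.
Qed.

Lemma L2_truncate n f : L2 mu f -> L2 mu (truncate n f).
Proof.
move=> f2; apply: (L2_le _ _ f2); first by apply: measurable_truncate; exact: f2.1.
by move=> x; rewrite /truncate; case: ifP; rewrite ?normr0.
Qed.

Lemma truncate_cvg f x : truncate n f x @[n --> \oo] --> f x.
Proof.
apply: cvg_near_cst; exists (Num.bound (enorm x)) => // n /= nx.
rewrite /truncate ifT//; apply: le_trans (ltW (archi_boundP _)) _; first exact: sqrtr_ge0.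
by rewrite ler_nat.
Qed.

Lemma n2_truncate_cvg f : L2 mu f ->
  n2 mu (fun x => truncate n f x - f x) @[n --> \oo] --> (0 : R).
Proof.
move=> f2.
have f21 : L1 mu (fun x => f x ^+ 2) := f2.2.
have c : \int[mu]_x (truncate n f x - f x) ^+ 2 @[n --> \oo] --> \int[mu]_x (0 : R).
  apply: (Rint_dominated _ _ _ f21 _).2.
  - by move=> n; exact: L1_measurable (L2B (L2_truncate n f2) f2).2.
  - exact: measurable_cst.
  - apply: aeW => x; have -> : (0 : R) = (f x - f x) * (f x - f x) by rewrite subrr mul0r.
    by apply: (@cvgM _ _ _ _ (fun n => truncate n f x - f x) (fun n => truncate n f x - f x)); apply: cvgB; try exact: cvg_cst; exact: truncate_cvg.
  - move=> n x; rewrite ger0_norm ?sqr_ge0// /truncate; case: ifP => _.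
      by rewrite subrr expr0n/= sqr_ge0.
    by rewrite sub0r sqrrN.
by move: c; rewrite {2}/Rintegral integral0.
Qed.

(* [h] is the Hartley transform of [f], extended to L^2. *)
Definition hlim f h := [/\ L2 mu f, L2 mu h &
  n2 mu (fun p => hart (truncate n f) p - h p) @[n --> \oo] --> (0 : R)].

Lemma L2_hart_truncate n f : L2 mu f -> L2 mu (hart (truncate n f)).
Proof. by move=> f2; exact: (hart_n2 (L1_truncate n f2) (L2_truncate n f2)).1. Qed.

(** Truncations are Cauchy in L^2 and [hart] does not increase [n2], so their transforms are Cauchy
    too. *)
Lemma hlim_exists f : L2 mu f -> exists h, hlim f h.
Proof.
move=> f2.
have [||h h2 hc] := riesz_fischer (f_ := fun n => hart (truncate n f)) (mu := mu).
- by move=> n; exact: L2_hart_truncate.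
- move=> e e0.
  have e4 : 0 < e / 4 by rewrite divr_gt0.
  have /cvgrPdist_le/(_ _ e4)[N _ HN] := n2_truncate_cvg f2.
  exists N => m n Nm Nn.
  have d1 := L1B (L1_truncate m f2) (L1_truncate n f2).
  have d2 := L2B (L2_truncate m f2) (L2_truncate n f2).
  rewrite (_ : n2 mu _ = n2 mu (hart (fun x => truncate m f x - truncate n f x))); last first.
    by apply: eq_Rint => p; rewrite hartB//; exact: L1_truncate.
  apply: (le_trans (hart_n2 d1 d2).2).
  have := n2B_le (L2B (L2_truncate m f2) f2) (L2B (L2_truncate n f2) f2).
  rewrite (_ : n2 mu _ = n2 mu (fun x => truncate m f x - truncate n f x)); last first.
    by apply: eq_Rint => x; congr (_ ^+ 2); ring.
  have := HN _ Nm; have := HN _ Nn; rewrite /= !sub0r !normrN !ger0_norm ?n2_ge0//; lra.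
- by exists h.
Qed.

Lemma hlim_n2_le f h : hlim f h -> n2 mu h <= n2 mu f.
Proof.
move=> [f2 h2 hc].
have c1 := n2_cvg (fun n => L2_hart_truncate n f2) h2 hc.
have c2 := n2_cvg (fun n => L2_truncate n f2) f2 (n2_truncate_cvg f2).
apply: (ler_cvg_to c1 c2); apply: nearW => n.
exact: (hart_n2 (L1_truncate n f2) (L2_truncate n f2)).2.
Qed.

Lemma hlim_ip f h g : hlim f h -> L1 mu g -> L2 mu g -> ip mu h g = ip mu f (hart g).
Proof.
move=> [f2 h2 hc] g1 g2; have [hg2 _] := hart_n2 g1 g2.
have c1 := ip_cvg (fun n => L2_hart_truncate n f2) h2 g2 hc.
have c2 := ip_cvg (fun n => L2_truncate n f2) f2 hg2 (n2_truncate_cvg f2).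
have E : (fun n => ip mu (hart (truncate n f)) g) = (fun n => ip mu (truncate n f) (hart g)).
  by apply/funext => n; exact: hart_sym (L1_truncate n f2) g1.
by rewrite E in c1; exact: (cvg_unique _ c1 c2).
Qed.

Lemma hlimB f h f' h' : hlim f h -> hlim f' h' ->
  hlim (fun x => f x - f' x) (fun p => h p - h' p).
Proof.
move=> [f2 h2 hc] [f2' h2' hc']; split; [exact: L2B|exact: L2B|].
apply: (@cvg_dist_le _ _ (fun n => 2 * n2 mu (fun p => hart (truncate n f) p - h p) +
   2 * n2 mu (fun p => hart (truncate n f') p - h' p))).
  move=> n; rewrite subr0 ger0_norm ?n2_ge0//.
  have := n2B_le (L2B (L2_hart_truncate n f2) h2) (L2B (L2_hart_truncate n f2') h2').
  rewrite (_ : n2 mu _ = n2 mu (fun p => hart (truncate n (fun x => f x - f' x)) p - (h p - h' p)))//.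
  apply: eq_Rint => p; congr (_ ^+ 2).
  rewrite (_ : truncate n (fun x => f x - f' x) = fun x => truncate n f x - truncate n f' x); last first.
    by apply/funext => x; rewrite /truncate; case: ifP => //; rewrite subrr.
  by rewrite (hartB p (L1_truncate n f2) (L1_truncate n f2')); ring.
rewrite -[0]addr0 -{1}(mulr0 2) -{2}(mulr0 2).
by apply: cvgD; apply: cvgM => //; exact: cvg_cst.
Qed.

Lemma hlim_unique f h h' : hlim f h -> hlim f h' -> {ae mu, forall p, h p = h' p}.
Proof.
move=> [f2 h2 hc] [_ h2' hc'].
exact: (n2_cvg_unique (fun n => L2_hart_truncate n f2) h2 h2' hc hc').
Qed.

Lemma hlim_ae f h h' : hlim f h -> measurable_fun [set: R3 R] h' ->
  {ae mu, forall p, h p = h' p} -> hlim f h'.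
Proof.
move=> [f2 h2 hc] mh' hh'; split => //; first exact: L2_ae h2 mh' hh'.
move: hc; apply: cvg_trans; apply: near_eq_cvg; apply: nearW => n.
have mt := (L2_hart_truncate n f2).1.
apply: n2_ae.
- by apply: measurable_funB => //; exact: h2.1.
- by apply: measurable_funB.
- by apply: filterS hh' => p ->.
Qed.

Lemma hlim_hart f : L1 mu f -> L2 mu f -> hlim f (hart f).
Proof.
move=> f1 f2; have [h2 _] := hart_n2 f1 f2; split => //.
apply: (@cvg_dist_le _ _ (fun n => n2 mu (fun x => truncate n f x - f x))); last exact: n2_truncate_cvg.
move=> n; rewrite subr0 ger0_norm ?n2_ge0//.
have d1 := L1B (L1_truncate n f2) f1; have d2 := L2B (L2_truncate n f2) f2.
apply: le_trans (hart_n2 d1 d2).2.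
rewrite le_eqVlt; apply/orP; left; apply/eqP; apply: eq_Rint => p.
by rewrite hartB//; exact: L1_truncate.
Qed.

(** Let th be the transform of [hart f]. Against a box, moving the transform across and using
    [hart_box_isometry] shows that th and f have the same inner product, so they agree by
    [box_ae0]. *)
Lemma hlim_sym_L1 f : L1 mu f -> L2 mu f -> hlim (hart f) f.
Proof.
move=> f1 f2; have [h2 _] := hart_n2 f1 f2.
have [th H] := hlim_exists h2; have [_ th2 _] := H.
apply: (hlim_ae H f2.1).
have : {ae mu, forall x, th x - f x = 0}.
  apply: box_ae0; first exact: L2B.
  move=> a b; have b1 := L1_box a b; have b2 := L2_box a b.
  rewrite /ip (_ : \int[mu]_x _ = \int[mu]_x (th x * box a b x - f x * box a b x)); last first.
    by apply: eq_Rint => x; rewrite mulrBl.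
  rewrite (RintB (L2M th2 b2) (L2M f2 b2)).
  have := hlim_ip H b1 b2; rewrite {1}/ip => ->.
  by rewrite (hart_box_isometry _ _ f1 f2) subrr.
by apply: filterS => x /eqP; rewrite subr_eq0 => /eqP.
Qed.

(** The truncations of f are the transforms of their own transforms, which converge to h. By
    contraction the truncations converge to the transform of h, but they also converge to f. *)
Lemma hlim_sym f h : hlim f h -> hlim h f.
Proof.
move=> H; have [f2 h2 hc] := H; have [th Hth] := hlim_exists h2; have [_ th2 _] := Hth.
apply: (hlim_ae Hth f2.1).
apply: (n2_cvg_unique (fun n => L2_truncate n f2) th2 f2 _ (n2_truncate_cvg f2)).
apply: (cvg_dist_le _ hc) => n; rewrite subr0 ger0_norm ?n2_ge0//.
exact: (hlim_n2_le (hlimB (hlim_sym_L1 (L1_truncate n f2) (L2_truncate n f2)) Hth)).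
Qed.

(** The transform is a contraction in both directions. *)
Lemma hlim_n2 f h : hlim f h -> n2 mu h = n2 mu f.
Proof.
by move=> H; apply/eqP; rewrite eq_le (hlim_n2_le H) (hlim_n2_le (hlim_sym H)).
Qed.

End HartleyInvolution.

(** * Plancherel's theorem and fractional Laplacians *)

Section FourierPairs.
Context {R : realType}.
Local Notation mu := (@leb3 R).
Implicit Types (x y p : R3 R) (f g h phi w : R3 R -> R) (a b psi : R3 R -> R).

Lemma Lnorm2E f : L2 mu f -> ('N[mu]_2%:E [EFin \o f])%E = (Num.sqrt (n2 mu f))%:E.
Proof.
move=> [mf f2]; rewrite unlock /=.
rewrite (_ : (\int[mu]_x _)%E = (n2 mu f)%:E).
  by rewrite poweR_EFin powR12_sqrt ?n2_ge0.
rewrite /n2 (RintegralE f2); apply: eq_integral => x _.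
by rewrite /= powR_mulrn// real_normK ?num_real.
Qed.

Lemma Lnorm2_lty f : measurable_fun [set: R3 R] f ->
  ('N[mu]_2%:E [EFin \o f] < +oo)%E -> L2 mu f.
Proof.
move=> mf fo.
have : f \in Lfun mu 2%:E by rewrite inE; apply/andP; split; rewrite inE.
move=> /Lfun2_integrable_sqr; split => //.
Qed.

Lemma Lfun2P f : f \in Lfun mu 2%:E <-> L2 mu f.
Proof.
split=> [f2|f2].
  split; last exact: Lfun2_integrable_sqr.
  by move: f2; rewrite inE => /andP[]; rewrite inE.
rewrite inE; apply/andP; split; rewrite inE; first exact: f2.1.
by rewrite /= /finite_norm Lnorm2E// ltry.
Qed.

Lemma norm_Lp2E f : L2 mu f -> norm_Lp 2%:E f = Num.sqrt (n2 mu f).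
Proof. by move=> f2; rewrite /norm_Lp Lnorm2E. Qed.

Lemma norm_Lp1E f : L1 mu f -> norm_Lp 1 f = \int[mu]_x `|f x|.
Proof. by move=> f1; rewrite /norm_Lp Lnorm1. Qed.

Definition ev psi p : R := (psi p + psi (- p)) / 2.
(** Minus the odd part, which matches the sign of the sine in exp(-i p x). *)
Definition od psi p : R := (psi (- p) - psi p) / 2.

Lemma fourier_re_hart f p : L1 mu f -> fourier_re f p = ev (hart f) p.
Proof.
move=> f1; rewrite /ev /hart -mulrDr -(RintD (L1_cas p f1) (L1_cas (- p) f1)).
rewrite -mulrA /fourier_re; congr (_ * _).
rewrite mulrC -(RintZ _ (L1D (L1_cas p f1) (L1_cas (- p) f1))); apply: eq_Rint => x.
by rewrite dotNl /cas cosN sinN; field.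
Qed.

Lemma fourier_im_hart f p : L1 mu f -> fourier_im f p = od (hart f) p.
Proof.
move=> f1; rewrite /od /hart -mulrBr -(RintB (L1_cas (- p) f1) (L1_cas p f1)).
rewrite -mulrA /fourier_im -mulrN; congr (_ * _).
have [_ s1] := L1_cos_sin p f1.
rewrite mulrC -(RintZ _ (L1B (L1_cas (- p) f1) (L1_cas p f1))) -mulN1r -(RintZ _ s1); apply: eq_Rint => x.
by rewrite dotNl /cas cosN sinN; field.
Qed.

Lemma measurable_opp_arg h : measurable_fun [set: R3 R] h ->
  measurable_fun [set: R3 R] (fun p => h (- p)).
Proof. by move=> mh; apply: (measurableT_comp mh); exact: mpres_opp.1. Qed.

Lemma L2_opp h : L2 mu h -> L2 mu (fun p => h (- p)).
Proof.
move=> [mh h2]; split; first exact: measurable_opp_arg.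
exact: (L1_mpres mpres_opp h2).
Qed.

Lemma n2_opp h : L2 mu h -> n2 mu (fun p => h (- p)) = n2 mu h.
Proof. by move=> [mh h2]; exact: (Rint_mpres mpres_opp (L1_measurable h2)). Qed.

Lemma L2_ev h : L2 mu h -> L2 mu (ev h).
Proof.
move=> h2; have := L2Z 2^-1 (L2D h2 (L2_opp h2)).
by rewrite (_ : (fun x => _) = ev h)//; apply/funext => p; rewrite /ev mulrC.
Qed.

Lemma L2_od h : L2 mu h -> L2 mu (od h).
Proof.
move=> h2; have := L2Z 2^-1 (L2B (L2_opp h2) h2).
by rewrite (_ : (fun x => _) = od h)//; apply/funext => p; rewrite /od mulrC.
Qed.

Lemma n2_ev_od h : L2 mu h -> n2 mu (ev h) + n2 mu (od h) = n2 mu h.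
Proof.
move=> h2; rewrite /n2 -(RintD (L2_ev h2).2 (L2_od h2).2).
rewrite (_ : \int[mu]_x _ = \int[mu]_p (2^-1 * (h p ^+ 2 + h (- p) ^+ 2))).
  rewrite (RintZ _ (L1D h2.2 (L2_opp h2).2)) (RintD h2.2 (L2_opp h2).2).
  by rewrite -/(n2 mu h) -/(n2 mu (fun p => h (- p))) n2_opp//; lra.
by apply: eq_Rint => p; rewrite /ev /od; field.
Qed.

Lemma ev_lim (h_ : nat -> R3 R -> R) h : (forall n, L2 mu (h_ n)) -> L2 mu h ->
  n2 mu (fun p => h_ n p - h p) @[n --> \oo] --> (0 : R) ->
  n2 mu (fun p => ev (h_ n) p - ev h p) @[n --> \oo] --> (0 : R) /\
  n2 mu (fun p => od (h_ n) p - od h p) @[n --> \oo] --> (0 : R).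
Proof.
move=> h_2 h2 hc.
have E n : n2 mu (fun p => ev (h_ n) p - ev h p) + n2 mu (fun p => od (h_ n) p - od h p)
   = n2 mu (fun p => h_ n p - h p).
  rewrite -(n2_ev_od (L2B (h_2 n) h2)); congr (_ + _); apply: eq_Rint => p;
    by rewrite /ev /od; congr (_ ^+ 2); field.
split; apply: (@cvg_dist_le _ _ (fun n => n2 mu (fun p => h_ n p - h p))) => // n.
  by rewrite subr0 ger0_norm ?n2_ge0// -E lerDl n2_ge0.
by rewrite subr0 ger0_norm ?n2_ge0// -E lerDr n2_ge0.
Qed.

(* The L^2 branch of [is_fourier], read off the Hartley transform. *)
Definition isF phi a b := [/\ measurable_fun [set: R3 R] a, measurable_fun [set: R3 R] b &
  exists psi, [/\ hlim phi psi, {ae mu, forall p, a p = ev psi p} &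
                 {ae mu, forall p, b p = od psi p}]].

(** [is_fourier] does not ask that [a] be square integrable; an eventually finite distance to the
    L^2 functions [h_ n] implies it. *)
Lemma Lnorm2_cvg0 (h_ : nat -> R3 R -> R) a : (forall n, L2 mu (h_ n)) ->
  measurable_fun [set: R3 R] a ->
  ('N[mu]_2%:E [EFin \o (h_ n \- a)%R])%E @[n --> \oo] --> 0%E ->
  L2 mu a /\ n2 mu (fun p => h_ n p - a p) @[n --> \oo] --> (0 : R).
Proof.
move=> h_2 ma ac.
have [N _ HN] : \forall n \near \oo, ('N[mu]_2%:E [EFin \o (h_ n \- a)%R] < +oo)%E.
  have /fine_cvgP[fin _] := ac; move: fin.
  by apply: filterS => n; rewrite ge0_fin_numE// Lnorm_ge0.
have mha n : measurable_fun [set: R3 R] (h_ n \- a).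
  by apply: measurable_funB => //; exact: (h_2 n).1.
have a2 : L2 mu a.
  have := L2B (h_2 N) (Lnorm2_lty (mha N) (HN N (leqnn N))).
  by rewrite (_ : (fun x => _) = a)//; apply/funext => p /=; ring.
split => //.
have E n : ('N[mu]_2%:E [EFin \o (h_ n \- a)%R])%E = (Num.sqrt (n2 mu (fun p => h_ n p - a p)))%:E.
  exact: (Lnorm2E (L2B (h_2 n) a2)).
have sc : Num.sqrt (n2 mu (fun p => h_ n p - a p)) @[n --> \oo] --> (0 : R).
  by move: ac; under eq_fun do rewrite E; move=> /fine_cvg.
rewrite (_ : (fun n => _) = fun n => Num.sqrt (n2 mu (fun p => h_ n p - a p)) * Num.sqrt (n2 mu (fun p => h_ n p - a p))).
  by rewrite -(mul0r (0:R)); apply: cvgM.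
by apply/funext => n; rewrite -expr2 sqr_sqrtr// n2_ge0.
Qed.

Lemma Lnorm2_cvg0_conv (h_ : nat -> R3 R -> R) a : (forall n, L2 mu (h_ n)) -> L2 mu a ->
  n2 mu (fun p => h_ n p - a p) @[n --> \oo] --> (0 : R) ->
  ('N[mu]_2%:E [EFin \o (h_ n \- a)%R])%E @[n --> \oo] --> 0%E.
Proof.
move=> h_2 a2 ac.
have E n : ('N[mu]_2%:E [EFin \o (h_ n \- a)%R])%E = (Num.sqrt (n2 mu (fun p => h_ n p - a p)))%:E.
  exact: (Lnorm2E (L2B (h_2 n) a2)).
under eq_fun do rewrite E.
by apply/cvg_EFin; [exact: nearW|exact: sqrt_cvg0].
Qed.

Lemma fourier_re_truncate f n : L2 mu f -> fourier_re (truncate n f) = ev (hart (truncate n f)).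
Proof. by move=> f2; apply/funext => p; rewrite fourier_re_hart//; exact: L1_truncate. Qed.

Lemma fourier_im_truncate f n : L2 mu f -> fourier_im (truncate n f) = od (hart (truncate n f)).
Proof. by move=> f2; apply/funext => p; rewrite fourier_im_hart//; exact: L1_truncate. Qed.

(** For phi in L^2 the two branches of [is_fourier] agree: if phi is also in L^1, its integral
    transform is the L^2 limit by [hlim_hart]. *)
Lemma is_fourierP phi a b : L2 mu phi -> is_fourier phi a b <-> isF phi a b.
Proof.
move=> f2; have L2n n := L2_hart_truncate n f2.
split=> [[ma mb H]|[ma mb [psi [H ha hb]]]]; split => //.
  case: H => [[/Lfun1_integrable f1 ab]|[_ [ca cb]]].
    exists (hart phi); split; first exact: hlim_hart.
      by apply: filterS ab => p [-> _]; rewrite fourier_re_hart.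
    by apply: filterS ab => p [_ ->]; rewrite fourier_im_hart.
  have [psi H] := hlim_exists f2; have [_ p2 pc] := H; exists psi; split => //.
    have [ec _] := ev_lim L2n p2 pc.
    move: ca; under eq_fun do rewrite fourier_re_truncate//.
    move=> /(Lnorm2_cvg0 (fun n => L2_ev (L2n n)) ma)[a2 ac].
    exact: (n2_cvg_unique (fun n => L2_ev (L2n n)) a2 (L2_ev p2) ac ec).
  have [_ oc] := ev_lim L2n p2 pc.
  move: cb; under eq_fun do rewrite fourier_im_truncate//.
  move=> /(Lnorm2_cvg0 (fun n => L2_od (L2n n)) mb)[b2 bc].
  exact: (n2_cvg_unique (fun n => L2_od (L2n n)) b2 (L2_od p2) bc oc).
right; split; first exact/Lfun2P.
have [_ p2 pc] := H; have [ec oc] := ev_lim L2n p2 pc.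
have a2 : L2 mu a by apply: (L2_ae (L2_ev p2) ma); apply: filterS ha => p ->.
have b2 : L2 mu b by apply: (L2_ae (L2_od p2) mb); apply: filterS hb => p ->.
split.
  under eq_fun do rewrite fourier_re_truncate//.
  apply: Lnorm2_cvg0_conv => //; first by move=> n; exact: L2_ev.
  rewrite (_ : (fun n => _) = (fun n => n2 mu (fun p => ev (hart (truncate n phi)) p - ev psi p)))//.
  apply/funext => n; apply: n2_ae.
  - by apply: measurable_funB => //; exact: (L2_ev (L2n n)).1.
  - by apply: measurable_funB; [exact: (L2_ev (L2n n)).1|exact: (L2_ev p2).1].
  - by apply: filterS ha => p ->.
under eq_fun do rewrite fourier_im_truncate//.
apply: Lnorm2_cvg0_conv => //; first by move=> n; exact: L2_od.
rewrite (_ : (fun n => _) = (fun n => n2 mu (fun p => od (hart (truncate n phi)) p - od psi p)))//.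
apply/funext => n; apply: n2_ae.
- by apply: measurable_funB => //; exact: (L2_od (L2n n)).1.
- by apply: measurable_funB; [exact: (L2_od (L2n n)).1|exact: (L2_od p2).1].
- by apply: filterS hb => p ->.
Qed.

Lemma isF_plancherel phi a b : isF phi a b ->
  [/\ L2 mu phi, L2 mu a, L2 mu b & n2 mu phi = n2 mu a + n2 mu b].
Proof.
move=> [ma mb [psi [H ha hb]]]; have [f2 p2 pc] := H.
have a2 : L2 mu a by apply: (L2_ae (L2_ev p2) ma); apply: filterS ha => p ->.
have b2 : L2 mu b by apply: (L2_ae (L2_od p2) mb); apply: filterS hb => p ->.
split => //; rewrite (n2_ae ma (L2_ev p2).1 ha) (n2_ae mb (L2_od p2).1 hb).
by rewrite n2_ev_od// (hlim_n2 H).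
Qed.

Lemma ae_opp (P : R3 R -> Prop) : {ae mu, forall p, P p} -> {ae mu, forall p, P (- p)}.
Proof. exact: ae_mpres mpres_opp. Qed.

Lemma isF_unique phi a b a' b' : isF phi a b -> isF phi a' b' ->
  {ae mu, forall p, a p = a' p /\ b p = b' p}.
Proof.
move=> [_ _ [psi [H ha hb]]] [_ _ [psi' [H' ha' hb']]].
have E := hlim_unique H H'.
apply: filterS3 E (ae_opp E) (filterI (filterI ha hb) (filterI ha' hb')) => p e1 e2 [[-> ->] [-> ->]].
by rewrite /ev /od e1 e2.
Qed.

Lemma isF_ae phi a b a' b' : isF phi a b -> measurable_fun [set: R3 R] a' ->
  measurable_fun [set: R3 R] b' -> {ae mu, forall p, a p = a' p /\ b p = b' p} -> isF phi a' b'.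
Proof.
move=> [_ _ [psi [H ha hb]]] ma mb E; split => //; exists psi; split => //.
  by apply: filterS2 ha E => p <- [->].
by apply: filterS2 hb E => p <- [_ ->].
Qed.

Lemma isFB phi a b phi' a' b' : isF phi a b -> isF phi' a' b' ->
  isF (fun x => phi x - phi' x) (fun p => a p - a' p) (fun p => b p - b' p).
Proof.
move=> [ma mb [psi [H ha hb]]] [ma' mb' [psi' [H' ha' hb']]].
split; [exact: measurable_funB|exact: measurable_funB|].
exists (fun p => psi p - psi' p); split; first exact: hlimB.
  by apply: filterS2 ha ha' => p -> ->; rewrite /ev; field.
by apply: filterS2 hb hb' => p -> ->; rewrite /od; field.
Qed.

Lemma isFD phi a b phi' a' b' : isF phi a b -> isF phi' a' b' ->
  isF (fun x => phi x + phi' x) (fun p => a p + a' p) (fun p => b p + b' p).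
Proof.
(* A sum written with differences only, to reuse [isFB]: u + v = u - (v - v - v). *)
move=> H H'; have := isFB H (isFB (isFB H' H') H').
have E (u v : R3 R -> R) : (fun x => u x - (v x - v x - v x)) = (fun x => u x + v x).
  by apply/funext => x; ring.
by rewrite !E.
Qed.

Lemma isF_parity phi a b : isF phi a b ->
  {ae mu, forall p, a (- p) = a p /\ b (- p) = - b p}.
Proof.
move=> [_ _ [psi [H ha hb]]].
apply: filterS2 (filterI ha hb) (ae_opp (filterI ha hb)) => p [-> ->] [-> ->].
by rewrite /ev /od opprK; split; field.
Qed.

(** Converse of [isF_parity]: for even a and odd b, the function a - b has [ev] equal to a and [od]
    equal to b, so w can be taken as the transform of a - b, the transform being its own inverse. *)
Lemma isF_exists a b : L2 mu a -> L2 mu b ->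
  {ae mu, forall p, a (- p) = a p /\ b (- p) = - b p} -> exists w, isF w a b.
Proof.
move=> a2 b2 ab; have [w H] := hlim_exists (L2B a2 b2).
exists w; split; [exact: a2.1|exact: b2.1|]; exists (fun p => a p - b p); split; first exact: hlim_sym.
  by apply: filterS ab => p [ha hb]; rewrite /ev ha hb; field.
by apply: filterS ab => p [ha hb]; rewrite /od ha hb; field.
Qed.

Lemma is_fourier_L1 phi a b : L1 mu phi -> is_fourier phi a b ->
  {ae mu, forall p, a p = fourier_re phi p /\ b p = fourier_im phi p}.
Proof.
move=> f1 H; have [ma mb [[_ //]|[/Lfun2P f2 _]]] := H.
move: H => /(is_fourierP _ _ f2)[_ _ [psi [hp ha hb]]].
have E := hlim_unique hp (hlim_hart f1 f2).
apply: filterS3 E (ae_opp E) (filterI ha hb) => p e1 e2 [-> ->].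
by rewrite fourier_re_hart// fourier_im_hart// /ev /od e1 e2.
Qed.

End FourierPairs.

(** * Symbols, convolution theorem and regularity of the linear solution *)

Section FractionalSymbols.
Context {R : realType}.
Local Notation mu := (@leb3 R).
Implicit Types (x y p : R3 R) (s : R) (f g h phi u v w K : R3 R -> R) (a b psi : R3 R -> R).

Lemma measurable_enorm_pow s : measurable_fun [set: R3 R] (fun p => enorm p `^ s).
Proof. by apply: (measurableT_comp (measurable_powR s)); exact: measurable_enorm. Qed.

Lemma isF_total phi : L2 mu phi -> exists a b, isF phi a b.
Proof.
move=> f2; have [psi H] := hlim_exists f2; have [_ p2 _] := H.
exists (ev psi), (od psi); split; [exact: (L2_ev p2).1|exact: (L2_od p2).1|].
by exists psi; split => //; exact: aeW.
Qed.

Lemma frac_lapP s phi : frac_lap_L2 s phi -> is_frac_lap s phi (frac_lap s phi).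
Proof. by move=> [w H]; apply: (@xgetPex _ (cst 0) [set w | is_frac_lap s phi w]); exists w. Qed.

Lemma isF_frac_lap s phi a b : isF phi a b -> frac_lap_L2 s phi ->
  isF (frac_lap s phi) (fun p => enorm p `^ (2 * s) * a p) (fun p => enorm p `^ (2 * s) * b p).
Proof.
move=> H /frac_lapP[/Lfun2P w2 [a' [b' [Hp /(is_fourierP _ _ w2) Hw]]]].
have [f2 _ _ _] := isF_plancherel H.
move: Hp => /(is_fourierP _ _ f2) Hp; have [ma mb _] := H.
have mm := measurable_enorm_pow (2 * s).
apply: (isF_ae Hw); [exact: measurable_funM|exact: measurable_funM|].
by apply: filterS (isF_unique Hp H) => p [-> ->].
Qed.

Lemma is_frac_lap_isF s phi w a b : isF phi a b ->
  isF w (fun p => enorm p `^ (2 * s) * a p) (fun p => enorm p `^ (2 * s) * b p) ->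
  frac_lap_L2 s phi.
Proof.
move=> H Hw; have [f2 _ _ _] := isF_plancherel H; have [w2 _ _ _] := isF_plancherel Hw.
exists w; split; first exact/Lfun2P.
by exists a, b; split; exact/is_fourierP.
Qed.

Lemma measurable_fourier f : L1 mu f ->
  measurable_fun [set: R3 R] (fourier_re f) /\ measurable_fun [set: R3 R] (fourier_im f).
Proof.
move=> f1; have mh := measurable_hart (L1_measurable f1).
have mhN := measurable_opp_arg mh.
split.
  rewrite (_ : fourier_re f = ev (hart f)); last by apply/funext => p; rewrite fourier_re_hart.
  by apply: measurable_funM; [exact: measurable_funD|exact: measurable_cst].
rewrite (_ : fourier_im f = od (hart f)); last by apply/funext => p; rewrite fourier_im_hart.
by apply: measurable_funM; [exact: measurable_funB|exact: measurable_cst].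
Qed.

(** Serves f and K, which are given in L^1; [isF] for phi itself would include square
    integrability. *)
Lemma isF_frac_lap_L1 s phi : L1 mu phi -> frac_lap_L2 s phi ->
  isF (frac_lap s phi) (fun p => enorm p `^ (2 * s) * fourier_re phi p)
    (fun p => enorm p `^ (2 * s) * fourier_im phi p).
Proof.
move=> f1 /frac_lapP[/Lfun2P w2 [a' [b' [Hp /(is_fourierP _ _ w2) Hw]]]].
have [m1 m2] := measurable_fourier f1; have mm := measurable_enorm_pow (2 * s).
apply: (isF_ae Hw); [exact: measurable_funM|exact: measurable_funM|].
by apply: filterS (is_fourier_L1 f1 Hp) => p [-> ->].
Qed.

Lemma in_H2B u v : in_H2 u -> in_H2 v -> in_H2 (u \- v).
Proof.
move=> [/Lfun2P u2 lu] [/Lfun2P v2 lv]; split; first exact/Lfun2P/L2B.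
have [a [b Hu]] := isF_total u2; have [a' [b' Hv]] := isF_total v2.
apply: (@is_frac_lap_isF 1 _ (fun x => frac_lap 1 u x - frac_lap 1 v x) _ _ (isFB Hu Hv)).
have := isFB (isF_frac_lap Hu lu) (isF_frac_lap Hv lv).
have E (c d : R3 R -> R) : (fun p => enorm p `^ (2 * 1) * c p - enorm p `^ (2 * 1) * d p) =
   (fun p => enorm p `^ (2 * 1) * (c p - d p)) by apply/funext => p; rewrite mulrBr.
by rewrite (E a a') (E b b').
Qed.

Lemma norm_H2_sqr u a b : in_H2 u -> isF u a b ->
  norm_H2 u ^+ 2 = (n2 mu a + n2 mu b) + (n2 mu (fun p => enorm p `^ 2 * a p) + n2 mu (fun p => enorm p `^ 2 * b p)).
Proof.
move=> [/Lfun2P u2 lu] Hu; have Hl := isF_frac_lap Hu lu.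
have [_ _ _ E] := isF_plancherel Hu; have [l2 _ _ El] := isF_plancherel Hl.
rewrite /norm_H2 /norm_H2s sqr_sqrtr ?addr_ge0 ?sqr_ge0//.
rewrite !norm_Lp2E// !sqr_sqrtr ?n2_ge0// E El.
by rewrite !mulr1.
Qed.

Lemma n2_le_norm_H2 u : in_H2 u -> Num.sqrt (n2 mu u) <= norm_H2 u.
Proof.
move=> [/Lfun2P u2 lu]; rewrite /norm_H2 /norm_H2s ler_wsqrtr// norm_Lp2E//.
by rewrite sqr_sqrtr ?n2_ge0// lerDl sqr_ge0.
Qed.

Lemma norm_H2_ge0 u : 0 <= norm_H2 u.
Proof. exact: sqrtr_ge0. Qed.

Lemma fourier_ae f g : measurable_fun [set: R3 R] f -> measurable_fun [set: R3 R] g ->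
  {ae mu, forall x, f x = g x} ->
  fourier_re f = fourier_re g /\ fourier_im f = fourier_im g.
Proof.
move=> mf mg fg; have mc p := measurable_cos_dot p; have ms p := measurable_sin_dot p.
split; apply/funext => p; rewrite /fourier_re /fourier_im.
  congr (_ * _); apply: Rint_ae; [exact: measurable_funM|exact: measurable_funM|].
  by apply: filterS fg => x ->.
congr (- (_ * _)); apply: Rint_ae; [exact: measurable_funM|exact: measurable_funM|].
by apply: filterS fg => x ->.
Qed.

Definition symbol s1 s2 p := enorm p `^ (2 * s1) + enorm p `^ (2 * s2).

(** The left side of the equation is in L^2 by definition and, agreeing almost everywhere with h,
    also in L^1; so its L^2 transform is the Fourier integral of h. *)
Lemma solves_symbol s1 s2 u h a b : solves s1 s2 u h -> L1 mu h -> isF u a b ->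
  {ae mu, forall p, symbol s1 s2 p * a p = fourier_re h p /\
    symbol s1 s2 p * b p = fourier_im h p}.
Proof.
move=> [l1 l2 E] h1 Hu.
have HF := isFD (isF_frac_lap Hu l1) (isF_frac_lap Hu l2).
set F := (fun x => frac_lap s1 u x + frac_lap s2 u x) in HF E.
have [F2 _ _ _] := isF_plancherel HF.
have F1 : L1 mu F by apply: (L1_ae h1 F2.1); apply: filterS E => x; rewrite /F => ->.
have [reE imE] := fourier_ae F2.1 (L1_measurable h1) E.
have := is_fourier_L1 F1 ((is_fourierP _ _ F2).2 HF).
by apply: filterS => p; rewrite reE imE /symbol !mulrDl.
Qed.

(** Covers cosine and sine at once: after Fubini and the shift x |-> x - y, the addition formula for
    k produces the coefficients C and S. *)
Lemma Rint_convolution_mul K h (k : R -> R) (C S : R) p : L1 mu K -> L1 mu h ->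
  measurable_fun [set: R] k -> (forall t, `|k t| <= 1) ->
  (forall y, \int[mu]_x (K x * k (dot p x + dot p y)) = C * cos (dot p y) + S * sin (dot p y)) ->
  \int[mu]_x (convolution K h x * k (dot p x)) =
  C * \int[mu]_y (h y * cos (dot p y)) + S * \int[mu]_y (h y * sin (dot p y)).
Proof.
move=> K1 h1 mk k1 HK.
have Kh := L1_shear K1 h1.
have mkd : measurable_fun [set: R3 R] (fun x => k (dot p x)).
  by apply: (measurableT_comp mk); exact: measurable_dot2.
have F1 : L1 (mu \x mu)%E (fun z => K (z.1 - z.2) * h z.2 * k (dot p z.1)).
  apply: (L1_le _ _ (L1_norm Kh)).
    by apply: measurable_funM; [exact: L1_measurable Kh|exact: (measurableT_comp mkd)].
  by move=> z; rewrite normrM ler_piMr.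
transitivity (\int[mu]_x \int[mu]_y (K (x - y) * h y * k (dot p x))).
  apply: Rint_ae.
  - by apply: measurable_funM => //; exact: L1_measurable (L1_convolution K1 h1).
  - exact: L1_measurable (L1_Rint_param1 F1).
  - have := ae_integrable1 Kh; apply: filterS => x iK.
    have L : L1 mu (fun y => K (x - y) * h y) by exact: iK.
    by rewrite /convolution mulrC -(RintZ _ L); apply: eq_Rint => y; rewrite mulrC.
rewrite (Rint_fubini F1) /=.
have [hc hs] := L1_cos_sin p h1.
rewrite -(RintZ C hc) -(RintZ S hs) -(RintD (L1Z C hc) (L1Z S hs)); apply: eq_Rint => y.
have mky : measurable_fun [set: R3 R] (fun x => k (dot p x + dot p y)).
  apply: (measurableT_comp mk); apply: measurable_funD; first exact: measurable_dot2.
  exact: measurable_cst.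
have G1 : L1 mu (fun x => K x * k (dot p x + dot p y)) by exact: (L1_bounded K1 mky (C := 1)).
transitivity (h y * \int[mu]_x (K x * k (dot p x + dot p y))); last by rewrite HK; ring.
rewrite -(Rint_mpres (mpres_subr y) (L1_measurable G1)).
rewrite -(RintZ _ (L1_mpres (mpres_subr y) G1)); apply: eq_Rint => x.
by rewrite dotBr subrK; ring.
Qed.

(** Real part of the convolution theorem; with the normalization (2 pi)^(-3/2), the product of the
    transforms is [fc] times the transform of the convolution. *)
Lemma fourier_convolution_re K h p : L1 mu K -> L1 mu h ->
  fc * fourier_re (convolution K h) p =
    fourier_re K p * fourier_re h p - fourier_im K p * fourier_im h p.
Proof.
move=> K1 h1; have [Kc Ks] := L1_cos_sin p K1.
rewrite /fourier_re /fourier_im -/fc.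
rewrite (@Rint_convolution_mul K h cos (\int[mu]_x (K x * cos (dot p x)))
  (- \int[mu]_x (K x * sin (dot p x))) p K1 h1).
- ring.
- by apply: continuous_measurable_fun; exact: continuous_cos.
- by move=> t; rewrite ler_norml cos_geN1 cos_le1.
- move=> y; rewrite mulNr ![_ * cos (dot p y)]mulrC ![_ * sin (dot p y)]mulrC.
  rewrite -(RintZ _ Kc) -(RintZ _ Ks) -(RintB (L1Z _ Kc) (L1Z _ Ks)); apply: eq_Rint => x.
  by rewrite cosD; ring.
Qed.

Lemma fourier_convolution_im K h p : L1 mu K -> L1 mu h ->
  fc * fourier_im (convolution K h) p =
    fourier_re K p * fourier_im h p + fourier_im K p * fourier_re h p.
Proof.
move=> K1 h1; have [Kc Ks] := L1_cos_sin p K1.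
rewrite /fourier_re /fourier_im -/fc.
rewrite (@Rint_convolution_mul K h sin (\int[mu]_x (K x * sin (dot p x)))
  (\int[mu]_x (K x * cos (dot p x))) p K1 h1).
- ring.
- by apply: continuous_measurable_fun; exact: continuous_sin.
- by move=> t; rewrite ler_norml sin_geN1 sin_le1.
- move=> y; rewrite ![_ * cos (dot p y)]mulrC ![_ * sin (dot p y)]mulrC.
  rewrite -(RintZ _ Kc) -(RintZ _ Ks) -(RintD (L1Z _ Ks) (L1Z _ Kc)); apply: eq_Rint => x.
  by rewrite sinD; ring.
Qed.

(** The squared modulus of the Fourier transform. *)
Definition fsq h p : R := fourier_re h p ^+ 2 + fourier_im h p ^+ 2.

Lemma fourier_convolution_sqr K h p : L1 mu K -> L1 mu h ->
  fsq (convolution K h) p = fc ^- 2 * (fsq K p * fsq h p).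
Proof.
move=> K1 h1; have E1 := fourier_convolution_re p K1 h1; have E2 := fourier_convolution_im p K1 h1.
have f0 : (fc : R) != 0 by rewrite gt_eqF// fc_gt0.
apply: (@mulfI _ (fc ^+ 2)); first by rewrite expf_neq0.
rewrite mulrA divff ?expf_neq0// mul1r /fsq mulrDr -!exprMn E1 E2; ring.
Qed.

(** Bounding the cosine and sine integrals separately would lose a factor 2. Pairing h with C cos +
    S sin, which is at most r in absolute value, gives the sharp modulus bound on which the stated
    constants rest. *)
Lemma fourier_sqr_le h p : L1 mu h ->
  fsq h p <= fc ^+ 2 * (\int[mu]_x `|h x|) ^+ 2.
Proof.
move=> h1; have [c1 s1] := L1_cos_sin p h1.
rewrite /fsq /fourier_re /fourier_im -/fc sqrrN !exprMn -mulrDr ler_wpM2l ?sqr_ge0//.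
set C := \int[mu]_x _; set S := \int[mu]_x (h x * sin _); set N := \int[mu]_x _.
have N0 : 0 <= N by apply: Rintegral_ge0.
set r := Num.sqrt (C ^+ 2 + S ^+ 2).
have key : C ^+ 2 + S ^+ 2 <= r * N.
  have -> : C ^+ 2 + S ^+ 2 = \int[mu]_x (C * (h x * cos (dot p x)) + S * (h x * sin (dot p x))).
    by rewrite (RintD (L1Z C c1) (L1Z S s1)) (RintZ _ c1) (RintZ _ s1) !expr2.
  have L := L1D (L1Z C c1) (L1Z S s1).
  rewrite -(RintZ r (L1_norm h1)); apply: (Rint_le L (L1Z r (L1_norm h1))) => x.
  apply: le_trans (ler_norm _) _.
  have -> : C * (h x * cos (dot p x)) + S * (h x * sin (dot p x)) =
     (C * cos (dot p x) + S * sin (dot p x)) * h x by ring.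
  rewrite normrM ler_wpM2r// /r -sqrtr_sqr ler_wsqrtr//.
  (* Lagrange's identity: (C^2 + S^2)(cos^2 + sin^2) - (C cos + S sin)^2 is a square. *)
  rewrite -subr_ge0 (_ : _ - _ = (C * sin (dot p x) - S * cos (dot p x)) ^+ 2) ?sqr_ge0//.
  rewrite -[C ^+ 2]mulr1 -[S ^+ 2]mulr1 -(cos2Dsin2 (dot p x)); ring.
have [r0|r0] := eqVneq (C ^+ 2 + S ^+ 2) 0; first by rewrite r0 sqr_ge0.
have rp : 0 < C ^+ 2 + S ^+ 2 by rewrite lt_def r0 addr_ge0 ?sqr_ge0.
have rs : 0 < r by rewrite sqrtr_gt0.
move: key; rewrite -{1}(sqr_sqrtr (ltW rp)) expr2 ler_pM2l// => key.
by rewrite -(sqr_sqrtr (ltW rp)) lerXn2r ?nnegrE// ltW.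
Qed.

(** Identities between powers of |p| can fail at the origin, where [powR] takes conventional
    values. *)
Lemma enorm_gt0_ae : {ae mu, forall p, 0 < enorm p}.
Proof.
apply: filterS (ae_neq3 (0 : R3 R)) => p [p1 p2 p3].
rewrite /enorm sqrtr_gt0 /dot -!expr2 addr_gt0//; last by rewrite lt_def sqrf_eq0 p3 sqr_ge0.
by rewrite addr_gt0// lt_def sqrf_eq0 ?p1 ?p2 sqr_ge0.
Qed.

(* |p|^2 |u^| <= |p|^(2 - 2 s1) |f^|, so |p|^2 u^ is the transform of some L^2 function. *)
Lemma in_H2_linear_solution s1 s2 u f : 0 < s1 -> s1 < s2 -> s1 < 1 -> L2 mu u ->
  L1 mu f -> frac_lap_L2 (1 - s1) f -> solves s1 s2 u f -> in_H2 u.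
Proof.
move=> s10 s12 s11 u2 f1 lf su; split; first exact/Lfun2P.
have [a [b Hu]] := isF_total u2.
have sym := solves_symbol su f1 Hu.
have Hf := isF_frac_lap_L1 f1 lf.
have [_ A2 B2 _] := isF_plancherel Hf.
have [ma mb _] := Hu.
have m2 := measurable_enorm_pow (2 * 1).
have key : {ae mu, forall p, `|enorm p `^ (2 * 1) * a p| <= `|enorm p `^ (2 * (1 - s1)) * fourier_re f p| /\
   `|enorm p `^ (2 * 1) * b p| <= `|enorm p `^ (2 * (1 - s1)) * fourier_im f p|}.
  apply: filterS2 sym enorm_gt0_ae => p [<- <-] p0.
  have E : enorm p `^ (2 * 1) = enorm p `^ (2 * (1 - s1)) * enorm p `^ (2 * s1).
    by rewrite -powRD ?(gt_eqF p0) ?implybT//; congr (_ `^ _); ring.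
  rewrite /symbol E !normrM -!mulrA; split; rewrite ler_wpM2l// ler_wpM2r// !ger0_norm ?addr_ge0 ?powR_ge0// lerDl powR_ge0//.
have L2_le_ae (c d : R3 R -> R) : measurable_fun [set: R3 R] c -> L2 mu d ->
    {ae mu, forall p, `|c p| <= `|d p|} -> L2 mu c.
  move=> mc d2 cd.
  (* The bound holds only off a null set; [c'] vanishes where it fails, so that [L2_le] applies. *)
  pose c' p : R := if `|c p| <= `|d p| then c p else 0.
  have mc' : measurable_fun [set: R3 R] c'.
    apply: measurable_fun_ifT => //.
    by apply: measurable_fun_ler; apply: measurableT_comp => //; exact: d2.1.
  apply: (@L2_ae _ _ _ _ c') => //.
    by apply: (L2_le mc' _ d2) => p; rewrite /c'; case: ifP; rewrite ?normr0.
  by apply: filterS cd => p cdp; rewrite /c' cdp.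
have a2 : L2 mu (fun p => enorm p `^ (2 * 1) * a p).
  apply: L2_le_ae A2 _; first exact: measurable_funM.
  by apply: filterS key => p [].
have b2 : L2 mu (fun p => enorm p `^ (2 * 1) * b p).
  apply: L2_le_ae B2 _; first exact: measurable_funM.
  by apply: filterS key => p [].
have [w Hw] : exists w, isF w (fun p => enorm p `^ (2 * 1) * a p) (fun p => enorm p `^ (2 * 1) * b p).
  apply: isF_exists => //.
  by apply: filterS (isF_parity Hu) => p [-> ->]; rewrite enormN mulrN.
exact: is_frac_lap_isF Hu Hw.
Qed.

End FractionalSymbols.

(** * Integral of a negative power of the norm over a ball *)

Section BallVolume.
Context {R : realType}.
Local Notation mu := (@leb3 R).
Local Notation leb := (@lebesgue_measure R).
Implicit Types (c s t r : R).

(** The substitution x = c sin t turns the integrand into 2 c^2 cos^2 t, with antiderivative c^2 (t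
    + sin t cos t). *)
Lemma integral_half_disk c : 0 <= c ->
  (\int[leb]_(x in `[(- c)%R, c]) (2 * Num.sqrt (c ^+ 2 - x ^+ 2))%:E = (pi * c ^+ 2)%:E)%E.
Proof.
rewrite le_eqVlt => /predU1P[<-|c0].
  by rewrite oppr0 set_itv1 integral_set1 expr0n/= mulr0.
have pi0 := pi_gt0 R.
pose F (t : R) := c * sin t.
have dF (t : R) : is_derive t 1 F (c * cos t).
  by apply: is_derive_eq; rewrite /GRing.scale/=; ring.
have F'E : F^`()%classic = (fun t => c * cos t).
  by apply/funext => t; rewrite derive1E; have [_ ->] := dF t.
have cF' : continuous (fun t : R => c * cos t).
  by move=> t; apply: cvgM; [exact: cvg_cst|exact: continuous_cos].
have cF (t : R) : {for t, continuous F}.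
  by apply: cvgM; [exact: cvg_cst|exact: continuous_sin].
have sub : F (- (pi / 2)) = - c /\ F (pi / 2) = c.
  by rewrite /F sinN sin_pihalf mulrN mulr1.
have ab : - (pi / 2) <= pi / 2 :> R by lra.
have := @integration_by_substitution_increasing R F (fun x => 2 * Num.sqrt (c ^+ 2 - x ^+ 2)) _ _ ab.
rewrite sub.1 sub.2 F'E => ->.
- pose P (t : R) := c ^+ 2 * (t + sin t * cos t).
  have dP (t : R) : is_derive t 1 P (2 * c ^+ 2 * cos t ^+ 2).
    apply: is_derive_eq; rewrite /GRing.scale/=.
    have := cos2Dsin2 t => h; rewrite -[X in _ * (X + _)](h); ring.
  transitivity (\int[leb]_(t in `[(- (pi / 2))%R, (pi / 2)%R]) (2 * c ^+ 2 * cos t ^+ 2)%:E)%E.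
    apply: eq_integral; move=> t /set_mem /=; rewrite in_itv/= => /andP[t1 t2]; congr EFin.
    have ct : 0 <= cos t by apply: cos_ge0_pihalf; rewrite t1 t2.
    have E : c ^+ 2 - (c * sin t) ^+ 2 = (c * cos t) ^+ 2.
      by rewrite -[X in X - _]mulr1 -(cos2Dsin2 t); ring.
    rewrite /F /= fctE /= E.
    by rewrite sqrtr_sqr ger0_norm ?mulr_ge0 ?(ltW c0)//; ring.
  rewrite (@continuous_FTC2 _ _ P)//.
  + by rewrite /P -EFinB cosN cos_pihalf !mulr0 !addr0; congr EFin; field.
  + by lra.
  + apply: continuous_subspaceT => t; apply: cvgM; first exact: cvg_cst.
    by apply: (@cvgM _ _ _ _ cos cos); exact: continuous_cos.
  + split.
    * by move=> x _; have [] := dP x.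
    * by apply: cvg_at_right_filter; exact: is_derive_continuous (dP (- (pi / 2))).
    * by apply: cvg_at_left_filter; exact: is_derive_continuous (dP (pi / 2)).
  + by move=> t _; rewrite derive1E; have [_ ->] := dP t.
- move=> x y xI yI xy; rewrite /F ltr_pM2l//.
  by rewrite ltr_sin.
- by move=> x _; exact: cF'.
- by apply/cvg_ex; exists (c * cos (- (pi / 2))); apply: cvg_at_right_filter; exact: cF'.
- by apply/cvg_ex; exists (c * cos (pi / 2)); apply: cvg_at_left_filter; exact: cF'.
- split.
  + by move=> x _; have [] := dF x.
  + by apply: cvg_at_right_filter; exact: cF.
  + by apply: cvg_at_left_filter; exact: cF.
- apply: continuous_subspaceT => x; apply: cvgM; first exact: cvg_cst.
  apply: continuous_cvg; first exact: sqrt_continuous.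
  by apply: cvgB; [exact: cvg_cst|apply: (@cvgM _ _ _ _ id id); exact: cvg_id].
Qed.

(** For negative c the set is empty and [Num.sqrt] is 0, so slices that miss the disk are covered as
    well. *)
Lemma leb_sqr_le c : leb [set t : measurableTypeR R | t ^+ 2 <= c] = (2 * Num.sqrt c)%:E.
Proof.
have [c0|c0] := leP 0 c.
  have -> : [set t : R | t ^+ 2 <= c] = `[- Num.sqrt c, Num.sqrt c]%classic.
    apply/seteqP; split => t /=; rewrite in_itv/= -ler_norml.
      by move=> h; rewrite -sqrtr_sqr ler_wsqrtr.
    by move=> h; rewrite -(sqr_sqrtr c0) -(real_normK (num_real t)) lerXn2r ?nnegrE// sqrtr_ge0.
  rewrite lebesgue_measure_itv/= lte_fin.
  have := sqrtr_ge0 c; case: ifP => [_ _|/negbT]; first by rewrite -EFinB; congr EFin; ring.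
  by rewrite -leNgt => ? ?; congr EFin; lra.
rewrite ltr0_sqrtr// mulr0 (_ : [set t : R | _] = set0) ?measure0//.
apply/seteqP; split => t //=; have := sqr_ge0 t; lra.
Qed.

Lemma leb2_disk c : (@leb2 R) [set x | x.1 ^+ 2 + x.2 ^+ 2 <= c] = (pi * Num.max c 0)%:E.
Proof.
have [c0|c0] := leP 0 c; last first.
  rewrite mulr0 (_ : [set x | _] = set0) ?measure0//.
  apply/seteqP; split => x //=; have := sqr_ge0 x.1; have := sqr_ge0 x.2; lra.
transitivity (\int[leb]_x (2 * Num.sqrt (c - x ^+ 2))%:E)%E.
  apply: eq_integral => x _ /=; rewrite -leb_sqr_le; congr (leb _).
  apply/seteqP; split => y; rewrite /xsection/= inE/=; lra.
have s0 := sqrtr_ge0 c; rewrite -[in RHS](sqr_sqrtr c0) -(integral_half_disk s0).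
rewrite [RHS]integral_mkcond; apply: eq_integral => x _.
rewrite patchE sqr_sqrtr//; case: ifPn => // /negP xc; congr EFin.
rewrite ler0_sqrtr ?mulr0// leNgt; apply/negP => h; apply: xc; apply/mem_set => /=.
by rewrite in_itv/= -ler_norml -sqrtr_sqr ler_wsqrtr//; lra.
Qed.

Lemma measurable_ball t : measurable [set p : R3 R | enorm p <= t].
Proof.
rewrite -[X in measurable X]setTI (_ : [set p | _] = (@enorm R) @^-1` `]-oo, t]%classic).
  exact: measurable_enorm.
by apply/seteqP; split => p; rewrite /= in_itv.
Qed.

Lemma leb3_ball t : 0 <= t -> mu [set p | enorm p <= t] = (4 / 3 * pi * t ^+ 3)%:E.
Proof.
move=> t0; set A := [set p | _]; have mA : measurable A := measurable_ball t.
have AE : A = [set p : R3 R | p.1.1 ^+ 2 + p.1.2 ^+ 2 <= t ^+ 2 - p.2 ^+ 2].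
  apply/seteqP; split => p; rewrite /A /= /enorm /dot -!expr2 => h.
    have h0 : 0 <= p.1.1 ^+ 2 + p.1.2 ^+ 2 + p.2 ^+ 2 by rewrite !addr_ge0 ?sqr_ge0.
    have : Num.sqrt (p.1.1 ^+ 2 + p.1.2 ^+ 2 + p.2 ^+ 2) ^+ 2 <= t ^+ 2.
      by rewrite lerXn2r ?nnegrE ?sqrtr_ge0.
    by rewrite sqr_sqrtr//; lra.
  by rewrite -(ger0_norm t0) -sqrtr_sqr ler_wsqrtr//; lra.
have -> : mu A = (\int[mu]_p (\1_A p)%:E)%E by rewrite integral_indic// setIT.
rewrite (@fubini_tonelli2 _ _ _ _ _ (@leb2 R) leb); last 2 first.
- by apply/measurable_EFinP; exact: measurable_indic.
- by move=> p; rewrite lee_fin indicE.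
(* The slice at height z is a disk of squared radius t^2 - z^2, of zero area beyond |z| = t. *)
transitivity (\int[leb]_(z in `[(- t)%R, t]) (pi * (t ^+ 2 - z ^+ 2))%:E)%E.
  rewrite [RHS]integral_mkcond; apply: eq_integral => z _.
  rewrite /fubini_G.
  have mB : measurable [set x : measurableTypeR R * measurableTypeR R | A (x, z)].
    have := measurable_ysection z mA; congr measurable.
    by apply/seteqP; split => x; rewrite /ysection /= inE.
  transitivity ((@leb2 R) [set x | A (x, z)]).
    have := integral_indic (@leb2 R) measurableT mB; rewrite setIT => <-.
    by apply: eq_integral => x _; rewrite !indicE; congr ((_ : bool)%:R%:E); apply/idP/idP; rewrite !inE.
  have -> : [set x | A (x, z)] = [set x | x.1 ^+ 2 + x.2 ^+ 2 <= t ^+ 2 - z ^+ 2] by rewrite AE.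
  rewrite leb2_disk patchE; case: ifPn => [/set_mem|/negP zt] /=.
    rewrite in_itv/= => /andP[? ?]; congr (_ * _)%:E; apply/max_idPl; nra.
  rewrite (_ : Num.max _ _ = 0) ?mulr0//; apply/max_idPr; rewrite leNgt; apply/negP => h.
  apply: zt; apply/mem_set; rewrite /= in_itv/= -ler_norml -(ger0_norm t0) -!sqrtr_sqr.
  by rewrite ler_wsqrtr//; lra.
move: t0; rewrite le_eqVlt => /predU1P[<-|t0].
  by rewrite oppr0 set_itv1 integral_set1 expr0n/= mulr0.
pose F (z : R) := pi * (t ^+ 2 * z - z ^+ 3 / 3).
have dF (z : R) : is_derive z 1 F (pi * (t ^+ 2 - z ^+ 2)).
  apply: is_derive_eq; rewrite /GRing.scale/=; field.
  by [].
have cF (z : R) : {for z, continuous F}.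
  exact: is_derive_continuous (dF z).
rewrite (@continuous_FTC2 _ _ F)//.
- by rewrite /F -EFinB; congr EFin; field.
- lra.
- apply: continuous_subspaceT => z; apply: cvgM; first exact: cvg_cst.
  by apply: cvgB; [exact: cvg_cst|apply: (@cvgM _ _ _ _ id id); exact: cvg_id].
- split.
  + by move=> z _; have [] := dF z.
  + by apply: cvg_at_right_filter; exact: cF.
  + by apply: cvg_at_left_filter; exact: cF.
- by move=> z _; rewrite derive1E; have [_ ->] := dF z.
Qed.

Lemma measurable_superlevel s r : measurable [set z : R3 R * measurableTypeR R |
  [/\ enorm z.1 <= r, 0 < z.2 & z.2 < enorm z.1 `^ (- (4 * s))]].
Proof.
have m1 : measurable_fun [set: R3 R * measurableTypeR R] (fun z => enorm z.1).
  by apply: (measurableT_comp measurable_enorm).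
have m2 : measurable_fun [set: R3 R * measurableTypeR R] (fun z => enorm z.1 `^ (- (4 * s))).
  by apply: (measurableT_comp (measurable_enorm_pow _)).
have m3 : measurable_fun [set: R3 R * measurableTypeR R] (fun z => (z.2 : R)) by exact: measurable_snd.
have b1 : measurable_fun [set: R3 R * measurableTypeR R] (fun z => [&& enorm z.1 <= r, 0 < z.2 & z.2 < enorm z.1 `^ (- (4 * s))]).
  apply: measurable_and; first by apply: measurable_fun_ler => //; exact: measurable_cst.
  apply: measurable_and; first by apply: measurable_fun_ltr => //; exact: measurable_cst.
  exact: measurable_fun_ltr.
have := b1 measurableT [set true] I; rewrite setTI; congr measurable.
apply/seteqP; split => z /=; first by move=> /and3P[].
by move=> [? ? ?]; apply/and3P.
Qed.

Lemma cvgy_powR_neg (k : R) : k < 0 -> t `^ k @[t --> +oo] --> (0 : R).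
Proof.
move=> k0; apply/cvgrPdist_le => e e0; have k0' : 0 < - k by rewrite oppr_gt0.
exists (e^-1 `^ (- k)^-1); split; first exact: num_real.
move=> t et; have e1 : 0 <= e^-1 by rewrite invr_ge0 ltW.
have t0 : 0 < t by apply: le_lt_trans et; exact: powR_ge0.
rewrite sub0r normrN ger0_norm ?powR_ge0// -[k]opprK powRN.
rewrite -[leRHS]invrK lef_pV2 ?posrE ?powR_gt0 ?invr_gt0//.
have -> : e^-1 = (e^-1 `^ (- k)^-1) `^ (- k).
  by rewrite -powRrM mulVf ?gt_eqF// powRr1.
by apply: ge0_ler_powR; rewrite ?nnegrE ?powR_ge0// ?ltW.
Qed.

Lemma powR_lt_inv (s t v : R) : 0 < s -> 0 < t -> 0 <= v -> t < v `^ (- (4 * s)) ->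
  v <= t `^ (- (4 * s)^-1).
Proof.
move=> s0 t0 v0 h; have s4 : 0 < 4 * s by rewrite mulr_gt0.
(* A power of 0 with nonzero exponent is 0 by convention, so v = 0 contradicts 0 < t < v^(-4 s). *)
have v0' : 0 < v.
  rewrite lt_def v0 andbT; apply/eqP => ve; move: h; rewrite ve powR0.
    by move/(lt_trans t0); rewrite ltxx.
  by rewrite oppr_eq0 gt_eqF.
have -> : v = (v `^ (4 * s)) `^ (4 * s)^-1.
  by rewrite -powRrM divff ?gt_eqF// powRr1.
have -> : t `^ (- (4 * s)^-1) = (t^-1) `^ (4 * s)^-1.
  by rewrite -(powR_inv1 (ltW t0)) -powRrM mulN1r.
apply: ge0_ler_powR; rewrite ?nnegrE ?powR_ge0 ?invr_ge0 ?(ltW s4) ?(ltW t0)//.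
rewrite -[leLHS]invrK lef_pV2 ?posrE ?invr_gt0 ?powR_gt0// -powRN; exact: ltW.
Qed.

(** The exponent 1 - 3 / (4 s) of the antiderivative is negative because s < 3 / 4, so the boundary
    term at infinity vanishes. *)
Lemma integral_powR_tail s (a : R) : 0 < s -> s < 3 / 4 -> 0 < a ->
  (\int[leb]_(t in `[a, +oo[) (4 / 3 * pi * t `^ (- (3 / (4 * s))))%:E =
   (4 / 3 * pi * (4 * s / (3 - 4 * s)) * a `^ (1 - 3 / (4 * s)))%:E)%E.
Proof.
move=> s0 s1 a0; have s3 : 0 < 3 - 4 * s by lra.
have pi0 := pi_ge0 R.
pose k : R := 1 - 3 / (4 * s).
have kE : k = - ((3 - 4 * s) / (4 * s)) by rewrite /k; field; rewrite gt_eqF.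
have k0 : k < 0 by rewrite kE oppr_lt0 divr_gt0// mulr_gt0.
pose F (t : R) := 4 / 3 * pi * (k^-1 * t `^ k).
have dF (t : R) : 0 < t -> is_derive t 1 F (4 / 3 * pi * t `^ (- (3 / (4 * s)))).
  move=> t0; have d := is_derive1_powR k t0.
  apply: is_derive_eq; rewrite /GRing.scale/=.
  have -> : k - 1 = - (3 / (4 * s)) by rewrite /k; ring.
  by field; rewrite lt_eqF.
have cP (q t : R) : 0 < t -> {for t, continuous (fun t : R => t `^ q)}.
  move=> t0; apply: differentiable_continuous; apply/derivable1_diffP.
  by have [] := is_derive1_powR q t0.
rewrite (@ge0_continuous_FTC2y _ _ F a 0).
- rewrite sub0e -EFinN; congr EFin; rewrite /F -/k kE; field.
  by rewrite !gt_eqF.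
- by move=> t _; rewrite !mulr_ge0 ?powR_ge0.
- apply: continuous_in_subspaceT => t /set_mem/=; rewrite in_itv/= andbT => at_.
  by apply: cvgM; [exact: cvg_cst|apply: cP; exact: lt_le_trans at_].
- rewrite -[X in _ --> X](mulr0 (4 / 3 * pi)); apply: cvgM; first exact: cvg_cst.
  rewrite -[X in _ --> X](mulr0 k^-1); apply: cvgM; first exact: cvg_cst.
  exact: cvgy_powR_neg.
- by move=> t at_; have [] := dF t (lt_trans a0 at_).
- apply: cvg_at_right_filter; apply: differentiable_continuous; apply/derivable1_diffP.
  by have [] := dF a a0.
- move=> t; rewrite in_itv/= andbT => at_; rewrite derive1E.
  by have [_ ->] := dF t (lt_trans a0 at_).
Qed.

(* Layer cake: the power is the length of the interval of values below it. *)
Lemma integral_ball_powR s r : 0 < s -> s < 3 / 4 -> 0 < r ->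
  (\int[mu]_p ((enorm p `^ (- (4 * s))) * \1_[set p | enorm p <= r] p)%:E
    <= (4 * pi * r `^ (3 - 4 * s) / (3 - 4 * s))%:E)%E.
Proof.
move=> s0 s1 r0; have pi0 := pi_ge0 R; have s3 : 0 < 3 - 4 * s by lra.
pose E := [set z : R3 R * measurableTypeR R |
  [/\ enorm z.1 <= r, 0 < z.2 & z.2 < enorm z.1 `^ (- (4 * s))]].
have mE : measurable E := measurable_superlevel s r.
have mfE : measurable_fun [set: R3 R * measurableTypeR R] (fun z => (\1_E z : R)%:E).
  by apply/measurable_EFinP; exact: measurable_indic.
have -> : (\int[mu]_p ((enorm p `^ (- (4 * s))) * \1_[set p | enorm p <= r] p)%:E =
    \int[(mu \x leb)%E]_z (\1_E z)%:E)%E.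
  rewrite (@fubini_tonelli1 _ _ _ _ _ mu leb)//.
  apply: eq_integral => p _; rewrite /fubini_F /= indicE.
  have [/set_mem/= pr|npr] := boolP (p \in [set p | enorm p <= r]).
    rewrite mulr1; transitivity (leb `]0, enorm p `^ (- (4 * s))[%classic).
      rewrite lebesgue_measure_itv/= lte_fin; case: ifP; rewrite ?oppr0 ?adde0//.
      by move=> /negbT; rewrite -leNgt => h; congr EFin; apply/le_anti; rewrite h powR_ge0.
    have := @integral_indic _ _ _ leb setT measurableT `]0, enorm p `^ (- (4 * s))[%classic (measurable_itv _).
    rewrite setIT => <-.
    apply: eq_integral => t _; congr EFin; rewrite !indicE; congr ((_ : bool)%:R).
    by apply/idP/idP => /set_mem; rewrite /E /= ?in_itv/=; [move=> /andP[? ?]|move=> [_ ? ?]];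
      apply/mem_set => /=; rewrite ?in_itv/=; [split|apply/andP; split].
  rewrite mulr0 -[LHS](integral0 leb setT); apply: eq_integral => t _; congr EFin.
  by rewrite indicE memNset// => -[pr _ _]; move/negP : npr; apply; apply/mem_set.
rewrite (@fubini_tonelli2 _ _ _ _ _ mu leb)//.
(* Up to the level a the superlevel set lies in the whole ball of radius r, of volume [V]; above it,
   in the ball of radius t^(-1/(4 s)), of volume [g t]. *)
pose a := r `^ (- (4 * s)); have a0 : 0 < a by exact: powR_gt0.
pose V := 4 / 3 * pi * r ^+ 3; pose g t := 4 / 3 * pi * t `^ (- (3 / (4 * s))).
have V0 : 0 <= V by apply: mulr_ge0; [rewrite !mulr_ge0|rewrite exprn_ge0// ltW].
have g0 t : 0 <= g t by apply: mulr_ge0; [rewrite !mulr_ge0|exact: powR_ge0].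
have mg : measurable_fun [set: R] g.
  by apply: measurable_funM; [exact: measurable_cst|exact: measurable_powR].
pose B1 (t : measurableTypeR R) : \bar R := (V * \1_(`]0, a]%classic) t)%:E.
pose B2 (t : measurableTypeR R) : \bar R := (g t * \1_(`[a, +oo[%classic) t)%:E.
have mB1 : measurable_fun [set: measurableTypeR R] B1.
  by apply/measurable_EFinP; apply: measurable_funM; [exact: measurable_cst|exact: measurable_indic].
have mB2 : measurable_fun [set: measurableTypeR R] B2.
  by apply/measurable_EFinP; apply: measurable_funM => //; exact: measurable_indic.
have B10 t : (0 <= B1 t)%E by rewrite lee_fin mulr_ge0// indicE.
have B20 t : (0 <= B2 t)%E by rewrite lee_fin mulr_ge0// indicE.
apply: (@le_trans _ _ (\int[leb]_t (B1 t + B2 t))%E).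
  apply: ge0_le_integral => //.
  - by move=> t _; apply: integral_ge0 => p _; rewrite lee_fin indicE.
  - by apply: measurable_fun_fubini_tonelli_G => // z; rewrite lee_fin indicE.
  - exact: emeasurable_funD.
  move=> t _; rewrite /fubini_G.
  have mEt : measurable [set p | E (p, t)].
    have := measurable_ysection t mE; congr measurable.
    by apply/seteqP; split => p; rewrite /ysection /= inE.
  have -> : (\int[mu]_p (\1_E (p, t))%:E = mu [set p | E (p, t)])%E.
    have := integral_indic mu measurableT mEt; rewrite setIT => <-.
    by apply: eq_integral => p _; rewrite !indicE; congr ((_ : bool)%:R%:E); apply/idP/idP; rewrite !inE.
  have [t0|t0] := leP t 0.
    rewrite (_ : [set p | _] = set0) ?measure0 ?adde_ge0//.
    by apply/seteqP; split => p //= -[_ /(le_lt_trans t0)]; rewrite ltxx.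
  have [ta|ta] := leP t a.
    apply: (@le_trans _ _ (B1 t)); last by rewrite leeDl.
    rewrite /B1 indicE mem_set/=; last by rewrite in_itv/= t0 ta.
    rewrite mulr1 /V -leb3_ball ?(ltW r0)//; apply: le_measure.
    - by rewrite inE.
    - by rewrite inE; exact: measurable_ball.
    - by move=> p [].
  apply: (@le_trans _ _ (B2 t)); last by rewrite leeDr.
  rewrite /B2 indicE mem_set/=; last by rewrite in_itv/= (ltW ta).
  have -> : g t = 4 / 3 * pi * (t `^ (- (4 * s)^-1)) ^+ 3.
    by rewrite /g -powR_mulrn ?powR_ge0// -powRrM; congr (_ * _ `^ _); field; rewrite gt_eqF.
  rewrite mulr1 -leb3_ball ?powR_ge0//; apply: le_measure.
  - by rewrite inE.
  - by rewrite inE; exact: measurable_ball.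
  - move=> p [/= _ _ h]; apply: powR_lt_inv => //; exact: sqrtr_ge0.
rewrite ge0_integralD//.
have -> : (\int[leb]_t B1 t = (V * a)%:E)%E.
  rewrite /B1; under eq_integral do rewrite EFinM.
  rewrite ge0_integralZl//; last by apply/measurable_EFinP; exact: measurable_indic.
  have mE0 : (\int[leb]_x (\1_(`]0, a]%classic : set (measurableTypeR R)) x)%:E = a%:E)%E.
    have lE : leb (`]0, a]%classic : set (measurableTypeR R)) = a%:E.
      by rewrite lebesgue_measure_itv/= lte_fin a0 oppr0 adde0.
    apply: etrans (@integral_indic _ _ _ leb setT measurableT `]0, a]%classic (measurable_itv _)) _.
    by rewrite setIT; exact: lE.
  by rewrite [X in (_ * X)%E](_ : _ = a%:E)//.
have -> : (\int[leb]_t B2 t = \int[leb]_(t in `[a, +oo[) (g t)%:E)%E.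
  rewrite [RHS]integral_mkcond; apply: eq_integral => t _; rewrite patchE /B2 indicE.
  by case: ifP => _; rewrite ?mulr1 ?mulr0.
rewrite integral_powR_tail// -EFinD lee_fin /V.
have E1 : a `^ (1 - 3 / (4 * s)) = r `^ (3 - 4 * s).
  rewrite /a -powRrM; congr (_ `^ _); field; by rewrite gt_eqF.
have E2 : r ^+ 3 * a = r `^ (3 - 4 * s).
  rewrite -powR_mulrn ?(ltW r0)// /a -powRD//; apply/implyP => _; by rewrite gt_eqF.
(* The two contributions are 4/3 pi r^(3 - 4 s) times 1 and times 4 s / (3 - 4 s), which add up to 3
   / (3 - 4 s). *)
rewrite E1 -(mulrA _ (r ^+ 3)) E2 le_eqVlt; apply/orP; left; apply/eqP; field.
by rewrite gt_eqF.
Qed.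

End BallVolume.

(** * The nonlinearity *)

Section C2Bounds.
Context {R : realType}.
Implicit Types (g k : R -> R) (L x y z : R).

(** Properness makes the [lim] in [deriv_on] unique; at an end point, too, I contains points
    arbitrarily close on one side. *)
Lemma itv_dnbhs_proper L z : 0 < L -> z \in `[- L, L] ->
  ProperFilter (within `[- L, L]%classic z^').
Proof.
move=> L0; rewrite in_itv/= => /andP[z1 z2]; apply: Build_ProperFilter_ex => P.
rewrite /within/= /dnbhs /within /= => -[e /= e0 H].
(* With d below both e and L, a move by d from z in the direction of 0 stays inside I. *)
pose d := Num.min e L / 2.
have m0 : 0 < Num.min e L by rewrite lt_min e0.
have d0 : 0 < d by rewrite divr_gt0.
have de : d < e by apply: (@lt_le_trans _ _ (Num.min e L)); rewrite ?ge_min ?lexx// /d; lra.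
have dL : d < L by apply: (@lt_le_trans _ _ (Num.min e L)); rewrite ?ge_min ?lexx ?orbT// /d; lra.
have [zp|zn] := leP 0 z.
  exists (z - d); apply: H => /=.
  - by rewrite (_ : z - (z - d) = d) ?gtr0_norm//; ring.
  - by rewrite lt_eqF// ltrBlDr ltrDl.
  - by rewrite in_itv/=; apply/andP; split; lra.
exists (z + d); apply: H => /=.
- by rewrite (_ : z - (z + d) = - d) ?normrN ?gtr0_norm//; ring.
- by rewrite gt_eqF// ltrDl.
- by rewrite in_itv/=; apply/andP; split; lra.
Qed.

Section fixed.
Variables (L : R) (L0 : 0 < L).
Local Notation I := (`[- L, L]%classic).

Lemma deriv_on_cvg g z : derivable_on I g -> I z ->
  dquot g z y @[y --> within I z^'] --> deriv_on I g z.
Proof. by move=> dg Iz; exact: dg. Qed.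

Lemma deriv_on_eq g z (l : R) : I z -> dquot g z y @[y --> within I z^'] --> l ->
  deriv_on I g z = l.
Proof.
move=> Iz H; have PF : ProperFilter (within I z^') by exact: itv_dnbhs_proper.
exact: (cvg_lim _ H).
Qed.

Lemma derivable_on_is_derive g z : derivable_on I g -> z \in `]- L, L[ ->
  is_derive z 1 g (deriv_on I g z).
Proof.
move=> dg; rewrite in_itv/= => /andP[z1 z2].
have Iz : I z by rewrite /= in_itv/= !ltW.
have H := deriv_on_cvg dg Iz.
have H' : dquot g z y @[y --> z^'] --> deriv_on I g z.
  apply/cvgrPdist_le => e e0; move/cvgrPdist_le/(_ e e0) : H => -[d /= d0 Hd].
  have m0 : 0 < Num.min d (Num.min (L - z) (z + L)) by rewrite !lt_min d0/=; apply/andP; split; lra.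
  exists (Num.min d (Num.min (L - z) (z + L))) => // y /=; rewrite !lt_min => /and3P[yd y1 y2] yz.
  apply: Hd => //=; rewrite in_itv/=; move: y1 y2; rewrite !ltr_norml => /andP[? ?] /andP[? ?].
  by apply/andP; split; lra.
have sh : (fun h : R => h + z) h @[h --> 0^'] --> z^'.
  move=> P /= [e /= e0 HP]; exists e => //= h he h0.
  have -> : (h + z) = z - (0 - h) by ring.
  apply: HP => /=; first by rewrite (_ : z - (z - (0 - h)) = 0 - h)//; ring.
  rewrite (_ : z - (0 - h) = h + z); last by ring.
  by apply: contra h0 => /eqP hz; apply/eqP; move: hz; lra.
have c : h^-1 *: (g (h *: 1 + z) - g z) @[h --> 0^'] --> deriv_on I g z.
  have := cvg_comp _ _ sh H'; apply: cvg_trans; apply: near_eq_cvg.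
  apply: nearW => h; rewrite /= /dquot /GRing.scale/= mulr1 addrK; exact: mulrC.
apply: DeriveDef; first by apply/cvg_ex; exists (deriv_on I g z).
by rewrite /derive; apply: cvg_lim.
Qed.

Lemma derivable_on_within_continuous g : derivable_on I g -> {within I, continuous g}.
Proof.
move=> dg; apply/subspace_continuousP => z Iz.
have H := deriv_on_cvg dg Iz; set D := deriv_on I g z in H.
apply/cvgrPdist_le => e e0.
move/cvgrPdist_le/(_ 1 ltr01) : H => -[d /= d0 Hd].
have D1 : 0 < `|D| + 1 by rewrite ltr_wpDl.
have m0 : 0 < Num.min d (e / (`|D| + 1)) by rewrite lt_min d0 divr_gt0.
exists (Num.min d (e / (`|D| + 1))) => // y /=; rewrite lt_min => /andP[yd ye] Iy.
have [->|yz] := eqVneq y z; first by rewrite subrr normr0 ltW.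
have := Hd y yd yz Iy; rewrite /dquot => q.
have yz0 : y - z != 0 by rewrite subr_eq0.
have -> : g z - g y = - (((g y - g z) / (y - z)) * (y - z)) by rewrite divfK//; ring.
rewrite normrN normrM.
have q' : `|(g y - g z) / (y - z)| <= `|D| + 1.
  rewrite -lerBlDl; apply: le_trans q; rewrite distrC; exact: lerB_dist.
move: ye; rewrite distrC ltr_pdivlMr// => ye.
apply: le_trans (ltW ye); rewrite mulrC; exact: ler_wpM2l.
Qed.

(** The extreme value theorem bounds the set of values, without which [sup] would be a default
    value. *)
Lemma normC_ge g z : {within I, continuous g} -> I z -> `|g z| <= normC I g.
Proof.
move=> cg Iz; apply: ub_le_sup; last by exists z.
have ab : - L <= L by rewrite -subr_ge0 opprK addr_ge0// ltW.
have cn : {within I, continuous (fun z => `|g z|)}.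
  move=> t; apply: continuous_comp; [exact: cg|exact: norm_continuous].
have [c cI Hc] := EVT_max ab cn.
by exists `|g c| => _ [t It <-]; apply: Hc.
Qed.

Lemma within_continuous_sub g a b : {within I, continuous g} -> - L <= a -> b <= L ->
  {within `[a, b], continuous g}.
Proof.
move=> cg aL bL; apply: continuous_subspaceW cg => t /=.
by rewrite !in_itv/= => /andP[? ?]; apply/andP; split; lra.
Qed.

Lemma MVT_on g x y : derivable_on I g -> I x -> I y -> y < x ->
  exists2 c, y < c < x & g x - g y = deriv_on I g c * (x - y).
Proof.
move=> dg; rewrite /= !in_itv/= => /andP[x1 x2] /andP[y1 y2] yx.
have d c : c \in `]y, x[ -> is_derive c 1 g (deriv_on I g c).
  rewrite in_itv/= => /andP[c1 c2]; apply: derivable_on_is_derive => //.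
  by rewrite in_itv/=; apply/andP; split; lra.
have [c cI ->] := MVT yx d (within_continuous_sub (derivable_on_within_continuous dg) y1 x2).
by exists c => //; move: cI; rewrite in_itv.
Qed.

Lemma lipschitz_on g (C : R) x y : derivable_on I g -> (forall z, I z -> `|deriv_on I g z| <= C) ->
  I x -> I y -> `|g x - g y| <= C * `|x - y|.
Proof.
move=> dg dC; wlog yx : x y / y <= x.
  move=> W Ix Iy; have [/W|/ltW/W] := leP y x; first exact.
  by rewrite distrC (distrC y); exact.
move=> Ix Iy; move: yx; rewrite le_eqVlt => /predU1P[->|yx].
  by rewrite !subrr !normr0 mulr0.
have [c /andP[c1 c2] ->] := MVT_on dg Ix Iy yx.
rewrite normrM ler_wpM2r// dC//; move: Ix Iy; rewrite /= !in_itv/= => /andP[? ?] /andP[? ?].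
by apply/andP; split; lra.
Qed.

(** The plain mean value inequality would lose the factor 1/2. As g' lies between -C |z| and C |z|,
    the functions C z^2 / 2 - g and C z^2 / 2 + g are monotone on each side of 0; points of opposite
    sign are joined through 0. *)
Lemma quadratic_on g (C : R) x y : derivable_on I g ->
  (forall z, I z -> `|deriv_on I g z| <= C * `|z|) -> 0 <= C ->
  I x -> I y -> `|g x - g y| <= C / 2 * (`|x - y| * (`|x| + `|y|)).
Proof.
move=> dg dC C0.
(* The mean value theorem for g(z) - s z^2 / 2, applied below with s = C and s = -C. *)
have corrected_MVT (s a b : R) : I a -> I b -> a <= b -> exists2 c, a < b -> a < c < b &
    (g b - s / 2 * b ^+ 2) - (g a - s / 2 * a ^+ 2) = (deriv_on I g c - s * c) * (b - a).
  move=> Ia Ib; rewrite le_eqVlt => /predU1P[->|ab].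
    by exists a; rewrite ?ltxx// !subrr mulr0.
  pose G t := g t - s / 2 * t ^+ 2.
  have dG c : c \in `]a, b[ -> is_derive c 1 G (deriv_on I g c - s * c).
    rewrite in_itv/= => cab.
    have cI : c \in `]- L, L[.
      move: Ia Ib cab; rewrite /= !in_itv/= => /andP[? ?] /andP[? ?] /andP[? ?].
      by apply/andP; split; lra.
    have d1 := derivable_on_is_derive dg cI.
    have d2 : is_derive c 1 (fun t : R => s / 2 * t ^+ 2) (s * c).
      by apply: is_derive_eq; rewrite /GRing.scale/=; field.
    exact: is_deriveB.
  have cG : {within `[a, b], continuous G}.
    move=> t; apply: cvgB.
      move: Ia Ib; rewrite /= !in_itv/= => /andP[? ?] /andP[? ?].
      exact: (within_continuous_sub (derivable_on_within_continuous dg)).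
    have c2 : continuous (fun t : R => s / 2 * t ^+ 2).
      by move=> u; apply: cvgM; [exact: cvg_cst|apply: (@cvgM _ _ _ _ id id); exact: cvg_id].
    exact: (continuous_subspaceT c2).
  have [c cab E] := MVT ab dG cG; exists c => //.
have mono (s a b : R) : I a -> I b -> a <= b ->
    (forall c, a < c < b -> deriv_on I g c <= s * c) ->
    g b - g a <= s / 2 * (b ^+ 2 - a ^+ 2).
  move=> Ia Ib ab Hc; have [c cab E] := corrected_MVT s _ _ Ia Ib ab.
  suff : (deriv_on I g c - s * c) * (b - a) <= 0 by rewrite -E; lra.
  have [->|a_b] := eqVneq a b; first by rewrite subrr mulr0.
  have ab' : a < b by rewrite lt_neqAle a_b.
  by rewrite pmulr_lle0 ?subr_gt0// subr_le0; exact/Hc/cab.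
have monoN (s a b : R) : I a -> I b -> a <= b ->
    (forall c, a < c < b -> s * c <= deriv_on I g c) ->
    s / 2 * (b ^+ 2 - a ^+ 2) <= g b - g a.
  move=> Ia Ib ab Hc; have [c cab E] := corrected_MVT s _ _ Ia Ib ab.
  suff : 0 <= (deriv_on I g c - s * c) * (b - a) by rewrite -E; lra.
  have [->|a_b] := eqVneq a b; first by rewrite subrr mulr0.
  have ab' : a < b by rewrite lt_neqAle a_b.
  by rewrite pmulr_lge0 ?subr_gt0// subr_ge0; exact/Hc/cab.
have bounds c : I c -> - (C * `|c|) <= deriv_on I g c <= C * `|c|.
  by move=> Ic; rewrite -ler_norml dC.
have between (a b c : R) : I a -> I b -> a < c < b -> I c.
  rewrite /= !in_itv/= => /andP[? ?] /andP[? ?] /andP[? ?]; by apply/andP; split; lra.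
have pos (a b : R) : I a -> I b -> 0 <= a -> a <= b -> `|g b - g a| <= C / 2 * (b ^+ 2 - a ^+ 2).
  move=> Ia Ib a0 ab.
  rewrite ler_norml; apply/andP; split.
    rewrite -mulNr -mulNr; apply: monoN => // c cab; have /andP[b1 b2] := bounds c (between _ _ _ Ia Ib cab).
    move/andP : cab => [? ?]; move: b1 b2; rewrite ger0_norm; last by lra.
    by rewrite mulNr.
  apply: mono => // c cab; have /andP[b1 b2] := bounds c (between _ _ _ Ia Ib cab).
  by move/andP : cab => [? ?]; move: b1 b2; rewrite ger0_norm//; lra.
have neg (a b : R) : I a -> I b -> b <= 0 -> a <= b -> `|g b - g a| <= C / 2 * (a ^+ 2 - b ^+ 2).
  move=> Ia Ib b0 ab.
  rewrite (_ : C / 2 * (a ^+ 2 - b ^+ 2) = - C / 2 * (b ^+ 2 - a ^+ 2)); last by ring.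
  rewrite ler_norml; apply/andP; split.
    rewrite (_ : - (- C / 2 * _) = C / 2 * (b ^+ 2 - a ^+ 2)); last by ring.
    apply: monoN => // c cab; have /andP[b1 b2] := bounds c (between _ _ _ Ia Ib cab).
    move/andP : cab => [? ?]; move: b1 b2; rewrite ler0_norm; last by lra.
    by rewrite mulrN opprK.
  apply: mono => // c cab; have /andP[b1 b2] := bounds c (between _ _ _ Ia Ib cab).
  by move/andP : cab => [? ?]; move: b1 b2; rewrite ler0_norm; [rewrite mulrN mulNr|lra].
wlog xy : x y / y <= x.
  move=> W Ix Iy; have [/W|/ltW/W] := leP y x; first exact.
  by rewrite distrC (distrC y) (addrC `|y|); exact.
move=> Ix Iy; have C2 : 0 <= C / 2 by rewrite divr_ge0.
have I0 : I 0 by rewrite /= in_itv/= oppr_le0 (ltW L0).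
have xy0 : 0 <= x - y by rewrite subr_ge0.
rewrite (ger0_norm xy0).
have [y0|y0] := leP 0 y.
  have x0 : 0 <= x by exact: le_trans xy.
  rewrite (ger0_norm x0) (ger0_norm y0); apply: le_trans (pos _ _ Iy Ix y0 xy) _.
  by rewrite ler_wpM2l//; lra.
have [x0|x0] := leP x 0.
  rewrite (ler0_norm x0) (ltr0_norm y0); apply: le_trans (neg _ _ Iy Ix x0 xy) _.
  by rewrite ler_wpM2l//; lra.
rewrite (ltr0_norm y0) (gtr0_norm x0).
have -> : g x - g y = (g x - g 0) + (g 0 - g y) by ring.
apply: le_trans (ler_normD _ _) _.
have := pos _ _ I0 Ix (lexx _) (ltW x0); have := neg _ _ Iy I0 (lexx _) (ltW y0).
rewrite expr0n/= !subr0 => h1 h2.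
(* Here x - y = |x| + |y|, and x^2 + y^2 is at most its square. *)
apply: (@le_trans _ _ (C / 2 * (x ^+ 2 + y ^+ 2))); first by rewrite mulrDr; exact: lerD h2 h1.
rewrite ler_wpM2l//; nra.
Qed.

Lemma itv_sym0 : I 0.
Proof. by rewrite /= in_itv/= oppr_le0 (ltW L0). Qed.

Lemma cvg_dquot_eq g k z (l : R) : (forall y, I y -> g y = k y) -> I z ->
  dquot g z y @[y --> within I z^'] --> l -> dquot k z y @[y --> within I z^'] --> l.
Proof.
move=> gk Iz; apply: cvg_trans; apply: near_eq_cvg.
by exists 1 => //= y _ _ Iy; rewrite /dquot !gk.
Qed.

(** Identities between first derivatives hold on I only; this lets them be differentiated once more,
    in [C2_onB]. *)
Lemma eq_derivable_on g k : (forall y, I y -> g y = k y) -> derivable_on I g ->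
  derivable_on I k /\ forall z, I z -> deriv_on I k z = deriv_on I g z.
Proof.
move=> gk dg; have H z (Iz : I z) := cvg_dquot_eq gk Iz (deriv_on_cvg dg Iz).
split=> [z Iz|z Iz]; first by apply/cvg_ex; exists (deriv_on I g z); exact: H.
exact/deriv_on_eq/H.
Qed.

Lemma derivable_onB g k : derivable_on I g -> derivable_on I k ->
  derivable_on I (g \- k) /\
  forall z, I z -> deriv_on I (g \- k) z = deriv_on I g z - deriv_on I k z.
Proof.
move=> dg dk.
have H z : I z -> dquot (g \- k) z y @[y --> within I z^'] --> deriv_on I g z - deriv_on I k z.
  move=> Iz; rewrite (_ : dquot (g \- k) z = dquot g z \- dquot k z).
    by apply: cvgB; exact: deriv_on_cvg.
  by apply/funext => y; rewrite /dquot /= -mulrBl; congr (_ * _); ring.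
split=> [z Iz|z Iz]; last exact/deriv_on_eq/H.
by apply/cvg_ex; exists (deriv_on I g z - deriv_on I k z); exact: H.
Qed.

Lemma C2_onB g k : C2_on I g -> C2_on I k -> C2_on I (g \- k).
Proof.
move=> [dg ddg cg] [dk ddk ck]; have [d E] := derivable_onB dg dk.
have [dd EE] := derivable_onB ddg ddk.
have [dd' EE'] := eq_derivable_on (fun y Iy => esym (E y Iy)) dd.
split; [exact: d|exact: dd'|]; have cB : {within I, continuous (deriv_on I (deriv_on I g) \- deriv_on I (deriv_on I k))}.
  by move=> t; apply: cvgB; [exact: cg|exact: ck].
apply: subspace_eq_continuous cB => t /set_mem It.
rewrite /from_subspace; rewrite (EE' t It); exact/esym/EE.
Qed.

Lemma C2_on_bounds k : C2_on I k ->
  [/\ 0 <= normC2 I k,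
      forall z, I z -> `|deriv_on I k z| <= normC2 I k &
      forall z, I z -> `|deriv_on I (deriv_on I k) z| <= normC2 I k].
Proof.
move=> [dk ddk ck]; have c0 := derivable_on_within_continuous dk.
have c1 := derivable_on_within_continuous ddk.
have p (f : R -> R) : {within I, continuous f} -> 0 <= normC I f.
  by move=> cf; apply: le_trans (normC_ge cf itv_sym0).
have p0 := p _ c0; have p1 := p _ c1; have p2 := p _ ck.
split => [|z Iz|z Iz]; first by rewrite !addr_ge0.
  by apply: le_trans (normC_ge c1 Iz) _; rewrite /normC2 -addrA addrCA lerDl addr_ge0.
by apply: le_trans (normC_ge ck Iz) _; rewrite /normC2 lerDr addr_ge0.
Qed.

Lemma C2_lipschitz k x y : C2_on I k -> I x -> I y ->
  `|k x - k y| <= normC2 I k * `|x - y|.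
Proof. by move=> Ck; have [_ H _] := C2_on_bounds Ck; have [dk _ _] := Ck; exact: lipschitz_on. Qed.

(** The bound on the second derivative and the vanishing of the first one at 0 give |k'(z)| <= C
    |z|. *)
Lemma C2_quadratic k x y : C2_on I k -> deriv_on I k 0 = 0 -> I x -> I y ->
  `|k x - k y| <= normC2 I k / 2 * (`|x - y| * (`|x| + `|y|)).
Proof.
move=> Ck k0; have [C0 _ H] := C2_on_bounds Ck; have [dk ddk _] := Ck.
apply: quadratic_on => // z Iz.
by have := lipschitz_on ddk H Iz itv_sym0; rewrite k0 !subr0.
Qed.

(** 0 is interior to I, where the relative derivative is the usual one. *)
Lemma deriv_on0E g : derivable_on I g -> deriv_on I g 0 = derive1 g 0.
Proof.
move=> dg; have := derivable_on_is_derive (z := 0) dg.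
rewrite in_itv/= oppr_lt0 L0 => /(_ isT) H.
by rewrite derive1E derive_val.
Qed.

Lemma measurable_patch_comp d (T : measurableType d) g (u : T -> R) : {within I, continuous g} ->
  measurable_fun setT u -> measurable_fun setT (fun t => (g \_ I) (u t)).
Proof.
move=> cg mu; apply: (measurableT_comp (f := g \_ I)) => //.
apply/(measurable_restrictT g (measurable_itv `[- L, L])); exact: subspace_continuous_measurable_fun.
Qed.

End fixed.
End C2Bounds.

(** * The energy estimate *)

Section Energy.
Context {R : realType}.
Local Notation mu := (@leb3 R).
Implicit Types (p : R3 R) (K h : R3 R -> R).

Lemma fsq_ge0 h p : 0 <= fsq h p.
Proof. by rewrite addr_ge0// sqr_ge0. Qed.

Lemma isF_L1L2 h : L1 mu h -> L2 mu h -> isF h (fourier_re h) (fourier_im h).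
Proof.
move=> h1 h2; have [mr mi] := measurable_fourier h1; split => //.
exists (hart h); split; [exact: hlim_hart| |].
  by apply: aeW => p; rewrite fourier_re_hart.
by apply: aeW => p; rewrite fourier_im_hart.
Qed.

Lemma fsq_L1 h : L1 mu h -> L2 mu h -> L1 mu (fsq h) /\ \int[mu]_p fsq h p = n2 mu h.
Proof.
move=> h1 h2; have [_ [_ r2] [_ i2] E] := isF_plancherel (isF_L1L2 h1 h2).
by split; [exact: L1D|rewrite RintD].
Qed.

Lemma fsq_frac_L1 s K : L1 mu K -> frac_lap_L2 s K ->
  L1 mu (fun p => (enorm p `^ (2 * s)) ^+ 2 * fsq K p) /\
  \int[mu]_p ((enorm p `^ (2 * s)) ^+ 2 * fsq K p) = norm_Lp 2%:E (frac_lap s K) ^+ 2.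
Proof.
move=> K1 Ks; have [w2 [_ a2] [_ b2] E] := isF_plancherel (isF_frac_lap_L1 K1 Ks).
have EE p : (enorm p `^ (2 * s)) ^+ 2 * fsq K p =
  (enorm p `^ (2 * s) * fourier_re K p) ^+ 2 + (enorm p `^ (2 * s) * fourier_im K p) ^+ 2.
  by rewrite /fsq !exprMn mulrDr.
split; first by apply: eq_L1 (L1D a2 b2) => p; rewrite EE.
by rewrite norm_Lp2E// sqr_sqrtr ?n2_ge0// E /n2 -RintD//; exact: eq_Rint.
Qed.

Lemma fsq_le h p (A : R) : L1 mu h -> \int[mu]_x `|h x| <= A -> fsq h p <= fc ^+ 2 * A ^+ 2.
Proof.
move=> h1 hA; apply: le_trans (fourier_sqr_le p h1) _.
rewrite ler_wpM2l ?sqr_ge0// lerXn2r// ?nnegrE; first by apply: Rintegral_ge0.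
by apply: le_trans hA; apply: Rintegral_ge0.
Qed.

(* Bounds for the frequencies below and above [r]. *)
Definition low_high (s : R) (k A B r : R) :=
  fc ^+ 2 * k ^+ 2 * A ^+ 2 * (4 * pi * r `^ (3 - 4 * s) / (3 - 4 * s)) +
  k ^+ 2 * r `^ (- (4 * s)) * B ^+ 2.

Lemma symbol_le (s s2 : R) p : 0 < s -> s < s2 -> 0 < enorm p ->
  0 < symbol s s2 p /\
  symbol s s2 p ^- 2 <= enorm p `^ (- (4 * s)).
Proof.
move=> s0 ss2 p0; have a0 : 0 < enorm p `^ (2 * s) by exact: powR_gt0.
have b0 : 0 < enorm p `^ (2 * s2) by exact: powR_gt0.
rewrite /symbol; split; first exact: addr_gt0.
rewrite powRN (_ : 4 * s = 2 * s * 2%:R); last by ring.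
rewrite (powRrM _ (2 * s) 2%:R) powR_mulrn ?powR_ge0// lef_pV2 ?posrE ?exprn_gt0 ?addr_gt0//.
by rewrite lerXn2r ?nnegrE ?ltW ?addr_gt0// ltrDl.
Qed.

(** The three terms of G: below r, both transforms are bounded by L^1 norms; above r, K^ is bounded
    by its L^1 norm and the inverse square of the symbol by r^(-4 s), leaving Plancherel for h; for
    the factor |p|^4, h^ is bounded by its L^1 norm, and |p|^(4 - 4 s) |K^|^2 integrates to Q^2. *)
Lemma energy_majorant (s s2 : R) K h (A B r : R) : 0 < s -> s < 3 / 4 -> s < s2 -> 0 < r ->
  L1 mu K -> frac_lap_L2 (1 - s) K -> L1 mu h -> L2 mu h ->
  \int[mu]_x `|h x| <= A -> n2 mu h <= B ^+ 2 ->
  exists G, [/\ L1 mu G,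
    forall p, 0 < enorm p -> (1 + (enorm p `^ 2) ^+ 2) *
      (fc ^- 2 * (fsq K p * fsq h p) * symbol s s2 p ^- 2) <= G p &
    \int[mu]_p G p <= low_high s (norm_Lp 1 K) A B r +
      norm_Lp 2%:E (frac_lap (1 - s) K) ^+ 2 * A ^+ 2].
Proof.
move=> s0 s34 ss2 r0 K1 Ks h1 h2 hA hB; set k := norm_Lp 1 K; set Q := norm_Lp _ (frac_lap _ _).
have kE : \int[mu]_x `|K x| <= k by rewrite /k norm_Lp1E.
have f0 : (fc : R) ^+ 2 != 0 by rewrite expf_neq0// gt_eqF// fc_gt0.
have f1 : 0 < (fc : R) ^+ 2 by rewrite exprn_gt0// fc_gt0.
pose P p : R := enorm p `^ (- (4 * s)) * \1_[set p | enorm p <= r] p.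
have P0 p : 0 <= P p by apply: mulr_ge0; [exact: powR_ge0|rewrite indicE].
have mP : measurable_fun [set: R3 R] P.
  apply: measurable_funM; first exact: measurable_enorm_pow.
  by apply: measurable_indic; exact: measurable_ball.
have PI := integral_ball_powR s0 s34 r0.
have P1 : L1 mu P by apply/L1_ge0P => //; apply: le_lt_trans PI _; rewrite ltry.
have {}PI : \int[mu]_p P p <= 4 * pi * r `^ (3 - 4 * s) / (3 - 4 * s).
  by rewrite -lee_fin RintegralE.
have [H1 HE] := fsq_L1 h1 h2; have [Q1 QE] := fsq_frac_L1 K1 Ks.
exists (fun p => (fc ^+ 2 * k ^+ 2 * A ^+ 2 * P p + k ^+ 2 * r `^ (- (4 * s)) * fsq h p) +
   A ^+ 2 * ((enorm p `^ (2 * (1 - s))) ^+ 2 * fsq K p)); split.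
- by apply: L1D; [apply: L1D|]; exact: L1Z.
- move=> p p0; have [D0 D1] := symbol_le s0 ss2 p0.
  set D := symbol _ _ _ ^- 2 in D1 *.
  have D2 : 0 <= D by rewrite invr_ge0 exprn_ge0// ltW.
  have K0 := fsq_ge0 K p; have h0 := fsq_ge0 h p.
  have fK : fsq K p <= fc ^+ 2 * k ^+ 2 by exact: fsq_le.
  have fh : fsq h p <= fc ^+ 2 * A ^+ 2 by exact: fsq_le.
  rewrite mulrDl mul1r; apply: lerD.
    have [pr|pr] := leP (enorm p) r.
      apply: ler_wpDr; first by apply: mulr_ge0 => //; apply: mulr_ge0; rewrite ?sqr_ge0 ?powR_ge0.
      rewrite /P indicE mem_set// mulr1; apply: ler_pM => //.
        by rewrite mulr_ge0 ?invr_ge0 ?(ltW f1)// mulr_ge0.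
      rewrite ler_pdivrMl//; apply: le_trans (ler_pM K0 h0 fK fh) _.
      by rewrite le_eqVlt; apply/orP; left; apply/eqP; ring.
    apply: ler_wpDl; first by apply: mulr_ge0 => //; rewrite -!exprMn sqr_ge0.
    rewrite (_ : _ * D = fc ^- 2 * fsq K p * D * fsq h p); last by rewrite mulrA -(mulrA _ (fsq h p)) (mulrC (fsq h p)) mulrA.
    rewrite ler_wpM2r//; apply: ler_pM => //.
    - by rewrite mulr_ge0 ?invr_ge0 ?(ltW f1).
    - by rewrite ler_pdivrMl.
    apply: le_trans D1 _; rewrite !powRN lef_pV2 ?posrE ?powR_gt0//.
    by apply: ge0_ler_powR; rewrite ?nnegrE ?mulr_ge0 ?ltW.
  have -> : (enorm p `^ (2 * (1 - s))) ^+ 2 = (enorm p `^ 2) ^+ 2 * enorm p `^ (- (4 * s)).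
    rewrite -(powR_mulrn 2 (powR_ge0 (enorm p) (2 * (1 - s)))) -(powR_mulrn 2 (powR_ge0 (enorm p) 2)).
    rewrite -!powRrM -powRD; first by congr (_ `^ _); ring.
    by apply/implyP => _; rewrite gt_eqF.
  rewrite (_ : A ^+ 2 * _ = (enorm p `^ 2) ^+ 2 * ((A ^+ 2 * fsq K p) * enorm p `^ (- (4 * s)))); last by ring.
  rewrite ler_wpM2l ?sqr_ge0//; apply: ler_pM => //.
    by rewrite mulr_ge0 ?invr_ge0 ?(ltW f1)// mulr_ge0.
  by rewrite ler_pdivrMl// mulrA (mulrC (fsq K p)) ler_wpM2r.
rewrite RintD; [|by apply: L1D; exact: L1Z|exact: L1Z].
rewrite RintD ?RintZ//; try exact: L1Z.
rewrite HE QE /low_high; apply: lerD; last by rewrite mulrC.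
apply: lerD; apply: ler_wpM2l => //; first by rewrite -!exprMn sqr_ge0.
by apply: mulr_ge0; [exact: sqr_ge0|exact: powR_ge0].
Qed.

(* The radius below, with r^3 = 8 pi^2 s B^2 / A^2, minimizes [low_high]. *)
Lemma low_high_opt (s k A B : R) : 0 < s -> s < 3 / 4 -> 0 < A -> 0 < B ->
  exists2 r, 0 < r & low_high s k A B r =
    k ^+ 2 * (B `^ (2 - 8 * s / 3) * A `^ (8 * s / 3)) /
    (s `^ (4 * s / 3) * pi `^ (8 * s / 3) * 2 `^ (4 * s)) * (3 / (3 - 4 * s)).
Proof.
move=> s0 s34 A0 B0; have pi0 := pi_gt0 R; have s3 : 0 < 3 - 4 * s by lra.
pose c : R := 2 ^+ 3 * pi ^+ 2 * s * B ^+ 2 / A ^+ 2.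
have c0 : 0 < c by rewrite /c !mulr_gt0// ?invr_gt0 exprn_gt0.
exists (c `^ 3^-1); first exact: powR_gt0.
set r := c `^ _; have r0 : 0 < r by exact: powR_gt0.
have r3 : r ^+ 3 = c.
  by rewrite -powR_mulrn ?powR_ge0// /r -powRrM mulVf ?powRr1 ?ltW// .
have rs : r `^ (3 - 4 * s) = c * r `^ (- (4 * s)).
  by rewrite powRD ?gt_eqF ?implybT// -r3 -powR_mulrn ?ltW.
have fcE : (fc : R) ^+ 2 * (4 * pi) = (2 * pi ^+ 2)^-1.
  by rewrite fc_sqr; move: (pi) pi0 => q q0; field; rewrite gt_eqF.
(* At the minimum the low part is 4 s / (3 - 4 s) times the high part, so the sum is 3 / (3 - 4 s)
   times the high part. *)
have -> : low_high s k A B r = k ^+ 2 * (r `^ (- (4 * s)) * B ^+ 2) * (3 / (3 - 4 * s)).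
  rewrite /low_high rs.
  rewrite (_ : fc ^+ 2 * k ^+ 2 * A ^+ 2 * _ = (fc ^+ 2 * (4 * pi)) * (k ^+ 2 * A ^+ 2 * (c * r `^ (- (4 * s)) / (3 - 4 * s)))); last by move: (pi) (r `^ _) (fc) => q z t; field; rewrite gt_eqF.
  by rewrite fcE /c; move: (r `^ _) (pi) pi0 => z q q0; field; rewrite !gt_eqF.
congr (_ * _); rewrite -[RHS]mulrA; congr (_ * _).
have rE : r `^ (- (4 * s)) = (2 ^+ 3) `^ (- (4 * s / 3)) * (pi ^+ 2) `^ (- (4 * s / 3)) * s `^ (- (4 * s / 3)) *
    (B ^+ 2) `^ (- (4 * s / 3)) * (A ^+ 2)^-1 `^ (- (4 * s / 3)).
  rewrite /r -powRrM (_ : 3^-1 * - (4 * s) = - (4 * s / 3)); last by field.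
  rewrite /c !powRM ?invr_ge0 ?exprn_ge0 ?mulr_ge0 ?sqr_ge0 ?ltW//.
have pX (x t : R) (n : nat) : 0 <= x -> (x ^+ n) `^ t = x `^ (n%:R * t).
  by move=> x0; rewrite -powR_mulrn// powRrM.
have AV : (A ^- 2) `^ (- (4 * s / 3)) = A `^ (8 * s / 3).
  rewrite -powR_inv1 ?sqr_ge0// -powRrM pX ?(ltW A0)//.
  by congr (_ `^ _); field.
rewrite rE AV.
rewrite !pX ?ltW//.
rewrite (_ : 3%:R * - (4 * s / 3) = - (4 * s)); last by field.
rewrite (_ : 2%:R * - (4 * s / 3) = - (8 * s / 3)); last by field.
rewrite (_ : 2 - 8 * s / 3 = - (8 * s / 3) + 2%:R); last by ring.
rewrite powRD; last by apply/implyP => _; rewrite gt_eqF.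
rewrite (powR_mulrn 2 (ltW B0)) !invfM !powRN.
ring.
Qed.

End Energy.

(** * The H^2 norm for a sum of two sources *)

Section EnergyEstimate.
Context {R : realType}.
Local Notation mu := (@leb3 R).
Implicit Types (p : R3 R) (K h w : R3 R -> R).

Lemma Rint_le_ae (f g : R3 R -> R) : L1 mu f -> L1 mu g -> {ae mu, forall x, f x <= g x} ->
  \int[mu]_x f x <= \int[mu]_x g x.
Proof.
(* Twice the positive part of f - g: it vanishes almost everywhere, and adding it to g - f gives a
   function nonnegative everywhere. *)
move=> f1 g1 fg; pose u x := (f x - g x) + `|f x - g x|.
have u1 : L1 mu u by apply: L1D; [exact: L1B|exact/L1_norm/L1B].
have u0 : \int[mu]_x u x = \int[mu]_x (cst 0 x : R).
  apply: Rint_ae; [exact: L1_measurable u1|exact: measurable_cst|].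
  by apply: filterS fg => x fg; rewrite /u ler0_norm ?subr_le0// subrr.
have z0 : \int[mu]_x (cst 0 x : R) = 0 by rewrite /Rintegral integral0.
rewrite -subr_ge0 -RintB//.
have -> : \int[mu]_x (g x - f x) = \int[mu]_x (u x + (g x - f x)).
  rewrite [RHS]RintD ?u0 ?z0 ?add0r//; exact: L1B.
apply: Rintegral_ge0 => x _; have := normr_ge0 (f x - g x); rewrite /u; lra.
Qed.

Lemma fourierD h1 h2 p : L1 mu h1 -> L1 mu h2 ->
  fourier_re (fun x => h1 x + h2 x) p = fourier_re h1 p + fourier_re h2 p /\
  fourier_im (fun x => h1 x + h2 x) p = fourier_im h1 p + fourier_im h2 p.
Proof.
move=> a1 a2; have [c1 s1] := L1_cos_sin p a1; have [c2 s2] := L1_cos_sin p a2.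
rewrite /fourier_re /fourier_im -opprD -!mulrDr -!RintD//.
by split; [|congr (- _)]; congr (_ * _); apply: eq_Rint => x; rewrite mulrDl.
Qed.

Lemma fourierZ k h p : L1 mu h ->
  fourier_re (fun x => k * h x) p = k * fourier_re h p /\
  fourier_im (fun x => k * h x) p = k * fourier_im h p.
Proof.
move=> h1; have [c1 s1] := L1_cos_sin p h1.
have E (c : R3 R -> R) : L1 mu (fun x => h x * c x) ->
    \int[mu]_x (k * h x * c x) = k * \int[mu]_x (h x * c x).
  by move=> hc; rewrite -RintZ//; apply: eq_Rint => x; rewrite mulrA.
by rewrite /fourier_re /fourier_im (E _ c1) (E _ s1) mulrN !(mulrCA k).
Qed.

(** The weights come from 2 x y <= t x^2 + y^2 / t; optimizing t after integration recovers the
    triangle inequality, where a fixed t would lose a factor. *)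
Lemma fsqD_le h1 h2 p (t : R) : 0 < t -> L1 mu h1 -> L1 mu h2 ->
  fsq (fun x => h1 x + h2 x) p <= (1 + t) * fsq h1 p + (1 + t^-1) * fsq h2 p.
Proof.
move=> t0 a1 a2; have [E1 E2] := fourierD p a1 a2; rewrite /fsq E1 E2.
have H (x y : R) : (x + y) ^+ 2 <= (1 + t) * x ^+ 2 + (1 + t^-1) * y ^+ 2.
  rewrite -subr_ge0 (_ : _ - _ = t^-1 * (t * x - y) ^+ 2); last by field; rewrite gt_eqF.
  by rewrite mulr_ge0 ?sqr_ge0// invr_ge0 ltW.
apply: le_trans (lerD (H _ _) (H _ _)) _; by rewrite le_eqVlt; apply/orP; left; apply/eqP; ring.
Qed.

(** The optimal value of [low_high] plus the contribution of |p|^4; A and B stand for bounds on the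
    L^1 and L^2 norms of the source. *)
Definition energy_bound (s k Q A B : R) :=
  k ^+ 2 * (B `^ (2 - 8 * s / 3) * A `^ (8 * s / 3)) /
    (s `^ (4 * s / 3) * pi `^ (8 * s / 3) * 2 `^ (4 * s)) * (3 / (3 - 4 * s)) + Q ^+ 2 * A ^+ 2.

(** w is not split into solutions for h1 and h2: the sum is estimated frequency by frequency, and
    each source has its own majorant with its own radius r1 or r2. *)
Lemma norm_H2_energy (s s2 eps t : R) K h1 h2 w a b (A1 B1 A2 B2 : R) :
  0 < s -> s < 3 / 4 -> s < s2 -> 0 < t ->
  L1 mu K -> frac_lap_L2 (1 - s) K ->
  L1 mu h1 -> L2 mu h1 -> \int[mu]_x `|h1 x| <= A1 -> n2 mu h1 <= B1 ^+ 2 -> 0 < A1 -> 0 < B1 ->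
  L1 mu h2 -> L2 mu h2 -> \int[mu]_x `|h2 x| <= A2 -> n2 mu h2 <= B2 ^+ 2 -> 0 < A2 -> 0 < B2 ->
  in_H2 w -> isF w a b ->
  {ae mu, forall p,
    symbol s s2 p * a p =
      eps * fourier_re (convolution K (fun x => h1 x + h2 x)) p /\
    symbol s s2 p * b p =
      eps * fourier_im (convolution K (fun x => h1 x + h2 x)) p} ->
  norm_H2 w ^+ 2 <= eps ^+ 2 *
    ((1 + t) * energy_bound s (norm_Lp 1 K) (norm_Lp 2%:E (frac_lap (1 - s) K)) A1 B1 +
     (1 + t^-1) * energy_bound s (norm_Lp 1 K) (norm_Lp 2%:E (frac_lap (1 - s) K)) A2 B2).
Proof.
move=> s0 s34 ss2 t0 K1 Ks h11 h12 hA1 hB1 A10 B10 h21 h22 hA2 hB2 A20 B20 w2 Hw E.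
rewrite (norm_H2_sqr w2 Hw).
have h12_1 : L1 mu (fun x => h1 x + h2 x) by exact: L1D.
have [_ [ma a2] [mb b2] _] := isF_plancherel Hw.
have [_ [ml la2] [mr lb2] _] := isF_plancherel (isF_frac_lap Hw w2.2).
rewrite mulr1 in la2 lb2.
have [r1 r10 E1] := low_high_opt (norm_Lp 1 K) s0 s34 A10 B10.
have [r2 r20 E2] := low_high_opt (norm_Lp 1 K) s0 s34 A20 B20.
have [G1 [L1G1 G1p G1i]] := energy_majorant s0 s34 ss2 r10 K1 Ks h11 h12 hA1 hB1.
have [G2 [L1G2 G2p G2i]] := energy_majorant s0 s34 ss2 r20 K1 Ks h21 h22 hA2 hB2.
rewrite E1 in G1i; rewrite E2 in G2i.
have t1 : 0 <= 1 + t by rewrite addr_ge0 ?ltW.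
have t2 : 0 <= 1 + t^-1 by rewrite addr_ge0 ?invr_ge0 ?ltW.
have L1G : L1 mu (fun p => eps ^+ 2 * ((1 + t) * G1 p + (1 + t^-1) * G2 p)).
  by apply: L1Z; apply: L1D; exact: L1Z.
apply: (@le_trans _ _ (\int[mu]_p (eps ^+ 2 * ((1 + t) * G1 p + (1 + t^-1) * G2 p)))); last first.
  rewrite RintZ ?ler_wpM2l ?sqr_ge0//; last by apply: L1D; exact: L1Z.
  by rewrite RintD ?RintZ//; [apply: lerD; exact: ler_wpM2l|exact: L1Z|exact: L1Z].
rewrite /n2 -!RintD//; [|exact: L1D..].
apply: Rint_le_ae => //; first by do ?[apply: L1D].
apply: filterS2 E enorm_gt0_ae => p [Ea Eb] p0.
have [D0 _] := symbol_le s0 ss2 p0; have := G1p p p0; have := G2p p p0.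
set D := symbol _ _ _ in Ea Eb D0 * => H2 H1.
have D00 : D != 0 by rewrite gt_eqF.
have ab : a p ^+ 2 + b p ^+ 2 =
    eps ^+ 2 * (fc ^- 2 * (fsq K p * fsq (fun x => h1 x + h2 x) p) * D ^- 2).
  apply: (@mulfI _ (D ^+ 2)); first by rewrite expf_neq0.
  rewrite -(fourier_convolution_sqr p K1 h12_1) /fsq mulrDr -!exprMn Ea Eb.
  move: (fourier_re _ _) (fourier_im _ _) => X Y; rewrite !exprMn -mulrDr.
  by rewrite [RHS]mulrC -!mulrA mulVf ?mulr1// expf_neq0.
rewrite [leLHS](_ : _ = (1 + (enorm p `^ 2) ^+ 2) * (a p ^+ 2 + b p ^+ 2)); last by rewrite !exprMn; ring.
rewrite ab mulrCA ler_wpM2l ?sqr_ge0//.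
apply: le_trans (lerD (ler_wpM2l t1 H1) (ler_wpM2l t2 H2)).
set X := 1 + _ ^+ 2; set F := fsq K p; set Y := fc ^- 2.
have X0 : 0 <= X by rewrite addr_ge0// sqr_ge0.
have Y0 : 0 <= Y by rewrite invr_ge0 exprn_ge0// ltW// fc_gt0.
have F0 : 0 <= F by exact: fsq_ge0.
have Z0 : 0 <= D ^- 2 by rewrite invr_ge0 exprn_ge0// ltW.
rewrite [leLHS](_ : _ = (X * Y * F * D ^- 2) * fsq (fun x => h1 x + h2 x) p); last by ring.
rewrite [leRHS](_ : _ = (X * Y * F * D ^- 2) * ((1 + t) * fsq h1 p + (1 + t^-1) * fsq h2 p)); last by ring.
by rewrite ler_wpM2l ?fsqD_le//; do ?[apply: mulr_ge0].
Qed.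

End EnergyEstimate.

(** * Integrals of functions altered on a null set *)

Section OffNull.
Context d (T : measurableType d) {R : realType} (mu : {measure set T -> \bar R}).

(* No measurability is assumed: the integral of a nonnegative function is a supremum over
   the simple functions below it. *)
Lemma ge0_le_integral_nonmeasurable (f g : T -> \bar R) : (forall x, 0 <= f x)%E ->
  (forall x, f x <= g x)%E -> (\int[mu]_x f x <= \int[mu]_x g x)%E.
Proof.
move=> f0 fg; have g0 x : (0 <= g x)%E by exact: le_trans (fg x).
rewrite !ge0_integralTE//; apply: ereal_sup_le => _ [h /= hf <-].
by exists h => // x; exact: le_trans (fg x).
Qed.

(** f may be non-measurable on the null set N: it is squeezed between g set to 0 on N and g raised
    to +oo on N, both with the integral of g. *)
Lemma ge0_integral_off_null (f g : T -> \bar R) : (forall x, 0 <= f x)%E ->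
  (forall x, 0 <= g x)%E -> measurable_fun setT g ->
  {ae mu, forall x, f x = g x} -> (\int[mu]_x f x = \int[mu]_x g x)%E.
Proof.
move=> f0 g0 mg [N [mN N0 fgN]].
have fg x : ~ N x -> f x = g x.
  by move=> Nx; apply: contrapT => ?; apply: Nx; exact: fgN.
have mNC : measurable (~` N) by exact: measurableC.
pose lo x := (g x * (\1_(~` N) x)%:E)%E; pose hi x := (g x + +oo * (\1_N x)%:E)%E.
have i0 (A : set T) x : (0 <= (\1_A x : R)%:E)%E by rewrite lee_fin indicE.
have lo0 x : (0 <= lo x)%E by exact: mule_ge0.
have hi0 x : (0 <= hi x)%E by apply: adde_ge0 => //; exact: mule_ge0.
have mi (A : set T) : measurable A -> measurable_fun setT (fun x => (\1_A x : R)%:E).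
  by move=> mA; apply/measurable_EFinP; exact: measurable_indic.
have mlo : measurable_fun setT lo by apply: emeasurable_funM => //; exact: mi.
have mhi : measurable_fun setT hi.
  by apply: emeasurable_funD => //; apply: emeasurable_funM; [exact: measurable_cst|exact: mi].
have lof x : (lo x <= f x)%E.
  rewrite /lo indicE; rewrite in_setC.
  case: (boolP (x \in N)) => [_|/negP Nx] /=; first by rewrite mule0.
  by rewrite mule1 fg// => /mem_set.
have fhi x : (f x <= hi x)%E.
  rewrite /hi indicE; case: (boolP (x \in N)) => [_|/negP Nx] /=.
    by rewrite mule1 addey ?leey// gt_eqF// (lt_le_trans _ (g0 x)).
  by rewrite mule0 adde0 fg// => /mem_set.
have loE : (\int[mu]_x lo x = \int[mu]_x g x)%E.
  apply: ae_eq_integral => //; exists N; split => // x /= H.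
  apply: contrapT => Nx; apply: H => _; rewrite /lo indicE in_setC.
  by rewrite memNset// mule1.
have hiE : (\int[mu]_x hi x = \int[mu]_x g x)%E.
  apply: ae_eq_integral => //; exists N; split => // x /= H.
  apply: contrapT => Nx; apply: H => _; rewrite /hi indicE.
  by rewrite memNset// mule0 adde0.
apply/eqP; rewrite eq_le -{1}hiE -loE.
by rewrite !ge0_le_integral_nonmeasurable.
Qed.

Lemma Rint_off_null (f g : T -> R) : measurable_fun setT g ->
  {ae mu, forall x, f x = g x} -> \int[mu]_x f x = \int[mu]_x g x.
Proof.
move=> mg fg; rewrite /Rintegral; congr fine.
rewrite [LHS]integralE [RHS]integralE; have mg' : measurable_fun setT (EFin \o g).
  exact/measurable_EFinP.
congr (_ - _)%E; apply: ge0_integral_off_null => //.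
- exact: measurable_funepos.
- by apply: filterS fg => x E; rewrite !funeposE E.
- exact: measurable_funeneg.
- by apply: filterS fg => x E; rewrite !funenegE E.
Qed.

End OffNull.

(** * Source terms built from the nonlinearity *)

Section Superposition.
Context {R : realType}.
Local Notation mu := (@leb3 R).
Implicit Types (u v f : R3 R -> R) (k : R -> R) (C L : R).

Lemma Rint_normM_le u v : L2 mu u -> L2 mu v ->
  \int[mu]_x (`|u x| * `|v x|) <= Num.sqrt (n2 mu u) * Num.sqrt (n2 mu v).
Proof.
have n u' : n2 mu (fun x => `|u' x|) = n2 mu u'.
  by apply: eq_Rint => x; rewrite real_normK ?num_real.
have l u' : L2 mu u' -> L2 mu (fun x => `|u' x|).
  by move=> [mu' u2]; apply: (L2_le (g := u')) => // [|x]; [exact: measurableT_comp|rewrite normr_id].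
move=> u2 v2; rewrite -(n u) -(n v); apply: le_trans (ip_le (l _ u2) (l _ v2)).
exact: ler_norm.
Qed.

Section fixed.
Variables (L : R) (L0 : 0 < L).
Local Notation I := (`[- L, L]%classic).

(* Off [I] the nonlinearity is arbitrary, possibly not measurable: it is cut off there. *)
Lemma superposition_L1_L2 k u : C2_on I k -> k 0 = 0 -> deriv_on I k 0 = 0 -> L2 mu u ->
  L1 mu (fun x => (k \_ I) (u x)) /\ L2 mu (fun x => (k \_ I) (u x)).
Proof.
move=> Ck k0 dk0 [mu_ u2]; have [dk _ _] := Ck; have [C0 _ _] := C2_on_bounds L0 Ck.
have mh := measurable_patch_comp (derivable_on_within_continuous dk) mu_.
have b1 x : `|(k \_ I) (u x)| <= normC2 I k / 2 * u x ^+ 2.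
  rewrite patchE; case: ifPn => [/set_mem Iu|_]; last by rewrite normr0 mulr_ge0 ?sqr_ge0 ?divr_ge0.
  have := C2_quadratic L0 Ck dk0 Iu (itv_sym0 L0).
  by rewrite k0 !subr0 normr0 addr0 -expr2 real_normK ?num_real.
have b2 x : `|(k \_ I) (u x)| <= `|normC2 I k * u x|.
  rewrite patchE; case: ifPn => [/set_mem Iu|_]; last by rewrite normr0.
  have := C2_lipschitz L0 Ck Iu (itv_sym0 L0).
  by rewrite k0 !subr0 normrM (ger0_norm C0).
split; first by apply: (L1_le mh b1); exact: L1Z.
by apply: (L2_le mh b2); exact: L2Z.
Qed.

(** The quadratic bound and Cauchy-Schwarz control the L^1 norm, the Lipschitz bound the L^2 norm. f
    is only required to equal k(u) - k(v) almost everywhere, so that the cut-off sources fit. *)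
Lemma superposition_diff k C u v f : C2_on I k -> deriv_on I k 0 = 0 ->
  normC2 I k <= C -> L2 mu u -> L2 mu v -> L1 mu f -> L2 mu f ->
  {ae mu, forall x, [/\ I (u x), I (v x) & f x = k (u x) - k (v x)]} ->
  \int[mu]_x `|f x| <= C / 2 * (Num.sqrt (n2 mu (u \- v)) * (Num.sqrt (n2 mu u) + Num.sqrt (n2 mu v))) /\
  n2 mu f <= C ^+ 2 * n2 mu (u \- v).
Proof.
move=> Ck dk0 kC u2 v2 f1 f2 fE; have [C0 _ _] := C2_on_bounds L0 Ck.
have C1 : 0 <= C by exact: le_trans kC.
have w2 : L2 mu (u \- v) by exact: L2B.
have nL u' : L2 mu u' -> L2 mu (fun x => `|u' x|).
  by move=> [mu' ?]; apply: (L2_le (g := u')) => // [|x]; [exact: measurableT_comp|rewrite normr_id].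
have p1 := L2M (nL _ w2) (nL _ u2); have p2 := L2M (nL _ w2) (nL _ v2).
split.
  apply: (@le_trans _ _ (\int[mu]_x (C / 2 * (`|(u \- v) x| * `|u x| + `|(u \- v) x| * `|v x|)))).
    apply: Rint_le_ae; [exact: L1_norm|by apply: L1Z; exact: L1D|].
    apply: filterS fE => x [Iu Iv ->]; rewrite -mulrDr.
    apply: le_trans (C2_quadratic L0 Ck dk0 Iu Iv) _.
    by rewrite ler_wpM2r ?mulr_ge0 ?addr_ge0// ler_wpM2r.
  rewrite RintZ ?RintD//; last exact: L1D.
  by rewrite ler_wpM2l ?divr_ge0// mulrDr lerD// Rint_normM_le.
rewrite /n2 -RintZ; last exact: w2.2.
apply: Rint_le_ae; [exact: f2.2|exact/L1Z/w2.2|].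
apply: filterS fE => x [Iu Iv ->]; rewrite -exprMn -real_normK ?num_real// -[leRHS]real_normK ?num_real//.
rewrite lerXn2r ?nnegrE// normrM (ger0_norm C1).
by apply: le_trans (C2_lipschitz L0 Ck Iu Iv) _; rewrite ler_wpM2r.
Qed.

End fixed.

Lemma sobolev_ae c u : sobolev_const c -> in_H2 u -> {ae mu, forall x, `|u x| <= c * norm_H2 u}.
Proof.
move=> [_ H] u2; have := H u u2; rewrite unlock /=.
(* The L^infinity norm is defined as the essential supremum only for positive total mass; otherwise
   the whole space is a null set. *)
case: ifPn => [_ /ess_supP|]; first by apply: filterS => x /=; rewrite lee_fin.
rewrite -leNgt => mu0 _.
exists setT; split => //; apply/eqP; rewrite eq_le mu0; exact: measure_ge0.
Qed.

Lemma L2_H2 u : in_H2 u -> L2 mu u.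
Proof. by move=> [/Lfun2P]. Qed.

(** Removes a possibly non-measurable h from the equation; the equality holds at every x because
    each integral ignores the null set. *)
Lemma convolution_off_null K h h' : measurable_fun [set: R3 R] K -> measurable_fun [set: R3 R] h' ->
  {ae mu, forall x, h x = h' x} -> convolution K h = convolution K h' :> (R3 R -> R).
Proof.
move=> mK mh E; apply/funext => x; apply: Rint_off_null.
  apply: measurable_funM => //; by apply: (measurableT_comp mK); exact: (mpres_sub x).1.
by apply: filterS E => y ->.
Qed.

(** Obtained from the product formula: the convolution integrals themselves are additive only where
    they converge, hence almost everywhere. *)
Lemma fourier_convolutionB K h h' p : L1 mu K -> L1 mu h -> L1 mu h' ->
  fourier_re (convolution K h) p - fourier_re (convolution K h') p =
    fourier_re (convolution K (fun x => h x - h' x)) p /\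
  fourier_im (convolution K h) p - fourier_im (convolution K h') p =
    fourier_im (convolution K (fun x => h x - h' x)) p.
Proof.
move=> K1 h1 h1'; have f0 : (fc : R) != 0 by rewrite gt_eqF// fc_gt0.
have [E1 E2] := fourierD p h1 (L1Z (-1) h1'); have [Z1 Z2] := fourierZ (-1) p h1'.
have E : fourier_re (fun x => h x - h' x) p = fourier_re h p - fourier_re h' p /\
    fourier_im (fun x => h x - h' x) p = fourier_im h p - fourier_im h' p.
  rewrite (_ : (fun x => h x - h' x) = (fun x => h x + -1 * h' x)).
    by rewrite E1 E2 Z1 Z2 !mulN1r.
  by apply/funext => x; rewrite mulN1r.
have hB := L1B h1 h1'; have [{}E1 {}E2] := E.
have R1 := fourier_convolution_re p K1 h1; have R2 := fourier_convolution_re p K1 h1'.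
have R3 := fourier_convolution_re p K1 hB; rewrite E1 E2 in R3.
have I1 := fourier_convolution_im p K1 h1; have I2 := fourier_convolution_im p K1 h1'.
have I3 := fourier_convolution_im p K1 hB; rewrite E1 E2 in I3.
have lin (c X Y Z q q' : R) : c != 0 -> c * X = q -> c * Y = q' -> c * Z = q - q' -> X - Y = Z.
  by move=> c0 HX HY HZ; apply: (mulfI c0); rewrite mulrBr HX HY HZ.
split; [apply: (lin _ _ _ _ _ _ f0 R1 R2)|apply: (lin _ _ _ _ _ _ f0 I1 I2)].
  by rewrite R3 !mulrBr !opprD !opprK addrACA.
by rewrite I3 !mulrBr opprD addrACA.
Qed.

End Superposition.

(** * Identification of the constants *)

Section Constants.
Context {R : realType}.
Implicit Types s e x v M n k Q W C : R.

(** Here v is the ratio A / B of the L^1 to the L^2 bound in [energy_bound]. *)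
Lemma powR_splitM x v e : 0 < x -> 0 < v -> x `^ (2 - e) * (x * v) `^ e = x ^+ 2 * v `^ e.
Proof.
move=> x0 v0; rewrite powRM ?ltW// mulrA -powRD; last by apply/implyP => _; rewrite gt_eqF.
by rewrite subrK powR_mulrn ?ltW.
Qed.

Lemma powR_split2 v e : 0 < v -> v `^ e = v `^ (e - 2) * v ^+ 2.
Proof.
move=> v0; rewrite -(powR_mulrn 2 (ltW v0)) -powRD ?subrK//.
by apply/implyP => _; rewrite gt_eqF.
Qed.

Section fixed.
Variables (s n k Q : R) (s0 : 0 < s) (s34 : s < 3 / 4) (n0 : 0 <= n).

Let D := s `^ (4 * s / 3) * pi `^ (8 * s / 3) * 2 `^ (4 * s).
(** Common to both constants: sigma contains X + Q^2, and the bracket is X / 2^(8 s / 3) + Q^2 /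
    4. *)
Let X := k ^+ 2 * (n + 1) `^ (8 * s / 3 - 2) / D * (3 / (3 - 4 * s)).

Let D_gt0 : 0 < D.
Proof. by rewrite !mulr_gt0// powR_gt0// pi_gt0. Qed.

Let n1_gt0 : 0 < n + 1. Proof. by rewrite ltr_wpDl. Qed.

Let third_gt0 : 0 < 3 / (3 - 4 * s).
Proof. by rewrite divr_gt0//; move: s34; lra. Qed.

Let X_ge0 : 0 <= X.
Proof. by rewrite mulr_ge0 ?(ltW third_gt0)// divr_ge0 ?(ltW D_gt0)// mulr_ge0 ?sqr_ge0 ?powR_ge0. Qed.

Lemma bracketE : bracket s n k Q = X / 2 `^ (8 * s / 3) + Q ^+ 2 / 4.
Proof.
rewrite /bracket; congr (_ + _); rewrite /X /D [2 `^ (_ + _)]powRD ?pnatr_eq0 ?implybT// (mulrA _ (2 `^ (4 * s))).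
by rewrite (invfM _ (2 `^ (8 * s / 3))) (mulrA _ _ (2 `^ _)^-1) mulrAC.
Qed.

Lemma sigma_constE M : sigma_const s M n k Q = M * (n + 1) * Num.sqrt (X + Q ^+ 2).
Proof. by []. Qed.

Let X_gt0 : 0 < k -> 0 < X.
Proof. by move=> k0; rewrite mulr_gt0// divr_gt0// mulr_gt0 ?exprn_gt0// powR_gt0. Qed.

Lemma bracket_gt0 : 0 < k -> 0 < bracket s n k Q.
Proof.
move=> /X_gt0 X0; rewrite bracketE ltr_pwDl ?divr_ge0 ?sqr_ge0//.
by rewrite divr_gt0 ?powR_gt0.
Qed.

Lemma sigma_const_gt0 M : 0 < M -> 0 < k -> 0 < sigma_const s M n k Q.
Proof.
move=> M0 /X_gt0 X0; rewrite sigma_constE mulr_gt0 ?mulr_gt0// sqrtr_gt0.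
by rewrite ltr_pwDl ?sqr_ge0.
Qed.

Lemma bracket_ge0 : 0 <= bracket s n k Q.
Proof. by rewrite bracketE addr_ge0// divr_ge0 ?sqr_ge0// powR_ge0. Qed.

(** Ratio A / B = n + 1: the source g_1(u_1) - g_1(u_2), with W for |u_1 - u_2|. *)
Lemma energy_bound_sigma M W : 0 < M -> 0 < W ->
  energy_bound s k Q (M * W * (n + 1)) (M * W) = (sigma_const s M n k Q * W) ^+ 2.
Proof.
move=> M0 W0; rewrite /energy_bound powR_splitM ?mulr_gt0// (powR_split2 _ n1_gt0) -/D.
rewrite sigma_constE !exprMn sqr_sqrtr ?addr_ge0 ?sqr_ge0//.
rewrite /X; move: (_ `^ (_ - 2)) (D^-1) (3 / (3 - 4 * s)) => y d z; ring.
Qed.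

(** Ratio A / B = (n + 1) / 2: the source (g_1 - g_2)(u_2), whose L^1 bound involves u_2 alone. The
    halved ratio is the origin of 2^(8 s / 3) and of the 4 under Q^2. *)
Lemma energy_bound_bracket C : 0 < C ->
  energy_bound s k Q (C / 2 * (n + 1) ^+ 2) (C * (n + 1)) =
  ((n + 1) ^+ 2 * Num.sqrt (bracket s n k Q) * C) ^+ 2.
Proof.
move=> C0; rewrite /energy_bound (_ : C / 2 * _ = C * (n + 1) * ((n + 1) / 2)); last by field.
rewrite powR_splitM ?mulr_gt0// powRM ?invr_ge0 ?(ltW n1_gt0)// (powR_split2 _ n1_gt0) -/D.
rewrite !exprMn sqr_sqrtr ?bracket_ge0// bracketE /X (_ : 2^-1 `^ (8 * s / 3) = (2 `^ (8 * s / 3))^-1); last first.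
  by rewrite -powR_inv1// -powRrM mulN1r powRN.
move: (_ `^ (_ - 2)) (D^-1) (3 / (3 - 4 * s)) (_ `^ _)^-1 => y d z t; field.
by [].
Qed.

(** From s < 3 / 4 follows 2^(8 s / 3) < 4, so X + Q^2 is less than 4 times the bracket; the
    remaining factor n + 1 of H is at least 1. *)
Lemma sigma_lt_H M : 0 < M -> 0 < k -> sigma_const s M n k Q < Hconst s M n k Q.
Proof.
move=> M0 k0; have X0 := X_gt0 k0.
have p2 : 2 `^ (8 * s / 3) < 4 :> R.
  rewrite (_ : 4 = 2 `^ 2%:R); last by rewrite powR_mulrn//; ring.
  rewrite /powR !gt_eqF// ltr_expR ltr_pM2r ?ln_gt0 ?ltr1n//.
    by move: s34; lra.
have H : X + Q ^+ 2 < 4 * bracket s n k Q.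
  rewrite bracketE mulrDr (_ : 4 * (Q ^+ 2 / 4) = Q ^+ 2) ?ltrD2r; last by field.
  by rewrite mulrCA -[ltLHS]mulr1 ltr_pM2l// ltr_pdivlMr ?powR_gt0// mul1r.
have b0 := bracket_gt0 k0.
have S : Num.sqrt (X + Q ^+ 2) < 2 * Num.sqrt (bracket s n k Q).
  have -> : 2 * Num.sqrt (bracket s n k Q) = Num.sqrt (4 * bracket s n k Q).
    by rewrite sqrtrM// (_ : (4 : R) = 2 ^+ 2) ?sqrtr_sqr ?ger0_norm//; ring.
  by rewrite ltr_sqrt// mulr_gt0.
rewrite sigma_constE /Hconst; apply: (@lt_le_trans _ _ (M * (n + 1) * (2 * Num.sqrt (bracket s n k Q)))).
  by rewrite ltr_pM2l// mulr_gt0.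
rewrite (_ : 2 * M * _ * _ = M * (n + 1) * (2 * Num.sqrt (bracket s n k Q)) * (n + 1)); last first.
  by move: (Num.sqrt _) => y; ring.
rewrite ler_peMr ?lerDr//; apply: mulr_ge0; [by rewrite mulr_ge0 ?ltW|].
by apply: mulr_ge0 => //; exact: sqrtr_ge0.
Qed.

End fixed.
End Constants.

(** If K had zero L^1 norm, its Fourier transform would vanish and so would Q. Positivity makes the
    inequality of [sigma_lt_H] strict. *)
Lemma norm_L1_gt0 (R : realType) (s : R) (K : R3 R -> R) : L1 leb3 K -> frac_lap_L2 s K ->
  0 < norm_Lp 2%:E (frac_lap s K) -> 0 < norm_Lp 1 K.
Proof.
move=> K1 Ks Q0; rewrite norm_Lp1E// lt_def; apply/andP; split; last exact: Rintegral_ge0.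
apply/eqP => k0; have [_ E] := fsq_frac_L1 K1 Ks; move: Q0; rewrite lt_def => /andP[+ _].
rewrite -sqrf_eq0 -E => /eqP; apply.
rewrite (_ : \int[_]_p _ = \int[leb3]_p (0 : R)); first by rewrite /Rintegral integral0.
apply: eq_Rint => p; apply/eqP; rewrite mulf_eq0 orbC; apply/orP; left.
rewrite eq_le fsq_ge0 andbT.
by apply: le_trans (fourier_sqr_le p K1) _; rewrite k0 expr0n/= mulr0.
Qed.

(** * Comparison of the fixed points *)

Section FixedPoints.
Context {R : realType}.
Local Notation mu := (@leb3 R).
Variables (s1 s2 : R) (hs1 : 1 / 4 < s1 /\ s1 < 3 / 4) (hs2 : s1 < s2 /\ s2 < 1).
Variables (K : R3 R -> R) (K1 : L1 mu K) (hK2 : frac_lap_L2 (1 - s1) K).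
Variables (c_e : R) (hce : sobolev_const c_e).
Variables (u0 : R3 R -> R) (u0H2 : in_H2 u0).

Local Notation N := (norm_H2 u0).
Local Notation L := (c_e * N + c_e).
Local Notation I := (`[- L, L]%classic).
Local Notation k := (norm_Lp 1 K).
Local Notation Q := (norm_Lp 2%:E (frac_lap (1 - s1) K)).

Let N0 : 0 <= N. Proof. exact: norm_H2_ge0. Qed.
Let L0 : 0 < L.
Proof. by have [c0 _] := hce; rewrite ltr_wpDl// mulr_ge0// ltW. Qed.

Variables (M eps rho : R) (M0 : 0 < M) (rho1 : rho <= 1) (eps0 : 0 < eps).

Section one.
Variables (g : R -> R) (up : R3 R -> R).
Hypothesis hg : nonlinearity I M g.
Hypothesis hup : t_graph s1 s2 eps rho K u0 g up up.

Lemma nonlinearity_deriv0 : deriv_on I g 0 = 0.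
Proof. by have [_ d0 [[dg _ _] _] _] := hg; rewrite deriv_on0E. Qed.

(** The half-length of I is c_e (|u_0| + 1), and |up| <= rho <= 1. *)
Lemma fixed_point_in_itv : {ae mu, forall x, I ((u0 \+ up) x)}.
Proof.
have [[upH2 nup] _ _] := hup; have [c0 _] := hce.
apply: filterS2 (sobolev_ae hce u0H2) (sobolev_ae hce upH2) => x h0 h1.
rewrite /= in_itv/= -ler_norml; apply: le_trans (ler_normD _ _) _; apply: (lerD h0).
by apply: le_trans h1 _; rewrite -[leRHS]mulr1; apply: ler_wpM2l; [exact: ltW|exact: le_trans nup _].
Qed.

Lemma L2_fixed_point : L2 mu (u0 \+ up).
Proof. by have [[upH2 _] _ _] := hup; apply: L2D; exact: L2_H2. Qed.

Lemma fixed_point_n2 : Num.sqrt (n2 mu (u0 \+ up)) <= N + 1.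
Proof.
have [[upH2 nup] _ _] := hup; apply: le_trans (sqrt_n2D (L2_H2 u0H2) (L2_H2 upH2)) _.
apply: lerD; first exact: n2_le_norm_H2.
by apply: le_trans (n2_le_norm_H2 upH2) _; exact: le_trans rho1.
Qed.

Lemma fixed_point_source : L1 mu (fun x => (g \_ I) ((u0 \+ up) x)) /\
  L2 mu (fun x => (g \_ I) ((u0 \+ up) x)).
Proof.
have [g0 _ [Cg _] _] := hg.
by apply: superposition_L1_L2 => //; [exact: nonlinearity_deriv0|exact: L2_fixed_point].
Qed.

(** The equation on the Fourier side, with g replaced by its cut-off, which is measurable and gives
    the same convolution. *)
Lemma fixed_point_symbol a b : isF up a b ->
  {ae mu, forall p,
    symbol s1 s2 p * a p =
      eps * fourier_re (convolution K (fun x => (g \_ I) ((u0 \+ up) x))) p /\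
    symbol s1 s2 p * b p =
      eps * fourier_im (convolution K (fun x => (g \_ I) ((u0 \+ up) x))) p}.
Proof.
move=> Hup; have [_ _] := hup; have [h1 _] := fixed_point_source.
rewrite (convolution_off_null (L1_measurable K1) (L1_measurable h1)); last first.
  by apply: filterS fixed_point_in_itv => x Ix; rewrite patchE mem_set.
move=> su; have C1 := L1_convolution K1 h1.
apply: filterS (solves_symbol su (L1Z eps C1) Hup) => p [-> ->].
by have [-> ->] := fourierZ eps p C1.
Qed.

End one.

Variables (g1 g2 : R -> R) (hg1 : nonlinearity I M g1) (hg2 : nonlinearity I M g2).
Variables (up1 up2 : R3 R -> R).
Hypotheses (hup1 : t_graph s1 s2 eps rho K u0 g1 up1 up1)
  (hup2 : t_graph s1 s2 eps rho K u0 g2 up2 up2).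

Local Notation u1 := (u0 \+ up1).
Local Notation u2 := (u0 \+ up2).

Let wE : u1 \- u2 = up1 \- up2 :> (R3 R -> R).
Proof. by apply/funext => x /=; rewrite opprD addrACA subrr add0r. Qed.

Lemma fixed_point_diff_H2 : in_H2 (u1 \- u2).
Proof. by rewrite wE; have [[? _] _ _] := hup1; have [[? _] _ _] := hup2; exact: in_H2B. Qed.

(** C and |u_1 - u_2| are taken positive so that the powers split and the weight t = B / A exists;
    the degenerate cases are left to the theorem. *)
Lemma fixed_point_diff_le C : normC2 I (g1 \- g2) <= C -> 0 < C -> 0 < k ->
  0 < norm_H2 (u1 \- u2) ->
  norm_H2 (u1 \- u2) <= eps * (sigma_const s1 M N k Q * norm_H2 (u1 \- u2) +
    (N + 1) ^+ 2 * Num.sqrt (bracket s1 N k Q) * C).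
Proof.
move=> gC C0 k0; set W := norm_H2 (u1 \- u2) => W0.
have [[s14 s34] [ss2 _]] := (hs1, hs2); have s0 : 0 < s1 by move: s14; lra.
have N1 : 0 < N + 1 := ltr_wpDl N0 ltr01.
have [g10 d1 [C1 M1] _] := hg1; have [g20 d2 [C2 M2] _] := hg2.
have dg1 := nonlinearity_deriv0 hg1; have dg2 := nonlinearity_deriv0 hg2.
have u1L2 := L2_fixed_point hup1; have u2L2 := L2_fixed_point hup2.
have [h11 h12] := fixed_point_source hg1 hup1; have [h21 h22] := fixed_point_source hg2 hup2.
have [hm1 hm2] := superposition_L1_L2 L0 C1 g10 dg1 u2L2.
have I1 := fixed_point_in_itv hup1; have I2 := fixed_point_in_itv hup2.
have n1 := fixed_point_n2 hup1; have n2' := fixed_point_n2 hup2.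
(* [ha] changes the argument, [hb] the nonlinearity. *)
pose ha x := (g1 \_ I) (u1 x) - (g1 \_ I) (u2 x).
pose hb x := (g1 \_ I) (u2 x) - (g2 \_ I) (u2 x).
have ha1 : L1 mu ha by exact: L1B. have ha2 : L2 mu ha by exact: L2B.
have hb1 : L1 mu hb by exact: L1B. have hb2 : L2 mu hb by exact: L2B.
have Wn : Num.sqrt (n2 mu (u1 \- u2)) <= W by exact: n2_le_norm_H2 fixed_point_diff_H2.
have sq (x y : R) : 0 <= x -> Num.sqrt x <= y -> x <= y ^+ 2.
  by move=> x0 xy; rewrite -[x]sqr_sqrtr// lerXn2r ?nnegrE ?sqrtr_ge0// (le_trans (sqrtr_ge0 _) xy).
have [A1 B1] : \int[mu]_x `|ha x| <= M * W * (N + 1) /\ n2 mu ha <= (M * W) ^+ 2.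
  have [] := @superposition_diff _ _ L0 g1 M u1 u2 ha C1 dg1 M1 u1L2 u2L2 ha1 ha2.
    by apply: filterS2 I1 I2 => x i1 i2; split => //; rewrite /ha !patchE !mem_set.
  move=> iA nA; split.
    apply: le_trans iA _.
    (* The norms of u_1 and of u_2 are both at most N + 1, which cancels the 1/2 of the quadratic
       bound. *)
    rewrite (_ : M * W * (N + 1) = M / 2 * (W * ((N + 1) + (N + 1)))); last by field.
    rewrite ler_wpM2l ?divr_ge0 ?(ltW M0)//; apply: ler_pM => //; rewrite ?sqrtr_ge0 ?lerD//.
  apply: le_trans nA _; rewrite exprMn ler_wpM2l ?sqr_ge0//; apply: sq => //; exact: n2_ge0.
have CB := C2_onB L0 C1 C2.
have dB : deriv_on I (g1 \- g2) 0 = 0.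
  have [dg1' _ _] := C1; have [dg2' _ _] := C2.
  by have [_ ->] := derivable_onB L0 dg1' dg2'; [rewrite dg1 dg2 subrr|exact: itv_sym0].
have L20 : L2 mu (fun _ : R3 R => 0 : R).
  by have := L2Z 0 u1L2; rewrite (_ : (fun x => _) = (fun _ => 0))//; apply/funext => x; rewrite mul0r.
have n20 : n2 mu (fun _ : R3 R => 0 : R) = 0.
  by rewrite /n2 expr0n/= /Rintegral integral0.
have [A2 B2] : \int[mu]_x `|hb x| <= C / 2 * (N + 1) ^+ 2 /\ n2 mu hb <= (C * (N + 1)) ^+ 2.
  (* Comparison with the zero function, as (g1 - g2)(0) = 0; the 1/2 of the quadratic bound survives
     here. *)
  have [] := @superposition_diff _ _ L0 (g1 \- g2) C u2 (fun _ => 0) hb CB dB gC u2L2 L20 hb1 hb2.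
    apply: filterS I2 => x i2; split => //; first exact: itv_sym0.
    by rewrite /hb !patchE !mem_set//= g10 g20 !subr0.
  rewrite n20 sqrtr0 addr0 (_ : u2 \- (fun _ => 0) = u2); last by apply/funext => x /=; rewrite subr0.
  move=> iA nA; split.
    apply: le_trans iA _; rewrite ler_wpM2l ?divr_ge0 ?(ltW C0)// expr2.
    by apply: ler_pM => //; exact: sqrtr_ge0.
  apply: le_trans nA _; rewrite exprMn ler_wpM2l ?sqr_ge0//; apply: sq => //; exact: n2_ge0.
have [[up1H2 _] _ _] := hup1; have [[up2H2 _] _ _] := hup2.
have [a1 [b1 F1]] := isF_total (L2_H2 up1H2); have [a2 [b2 F2]] := isF_total (L2_H2 up2H2).
have FB := isFB F1 F2.
have HW : isF (u1 \- u2) (fun p => a1 p - a2 p) (fun p => b1 p - b2 p) by rewrite wE.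
have sym : {ae mu, forall p,
    symbol s1 s2 p * (a1 p - a2 p) =
      eps * fourier_re (convolution K (fun x => ha x + hb x)) p /\
    symbol s1 s2 p * (b1 p - b2 p) =
      eps * fourier_im (convolution K (fun x => ha x + hb x)) p}.
  rewrite (_ : (fun x => ha x + hb x) = (fun x => (g1 \_ I) (u1 x) - (g2 \_ I) (u2 x))); last first.
    by apply/funext => x; rewrite /ha /hb addrA subrK.
  apply: filterS2 (fixed_point_symbol hg1 hup1 F1) (fixed_point_symbol hg2 hup2 F2) => p.
  move=> [E1 E2] [E3 E4]; have [<- <-] := fourier_convolutionB p K1 h11 h21.
  by rewrite !mulrBr E1 E2 E3 E4.
have b0 : 0 < bracket s1 N k Q by exact: bracket_gt0.
have S0 : 0 < sigma_const s1 M N k Q by exact: sigma_const_gt0.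
set A := sigma_const s1 M N k Q * W; set B := (N + 1) ^+ 2 * _ * C.
have A0 : 0 < A by rewrite mulr_gt0.
have B0 : 0 < B by apply: mulr_gt0 => //; apply: mulr_gt0; rewrite ?exprn_gt0// sqrtr_gt0.
(* t = B / A turns (1 + t) A^2 + (1 + 1/t) B^2 into (A + B)^2. *)
have := @norm_H2_energy R s1 s2 eps (B / A) K ha hb (u1 \- u2) _ _ (M * W * (N + 1)) (M * W)
  (C / 2 * (N + 1) ^+ 2) (C * (N + 1)) s0 s34 ss2 (divr_gt0 B0 A0) K1 hK2 ha1 ha2 A1 B1
  (mulr_gt0 (mulr_gt0 M0 W0) N1) (mulr_gt0 M0 W0) hb1 hb2 A2 B2 (mulr_gt0 (divr_gt0 C0 (ltr0Sn R 1)) (exprn_gt0 2 N1)) (mulr_gt0 C0 N1)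
  fixed_point_diff_H2 HW sym.
rewrite energy_bound_sigma// energy_bound_bracket// -/A -/B -/W.
move=> H; have {}H : W ^+ 2 <= (eps * (A + B)) ^+ 2.
  move: A B A0 B0 H => x y x0 y0 H; apply: le_trans H _.
  by rewrite le_eqVlt; apply/orP; left; apply/eqP; field; rewrite !gt_eqF.
rewrite -(@ler_pXn2r _ 2) ?nnegrE ?(ltW W0)//; apply: mulr_ge0; [exact: ltW|].
by rewrite addr_ge0 ?ltW.
Qed.

End FixedPoints.

Theorem theorem1p5 (R : realType) (s1 s2 : R)
  (hs1 : 1 / 4 < s1 /\ s1 < 3 / 4) (hs2 : s1 < s2 /\ s2 < 1)
  (f K : R3 R -> R)
  (hf0 : ~ {ae @leb3 R, forall x, f x = 0})
  (hf1 : f \in Lfun (@leb3 R) 1) (hf2 : frac_lap_L2 (1 - s1) f)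
  (hK1 : K \in Lfun (@leb3 R) 1) (hK2 : frac_lap_L2 (1 - s1) K)
  (Q : R) (hQ : Q = norm_Lp 2%:E (frac_lap (1 - s1) K)) (hQ0 : 0 < Q)
  (c_e : R) (hce : sobolev_const c_e)
  (u0 : R3 R -> R) (hu0 : in_H2s s2 u0) (hu0f : solves s1 s2 u0 f)
  (I : set R)
  (hI : I = `[- (c_e * norm_H2 u0) - c_e, c_e * norm_H2 u0 + c_e]%classic)
  (M : R) (hM : 0 < M) (g1 g2 : R -> R)
  (hg1 : nonlinearity I M g1) (hg2 : nonlinearity I M g2)
  (rho : R) (hrho : 0 < rho /\ rho <= 1)
  (eps : R) (heps0 : 0 < eps)
  (heps : eps <= rho / Hconst s1 M (norm_H2 u0) (norm_Lp 1 K) Q)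
  (up1 up2 : R3 R -> R)
  (hup1 : t_graph s1 s2 eps rho K u0 g1 up1 up1)
  (hup2 : t_graph s1 s2 eps rho K u0 g2 up2 up2)
  (u1 u2 : R3 R -> R) (hu1 : u1 = u0 \+ up1) (hu2 : u2 = u0 \+ up2) :
  norm_H2 (u1 \- u2) <=
    eps / (1 - eps * sigma_const s1 M (norm_H2 u0) (norm_Lp 1 K) Q)
    * (norm_H2 u0 + 1) ^+ 2
    * Num.sqrt (bracket s1 (norm_H2 u0) (norm_Lp 1 K) Q)
    * normC2 I (g1 \- g2).
Proof.
have [s14 s34] := hs1; have [ss2 s2_1] := hs2; have s0 : 0 < s1 by move: s14; lra.
have s1_1 : s1 < 1 by move: s34; lra.
have [rho0 rho1] := hrho; have [c0 _] := hce.
have K1 : L1 leb3 K by exact/Lfun1_integrable.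
have f1 : L1 leb3 f by exact/Lfun1_integrable.
have u0H2 : in_H2 u0.
  have [/Lfun2P u0L2 _] := hu0.
  exact: (in_H2_linear_solution s0 ss2 s1_1 u0L2 f1 hf2 hu0f).
have N0 : 0 <= norm_H2 u0 := norm_H2_ge0 u0.
have {hI}IE : I = `[- (c_e * norm_H2 u0 + c_e), c_e * norm_H2 u0 + c_e]%classic by rewrite hI opprD.
subst I u1 u2 Q.
have k0 : 0 < norm_Lp 1 K by exact: norm_L1_gt0 K1 hK2 hQ0.
set sg := sigma_const _ _ _ _ _; set b := Num.sqrt (bracket _ _ _ _).
set C := normC2 _ _; set W := norm_H2 _.
(* This follows from eps sigma < eps H <= rho <= 1. *)
have sg1 : 0 < 1 - eps * sg.
  rewrite subr_gt0.
  set H := Hconst _ _ _ _ _ in heps.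
  have sH : sg < H by exact: sigma_lt_H.
  have H0 : 0 < H by apply: lt_trans sH; exact: sigma_const_gt0.
  apply: (@lt_le_trans _ _ (eps * H)); first by rewrite ltr_pM2l.
  by apply: le_trans rho1; rewrite -ler_pdivlMr.
have F0 : 0 <= eps / (1 - eps * sg) * (norm_H2 u0 + 1) ^+ 2 * b.
  apply: mulr_ge0; last exact: sqrtr_ge0.
  by apply: mulr_ge0; [rewrite divr_ge0 ?ltW|exact: sqr_ge0].
have L0 : 0 < c_e * norm_H2 u0 + c_e by exact: ltr_wpDl (mulr_ge0 (ltW c0) N0) c0.
have C0 : 0 <= C.
  have [_ _ [C1 _] _] := hg1; have [_ _ [C2 _] _] := hg2.
  by have [] := C2_on_bounds L0 (C2_onB L0 C1 C2).
have W0 : 0 <= W by exact: norm_H2_ge0.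
have [->|Wn0] := eqVneq W 0; first exact: mulr_ge0.
have Wgt0 : 0 < W by rewrite lt_def Wn0.
(* C vanishes when g1 and g2 agree on I, so the bound is proved for every positive C' >= C, and C'
   then tends to C. *)
suff H C' : C <= C' -> 0 < C' -> W <= eps / (1 - eps * sg) * (norm_H2 u0 + 1) ^+ 2 * b * C'.
  set F := _ * b in F0 H *.
  apply/ler_addgt0Pr => e e0; have F1 : 0 < F + 1 by exact: ltr_wpDl.
  apply: le_trans (H (C + e / (F + 1)) _ _) _; first by rewrite lerDl divr_ge0 ?ltW.
    by rewrite ltr_wpDl// divr_gt0.
  rewrite mulrDr lerD2l mulrCA -[leRHS]mulr1 ler_wpM2l ?(ltW e0)//.
  by rewrite ler_pdivrMr// mul1r lerDl.
move=> CC' C'0.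
have := fixed_point_diff_le hs1 hs2 K1 hK2 hce u0H2 hM rho1 heps0 hg1 hg2 hup1 hup2 CC' C'0 k0 Wgt0.
rewrite -/sg -/b -/W => H.
(* The inequality H is solved for W, which is possible because 1 - eps sigma > 0. *)
rewrite (_ : _ * C' = eps * ((norm_H2 u0 + 1) ^+ 2 * b * C') / (1 - eps * sg)).
  rewrite ler_pdivlMr//; move: H; set Y := _ * b * C'; move: (W) (sg) => w z; lra.
by move: (b) (norm_H2 u0) => y z; field; rewrite gt_eqF.
Qed.
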